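(* For any $f\in\mathcal D(U_n)_q$ (with $t=q^{2\alpha}$) $$B_{q,t}(f)=(q^2t;q^2)_n\cdot\sum_{j=0}^\infty t^j\cdot q^{2j}\cdot\frac{(q^{2j+2};q^2)_{n-1}}{(q^2;q^2)_{n-1}}\cdot p_j(\Delta_{n,q})f,$$ where the series converges in $\mathcal D(U_n)'_q$ and $$p_j(\Delta_{n,q})=\sum_{l=0}^j\frac{(q^{-2j};q^2)_l\,q^{2l}}{(q^{2n};q^2)_l\,(q^2;q^2)_l}\prod_{m=0}^{l-1}\left((1-q^{2m})(1-q^{2m+2n})-q^{2m+2n-2}(1-q^2)^2\Delta_{n,q}\right).$$
   Context: **Notation.** Fix an integer $n\ge1$, $q\in(0,1)$ and a real number $\alpha>0$. $(a;q)_m=\prod_{j=0}^{m-1}(1-aq^j)$. For $\underline i,\underline j\in\mathbb Z_{\ge0}^n$: $|\underline i|=i_1+\dots+i_n$, $\underline i\times\underline j=(i_1j_1,\dots,i_nj_n)$; $P(n)=\{\underline k\in\mathbb Z^n_{\ge0}: k_1\ge\dots\ge k_n\}$; $\mathbf z^{\underline i}=z_n^{i_n}\cdots z_1^{i_1}$, $\mathbf z^{*\underline i}=z_1^{*i_1}\cdots z_n^{*i_n}$. **Polynomials.** $\mathcal P(\mathbb C^n)_q$ is the unital $*$-algebra with generators $z_1,\dots,z_n$ and relations $z_iz_j=qz_jz_i$ ($i<j$), $z_i^*z_j=qz_jz_i^*$ ($i\ne j$), $z_j^*z_j=q^2z_jz_j^*+(1-q^2)(1-\sum_{k>j}z_kz_k^*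 )$. $\mathbb C[\mathbb C^n]_q$ is the subalgebra generated by $z_1,\dots,z_n$; the monomials $\mathbf z^{\underline m}$ form a basis of it. Put $y_i=1-z_iz_i^*-\dots-z_nz_n^*$. **Finite functions and distributions.** Let $H$ be the $\mathcal P(\mathbb C^n)_q$-module generated by a vector $e_0$ with $z_i^*e_0=0$ for all $i$; it has basis $\mathbf z^{\underline m}e_0$, carries a scalar product (unique up to scale) with $(fu,v)=(u,f^*v)$, and is a faithful representation; $y_j\mathbf z^{\underline m}e_0=q^{2(m_j+\dots+m_n)}\mathbf z^{\underline m}e_0$. Identify $\mathcal P(\mathbb C^n)_q$ with its image in $\mathrm{End}(H)$. $\mathcal D(U_n)_q$ (finite functions) is the $*$-algebra of linear operators on $H$ having finitely many nonzero matrix entries in this basis. For a function $g$ on $\mathfrak M=\{(q^{2k_1},\dots,q^{2k_n}):\underline k\in P(n)\}$, $g(y_1,\dots,y_n)$ is the diagonal operator $\mathbf z^{\underline m}e_0\mapsto g(q^{2k_1},\dots,q^{2k_n})\mathbf z^{\underline m}e_0$, $k_j=m_j+\dots+m_n$. Each $f\in\mathcal D(U_n)_q$ (resp. $f\in\mathcal P(\mathbb C^n)_q$) is uniquely a finite sum $f=\sum_{\underline i\times\underline j=\underline 0}\mathbf z^{\underline i}f_{\underline i,\underline j}(y_1,\dots,y_n)\mathbf z^{*\underline j}$ with $f_{\underline i,\underline j}$ finitely supported functions on $\mathfrak M$ (resp. polynomials). $\mathcal D(U_n)'_q$ (distributions) is the space of infinite formal sums of this form with arbitrary functions $f_{\underline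 i,\underline j}$ on $\mathfrak M$, with the topology of pointwise convergence of coefficients (equivalently, all infinite matrices in the basis $\mathbf z^{\underline m}e_0$); it is the completion of $\mathcal D(U_n)_q$ and a right $\mathcal D(U_n)_q$-module. The invariant integral on $\mathcal D(U_n)_q$ is $\int_{U_n}f\,d\nu_q=(q^2;q^2)_n\sum_{\underline k\in P(n)}f_{\underline 0,\underline 0}(q^{2k_1},\dots,q^{2k_n})q^{-2nk_1}q^{2k_2}\cdots q^{2k_n}$; it gives (by continuity) a nondegenerate pairing $(\psi,\varphi)\mapsto\int_{U_n}\psi\varphi\,d\nu_q$ of $\mathcal D(U_n)'_q$ with $\mathcal D(U_n)_q$. **Toeplitz operators.** $\int_{U_n}f\,dm_{\alpha,q}=(q^{2\alpha+2};q^2)_n\sum_{\underline k\in P(n)}f_{\underline 0,\underline 0}(q^{2k_1},\dots,q^{2k_n})q^{2k_1(\alpha+1)}q^{2k_2}\cdots q^{2k_n}$; $(f,g)_{\alpha,q}=\int_{U_n}g^*f\,dm_{\alpha,q}$; $L^2(dm_{\alpha,q})$ is the completion of $\mathcal D(U_n)_q$ for this scalar product; it contains $\mathcal P(\mathbb C^n)_q$. $P_{\alpha,q}$ is the orthogonal projection onto the closure of $\mathbb C[\mathbb C^n]_q$. $\mathbb C[\mathbb C^n]_{q,\alpha}$ denotes $\mathbb C[\mathbb C^n]_q$ with this scalar product. For $f\in\mathcal D(U_n)_q$, $T_f\in\mathrm{End}(\mathbb C[\mathbb C^n]_{q,\alpha})$ is $T_f\psi=P_{\alpha,q}(f\psi)$;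 its matrix in the basis $\mathbf z^{\underline m}$ has finitely many nonzero entries. **Covariant symbols and Berezin transform.** For an operator with finitely many nonzero matrix entries, $A\mathbf z^{\underline m}=\sum_{\underline k}A^{\underline m}_{\underline k}\mathbf z^{\underline k}$, set $\mathrm{Tr}_q(A)=\frac{(q^2;q^2)_n}{(q^{2+2\alpha};q^2)_n}\sum_{\underline m}A^{\underline m}_{\underline m}q^{-2n|\underline m|}q^{2(m_2+\dots+m_n)}q^{2(m_3+\dots+m_n)}\cdots q^{2m_n}$. The covariant symbol of $T\in\mathrm{End}(\mathbb C[\mathbb C^n]_{q,\alpha})$ is the unique $\sigma(T)\in\mathcal D(U_n)'_q$ with $\int_{U_n}\sigma(T)f\,d\nu_q=\mathrm{Tr}_q(T\,T_f)$ for all $f\in\mathcal D(U_n)_q$. The $q$-Berezin transform is $B_{q,\alpha}:\mathcal D(U_n)_q\to\mathcal D(U_n)'_q$, $f\mapsto\sigma(T_f)$. **Laplace–Beltrami operator.** With $t=q^{2\alpha}$ write $B_{q,t}=B_{q,\alpha}$; for fixed $f,g\in\mathcal D(U_n)_q$, $\int_{U_n}B_{q,t}(f)g\,d\nu_q$ is a polynomial in $t$. $\Delta_{n,q}=\frac{q^{-2n}}{1-q^2}\frac{dB_{q,t}}{dt}\big|_{t=0}$ (derivative taken in these matrix entries); it maps $\mathcal D(U_n)_q$ to itself. *)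

(* Defs.v *)
From mathcomp Require Import all_boot all_order all_algebra.
From mathcomp Require Export complex.
From mathcomp Require Import finmap.
From mathcomp Require Import mathcomp_extra boolp classical_sets functions.
From mathcomp Require Import cardinality fsbigop reals ereal.
From mathcomp Require Import topology normedtype sequences numfun esum exp.
From mathcomp Require Import ring.

Set Implicit Arguments.
Unset Strict Implicit.
Unset Printing Implicit Defensive.

Import Order.TTheory GRing.Theory Num.Theory numFieldNormedType.Exports.
Local Open Scope classical_set_scope.
Local Open Scope ring_scope.
Local Open Scope complex_scope.

(* The q-Pochhammer symbol (a; b)_m. *)
Definition qpoch (F : pzRingType) (a b : F) (m : nat) : F :=
  \prod_(j < m) (1 - a * b ^+ j).

(* Coordinates are numbered from 0: z_1, m_1, k_1 have index 0. *)
Definition mindex (n : nat) := {ffun 'I_n -> nat}.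

Section Multiindices.
Variable n : nat.
Implicit Types m k : mindex n.

Definition mzero : mindex n := [ffun=> 0%N].
Definition madd k m : mindex n := [ffun j => (k j + m j)%N].
Definition msub k m : mindex n := [ffun j => (k j - m j)%N].
Definition munit (i : 'I_n) : mindex n := [ffun j => (j == i) : nat].

(* k_j = m_j + ... + m_n, a bijection from Z_{>=0}^n onto P(n), and its
   inverse m_j = k_j - k_{j+1} (with k_{n+1} = 0). *)
Definition tails m : mindex n := [ffun j : 'I_n => \sum_(l < n | (j <= l)%N) m l]%N.
Definition gaps k : mindex n :=
  [ffun j : 'I_n => (k j - \sum_(l < n | l == j.+1 :> nat) k l)%N].
Definition Pn : set (mindex n) :=
  [set k | forall i j : 'I_n, (i <= j)%N -> (k j <= k i)%N].

End Multiindices.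

(* f k m is the matrix entry of an operator f on H at the basis vectors
   z^k e_0 (row) and z^m e_0 (column): f (z^m e_0) = \sum_k f k m z^k e_0.
   The space D(U_n)'_q is the type of all such infinite matrices. *)
Definition infmx (R : realType) (n : nat) := mindex n -> mindex n -> R[i].

Section Matrices.
Variables (R : realType) (n : nat).
Implicit Types f g : infmx R n.

(* D(U_n)_q *)
Definition finop f : Prop :=
  finite_set [set km : mindex n * mindex n | f km.1 km.2 != 0].

(* The sums over l below always have finite support. *)
Definition opmul f g : infmx R n := fun k m => \sum_(l \in setT) f k l * g l m.
Definition opid : infmx R n := fun k m => (k == m)%:R.
Definition diagop (g : mindex n -> R[i]) : infmx R n :=
  fun k m => if k == m then g m else 0.

(* The matrix with a single entry c m, in row s m, in each column m. *)
Definition monop (c : mindex n -> R[i]) (s : mindex n -> mindex n) : infmx R n :=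
  fun k m => if k == s m then c m else 0.

(* Topology of pointwise convergence of the coefficients. *)
Definition infmx_cvg (u : nat -> infmx R n) (S : infmx R n) : Prop :=
  forall k m, (fun N => u N k m : R[i]^o) @ \oo --> (S k m : R[i]^o).

Definition polyop (D : infmx R n -> infmx R n) (p : {poly R[i]}) f : infmx R n :=
  \sum_(i < size p) p`_i *: iter i D f.

End Matrices.

Section QuantumBall.
Variables (R : realType) (n : nat) (q : R).
Implicit Types (f g F G : infmx R n) (m k l : mindex n) (al : R).

(* The polynomial algebra P(C^n)_q is identified with its image in End(H), in
   the basis z^m e_0 of H. The scalar product of H is normalised by
   (e_0, e_0) = 1; then (z^m e_0, z^m e_0) = \prod_i (q^2; q^2)_{m_i}, and [adj]
   is the adjoint. The lemmas [Z_Z], [Zs_Z] and [Zs_Z_eq] below are the defining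
   relations of P(C^n)_q, [Zs_mzero] says z_i^* e_0 = 0, [zpow_mzero] says that
   z^m e_0 is the basis vector of index m, and [y_diag] gives the eigenvalues of
   the y_j. *)
Definition hnorm m : R := \prod_(i < n) qpoch (q ^+ 2) (q ^+ 2) (m i).

Definition adj f : infmx R n :=
  fun k m => conjc (f m k) * (hnorm m / hnorm k)%:C.

Definition Z (i : 'I_n) : infmx R n :=
  monop (fun m => (q ^+ (\sum_(j < n | (i < j)%N) m j)%N)%:C) (madd (munit i)).
Definition Zs (i : 'I_n) : infmx R n := adj (Z i).

(* z^m = z_n^{m_n} ... z_1^{m_1} and z^{*m} = z_1^{*m_1} ... z_n^{*m_n}. *)
Definition zpow m : infmx R n :=
  \big[@opmul R n/@opid R n]_(i <- rev (enum 'I_n))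
    iter (m i) (opmul (Z i)) (@opid R n).
Definition zspow m : infmx R n :=
  \big[@opmul R n/@opid R n]_(i <- enum 'I_n)
    iter (m i) (opmul (Zs i)) (@opid R n).

(* C[C^n]_q *)
Inductive hol : infmx R n -> Prop :=
| hol_id : hol (@opid R n)
| hol_Z i : hol (Z i)
| hol_add f g : hol f -> hol g -> hol (f + g)
| hol_scale (c : R[i]) f : hol f -> hol (c *: f)
| hol_mul f g : hol f -> hol g -> hol (opmul f g).

(* f_{0,0}(q^{2 k_1}, ..., q^{2 k_n}): in a sum of z^i f_{i,j}(y) z^{*j} with
   i x j = 0 only the term i = j = 0 contributes to the diagonal (lemma
   [normal_order_diag]), and f_{0,0}(y) multiplies z^m e_0 by the value of
   f_{0,0} at k = tails m. *)
Definition f00 f k : R[i] := f (gaps k) (gaps k).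

(* a^{k_1} q^{2 k_2} ... q^{2 k_n} *)
Definition weight (a : R) k : R :=
  \prod_(j < n) (if j == 0%N :> nat then a else q ^+ 2) ^+ k j.

Definition int_nu f : R[i] :=
  (qpoch (q ^+ 2) (q ^+ 2) n)%:C *
  \sum_(k \in @Pn n) f00 f k * (weight (q ^- (2 * n)) k)%:C.

Definition int_m al f : R[i] :=
  (qpoch (q `^ (2 * al + 2)) (q ^+ 2) n)%:C *
  \sum_(k \in @Pn n) f00 f k * (weight (q `^ (2 * al + 2)) k)%:C.

(* Absolutely convergent sums of real and complex families. *)
Definition rsum (T : choiceType) (F : T -> R) : R :=
  fine (\esum_(x in setT) (Num.max (F x) 0)%:E) -
  fine (\esum_(x in setT) (Num.max (- F x) 0)%:E).
Definition csum (T : choiceType) (F : T -> R[i]) : R[i] :=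
  rsum (fun x => complex.Re (F x)) +i* rsum (fun x => complex.Im (F x)).

(* On finite functions (f, g) |-> int_m (g^* f) is a weighted l^2 scalar product
   of the matrix entries (lemma [scal_finop]); so its completion L^2(dm) is the
   space of the infinite matrices that are square summable for this weight. *)
Definition wt2 al (lp : mindex n * mindex n) : R :=
  qpoch (q `^ (2 * al + 2)) (q ^+ 2) n *
  (hnorm lp.1 / hnorm lp.2 * weight (q `^ (2 * al + 2)) (tails lp.2)).

Definition scal al f g : R[i] :=
  csum (fun lp : mindex n * mindex n =>
          conjc (g lp.1 lp.2) * f lp.1 lp.2 * (wt2 al lp)%:C).

Definition sqnorm al f : \bar R :=
  \esum_(lp in setT)
    ((complex.Re (f lp.1 lp.2) ^+ 2 + complex.Im (f lp.1 lp.2) ^+ 2) * wt2 al lp)%:E.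

Definition L2 al : set (infmx R n) := [set f | (sqnorm al f < +oo)%E].

(* The closure of C[C^n]_q in L^2(dm), and the orthogonal projection onto it. *)
Definition hol_closure al : set (infmx R n) :=
  [set f | L2 al f /\
     forall e : R, 0 < e -> exists2 g, hol g & (sqnorm al (f - g)%R < e%:E)%E].

Definition proj al f : infmx R n :=
  xget 0 [set g | hol_closure al g /\
                  forall h, hol_closure al h -> scal al (f - g) h = 0].

Definition toeplitz al f (psi : infmx R n) : infmx R n := proj al (opmul f psi).

(* The matrix of T_f in the basis z^m of C[C^n]_q. The coefficient of z^k in an
   element psi of C[C^n]_q is the entry psi k 0, because z^k e_0 is the k-th
   basis vector of H (lemma [hol_coord]). *)
Definition toeplitz_mx al f : infmx R n :=
  fun k m => toeplitz al f (zpow m) k (mzero n).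

Definition qtrace al (A : infmx R n) : R[i] :=
  (qpoch (q ^+ 2) (q ^+ 2) n / qpoch (q `^ (2 * al + 2)) (q ^+ 2) n)%:C *
  \sum_(m \in setT) A m m * (weight (q ^- (2 * n)) (tails m))%:C.

(* The covariant symbol of an operator given by its matrix in the basis z^m. *)
Definition symbol al (T : infmx R n) : infmx R n :=
  xget 0 [set s | forall f, finop f ->
    int_nu (opmul s f) = qtrace al (opmul T (toeplitz_mx al f))].

Definition berezin al f : infmx R n := symbol al (toeplitz_mx al f).

(* int B_{q,t}(f) g dnu as a polynomial in t = q^{2 al}. *)
Definition berezin_poly f g : {poly R[i]} :=
  xget 0 [set p : {poly R[i]} | forall al, 0 < al ->
    p.[(q `^ (2 * al))%:C] = int_nu (opmul (berezin al f) g)].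

Definition dberezin0 f : infmx R n :=
  xget 0 [set s | forall g, finop g ->
    int_nu (opmul s g) = (berezin_poly f g)^`().[0]].

Definition laplace f : infmx R n :=
  ((q ^- (2 * n)) / (1 - q ^+ 2))%:C *: dberezin0 f.

End QuantumBall.

Definition berezin_pj (F : fieldType) (q : F) (n j : nat) : {poly F} :=
  \sum_(l < j.+1)
    (qpoch (q ^- (2 * j)) (q ^+ 2) l * q ^+ (2 * l) /
     (qpoch (q ^+ (2 * n)) (q ^+ 2) l * qpoch (q ^+ 2) (q ^+ 2) l)) *:
    \prod_(m < l)
      (((1 - q ^+ (2 * m)) * (1 - q ^+ (2 * m + 2 * n)))%:P
       - (q ^+ (2 * m + 2 * n - 2) * (1 - q ^+ 2) ^+ 2) *: 'X).

Section MatrixLemmas.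
Variables (R : realType) (n : nat).
Implicit Types f g : infmx R n.

Lemma infmxZE (a : R[i]) f k m : (a *: f) k m = a * f k m.
Proof. by []. Qed.

Lemma infmxDE f g k m : (f + g) k m = f k m + g k m.
Proof. by []. Qed.

Lemma fsum_only (T : choiceType) (F : T -> R[i]) (x : T) :
  (forall y, y != x -> F y = 0) -> \sum_(y \in setT) F y = F x.
Proof.
move=> Fx; rewrite -(fsbig_widen [set x] setT) ?fsbig_set1// => y [_ /= yx].
by apply: Fx; apply/eqP.
Qed.

Lemma opmul_monopr f c s k m :
  opmul f (@monop R n c s) k m = f k (s m) * c m.
Proof.
rewrite /opmul (fsum_only (x := s m)) /monop ?eqxx// => l /negPf ->.
by rewrite mulr0.
Qed.

Lemma opmul_monop c s d u :
  opmul (@monop R n c s) (monop d u) = monop (fun m => c (u m) * d m) (s \o u).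
Proof.
apply/funext => k; apply/funext => m; rewrite opmul_monopr /monop /=.
by case: ifP => // _; rewrite mul0r.
Qed.

Lemma eq_monop c s d u :
  (forall m, c m = d m) -> (forall m, c m != 0 -> s m = u m) ->
  @monop R n c s = monop d u.
Proof.
move=> cd su; apply/funext => k; apply/funext => m; rewrite /monop -cd.
have [->|/su ->//] := eqVneq (c m) 0; by do 2!case: ifP.
Qed.

Lemma opidE : @opid R n = monop (fun=> 1) id.
Proof. by apply/funext => k; apply/funext => m; rewrite /opid/monop; case: eqP. Qed.

Lemma diagopE c : @diagop R n c = monop c id.
Proof. by []. Qed.

Lemma scale_monop a c s : a *: @monop R n c s = monop (fun m => a * c m) s.
Proof.
apply/funext => k; apply/funext => m; rewrite infmxZE /monop.
by case: ifP => // _; rewrite mulr0.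
Qed.

Lemma add_monop c d s : @monop R n c s + monop d s = monop (fun m => c m + d m) s.
Proof.
apply/funext => k; apply/funext => m; rewrite infmxDE /monop.
by case: ifP => // _; rewrite addr0.
Qed.

Lemma sum_monop (I : Type) (r : seq I) (P : pred I) c s :
  \sum_(i <- r | P i) @monop R n (c i) s = monop (fun m => \sum_(i <- r | P i) c i m) s.
Proof.
elim: r => [|i r IH].
  rewrite big_nil; apply/funext => k; apply/funext => m.
  by rewrite /monop big_nil if_same.
rewrite big_cons IH; case: ifP => Pi; last first.
  by apply: eq_monop => // m; rewrite big_cons Pi.
by rewrite add_monop; apply: eq_monop => // m; rewrite big_cons Pi.
Qed.

End MatrixLemmas.

Section QuantumBallLemmas.
Variables (R : realType) (n : nat) (q : R).
Hypothesis q01 : 0 < q < 1.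
Implicit Types (f g : infmx R n) (m k l : mindex n).
Local Notation Z := (@Z R n q).
Local Notation Zs := (@Zs R n q).

Lemma q_neq0 : q != 0. Proof. by case/andP: q01 => /lt0r_neq0. Qed.

Lemma exprq2_neq1 a : q ^+ 2 * (q ^+ 2) ^+ a != 1.
Proof.
case/andP: q01 => q0 q1; rewrite -exprS -exprM lt_eqF// exprn_ilt1 ?ltW//.
Qed.

Lemma hnorm_neq0 m : hnorm q m != 0.
Proof.
apply/prodf_neq0 => i _; apply/prodf_neq0 => j _.
by rewrite subr_eq0 eq_sym exprq2_neq1.
Qed.

Lemma hnormS (i : 'I_n) m :
  hnorm q (madd (munit i) m) = hnorm q m * (1 - q ^+ (2 * (m i).+1)).
Proof.
rewrite /hnorm (bigD1 i)//= [in RHS](bigD1 i)//= !ffunE eqxx add1n.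
rewrite {1}/qpoch big_ord_recr /= -/(qpoch _ _ _) -exprS -exprM.
rewrite -!mulrA [_ * \prod_(_ | _) _]mulrC; congr (_ * (_ * _)).
by apply: eq_bigr => j /negPf ji; rewrite !ffunE ji.
Qed.

Lemma ZsE i : Zs i = monop
  (fun m => (q ^+ (\sum_(j < n | (i < j)%N) m j)%N * (1 - q ^+ (2 * m i)))%:C)
  (fun m => msub m (munit i)).
Proof.
apply/funext => k; apply/funext => m; rewrite /Defs.Zs /adj /Defs.Z /monop.
have [->|mk] := eqVneq m (madd (munit i) k).
  have -> : k == msub (madd (munit i) k) (munit i).
    by apply/eqP/ffunP => j; rewrite !ffunE addKn.
  rewrite conjc_real -rmorphM/= hnormS mulrAC divff ?hnorm_neq0// mul1r.
  congr (_ * _)%:C; last by rewrite !ffunE eqxx.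
  congr (_ ^+ _); apply: eq_bigr => j ij; rewrite !ffunE.
  by case: eqP ij => // ->; rewrite ltnn.
rewrite conjc0 mul0r; case: eqP => // km; have [mi0|mi_gt0] := posnP (m i).
  by rewrite mi0 muln0 expr0 subrr mulr0.
case/eqP: mk; rewrite km; apply/ffunP => j; rewrite !ffunE.
by case: eqP => [->|_]; rewrite ?add0n ?subn0// subnKC.
Qed.

Lemma Z_Z (i j : 'I_n) : (i < j)%N -> opmul (Z i) (Z j) = q%:C *: opmul (Z j) (Z i).
Proof.
move=> ij; rewrite /Defs.Z !opmul_monop scale_monop; apply: eq_monop => m; last first.
  by move=> _; apply/ffunP => l; rewrite !ffunE addnCA.
rewrite -!rmorphM -!exprD -exprS; congr (_ ^+ _)%:C.
have -> : (\sum_(l < n | (i < l)%N) madd (munit j) m l =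
           (\sum_(l < n | (i < l)%N) m l).+1)%N.
  rewrite (bigD1 j)//= [in RHS](bigD1 j)//= !ffunE eqxx add1n addSn.
  by congr (_ + _).+1; apply: eq_bigr => l /andP[_ /negPf lj]; rewrite !ffunE lj.
have -> : (\sum_(l < n | (j < l)%N) madd (munit i) m l =
           \sum_(l < n | (j < l)%N) m l)%N.
  apply: eq_bigr => l jl; rewrite !ffunE; case: eqP => // li.
  by move: (ltn_trans ij jl); rewrite li ltnn.
by rewrite addSn addnC.
Qed.

Lemma Zs_Z (i j : 'I_n) : i != j -> opmul (Zs i) (Z j) = q%:C *: opmul (Z j) (Zs i).
Proof.
move=> ij; rewrite ZsE /Defs.Z !opmul_monop scale_monop; apply: eq_monop => m.
  rewrite !ffunE (negPf ij) add0n -!rmorphM/=; congr (_%:C).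
  have [lt_ij|lt_ji|/ord_inj eij] := ltngtP i j; last by rewrite eij eqxx in ij.
    have -> : (\sum_(l < n | (i < l)%N) madd (munit j) m l =
           (\sum_(l < n | (i < l)%N) m l).+1)%N.
      rewrite (bigD1 j)//= [in RHS](bigD1 j)//= !ffunE eqxx add1n addSn.
      congr (_ + _).+1; apply: eq_bigr => l /andP[_ /negPf lj].
      by rewrite !ffunE lj.
    have -> : (\sum_(l < n | (j < l)%N) msub m (munit i) l =
           \sum_(l < n | (j < l)%N) m l)%N.
      apply: eq_bigr => l jl; rewrite !ffunE; case: eqP => [li|]; last by rewrite subn0.
      by move: (ltn_trans lt_ij jl); rewrite li ltnn.
    by rewrite exprS; ring.
  have -> : (\sum_(l < n | (i < l)%N) madd (munit j) m l =
           (\sum_(l < n | (i < l)%N) m l))%N.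
    apply: eq_bigr => l il; rewrite !ffunE; case: eqP => // lj.
    by move: (ltn_trans lt_ji il); rewrite lj ltnn.
  have [mi0|mi_gt0] := posnP (m i); first by rewrite mi0 muln0 expr0 subrr !(mulr0,mul0r).
  have -> : (\sum_(l < n | (j < l)%N) m l =
         (\sum_(l < n | (j < l)%N) msub m (munit i) l).+1)%N.
    rewrite (bigD1 i)//= [in RHS](bigD1 i)//= !ffunE eqxx -addSn subn1 prednK//.
    congr (_ + _)%N; apply: eq_bigr => l /andP[_ /negPf lj].
    by rewrite !ffunE lj subn0.
  by rewrite exprS; ring.
move=> _; apply/ffunP => l; rewrite !ffunE.
case: (eqVneq l j) => [->|lj]; first by rewrite eq_sym (negPf ij) !subn0.
by rewrite !add0n.
Qed.

Lemma Z_Zs (j : 'I_n) : opmul (Z j) (Zs j) = diagop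
  (fun m => (q ^+ (2 * \sum_(l < n | (j < l)%N) m l)%N * (1 - q ^+ (2 * m j)))%:C).
Proof.
rewrite ZsE /Defs.Z opmul_monop diagopE; apply: eq_monop => m.
  rewrite -rmorphM/= mulrA -exprD; congr (_ ^+ _ * _)%:C.
  rewrite mul2n -addnn; congr (_ + _)%N; apply: eq_bigr => l jl; rewrite !ffunE.
  by case: eqP jl => [->|]; rewrite ?ltnn ?subn0.
move=> c0; apply/ffunP => l; rewrite !ffunE /=; case: eqP => [->|_]; last by rewrite subn0.
rewrite subnKC// lt0n; apply: contraNneq c0 => ->.
by rewrite muln0 expr0 subrr !(mulr0,mul0r).
Qed.

Lemma telescope_y m (a : nat) :
  \sum_(j < n | (a <= j)%N)
     q ^+ (2 * \sum_(l < n | (j < l)%N) m l)%N * (1 - q ^+ (2 * m j)) =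
  1 - q ^+ (2 * \sum_(l < n | (a <= l)%N) m l)%N.
Proof.
have [d] := ubnP (n - a)%N; elim: d a => // d IH a.
have [na _|an] := leqP n a.
  rewrite !big_pred0 ?muln0 ?expr0 ?subrr// => j;
    by apply: contraTF na => aj; rewrite -ltnNge (leq_ltn_trans aj).
move=> nad; rewrite (bigD1 (Ordinal an))//=.
rewrite [in RHS](bigD1 (Ordinal an))//=.
have E (l : 'I_n) : ((a <= l) && (l != Ordinal an))%N = (a < l)%N.
  by rewrite ltn_neqAle andbC -val_eqE /= eq_sym.
rewrite (eq_bigl _ _ E) IH; last first.
  by rewrite -ltnS (leq_trans _ nad)// ltnS subnS prednK ?subn_gt0.
by rewrite (eq_bigl _ _ E) mulnDr exprD /=; ring.
Qed.

Lemma y_diag (j : nat) :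
  @opid R n - \sum_(l < n | (j <= l)%N) opmul (Z l) (Zs l) =
  diagop (fun m => (q ^+ (2 * \sum_(l < n | (j <= l)%N) m l)%N)%:C).
Proof.
under eq_bigr do rewrite Z_Zs diagopE.
rewrite sum_monop -scaleN1r scale_monop opidE add_monop; apply: eq_monop => // m.
by rewrite mulN1r -rmorph_sum telescope_y rmorphB /= opprB addrC subrK.
Qed.

Lemma Zs_Z_eq (j : 'I_n) : opmul (Zs j) (Z j) =
  (q ^+ 2)%:C *: opmul (Z j) (Zs j) +
  (1 - q ^+ 2)%:C *: (@opid R n - \sum_(l < n | (j < l)%N) opmul (Z l) (Zs l)).
Proof.
rewrite y_diag Z_Zs !diagopE !scale_monop add_monop ZsE /Defs.Z opmul_monop.
apply: eq_monop => m; last first.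
  by move=> _; apply/ffunP => l; rewrite !ffunE addKn.
rewrite -!rmorphM -rmorphD /=; congr (_%:C).
rewrite !ffunE eqxx add1n mulnS exprD.
have -> : (\sum_(l < n | (j < l)%N) madd (munit j) m l =
           \sum_(l < n | (j < l)%N) m l)%N.
  apply: eq_bigr => l jl; rewrite !ffunE.
  by case: eqP jl => // ->; rewrite ltnn.
rewrite !mul2n -!addnn !exprD.
by ring.
Qed.

Lemma Zs_mzero j k : Zs j k (mzero n) = 0.
Proof.
rewrite ZsE /monop; case: ifP => // _.
by rewrite !ffunE muln0 expr0 subrr mulr0.
Qed.
End QuantumBallLemmas.

Section Monomials.
Variables (R : realType) (n : nat) (q : R).
Hypothesis q01 : 0 < q < 1.
Implicit Types (f g : infmx R n) (m k l p : mindex n).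
Local Notation Z := (@Z R n q).
Local Notation Zs := (@Zs R n q).

Let mrestr (s : seq 'I_n) m : mindex n := [ffun j => ((j \in s) * m j)%N].

Lemma iter_Z (i : 'I_n) a : iter a (opmul (Z i)) (@opid R n) =
  monop (fun p => (q ^+ (a * \sum_(j < n | (i < j)%N) p j)%N)%:C)
        (madd [ffun j => (a * (j == i))%N]).
Proof.
elim: a => [|a IH] /=.
  rewrite opidE; apply: eq_monop => m //=.
  by move=> _; apply/ffunP => j; rewrite !ffunE.
rewrite IH opmul_monop; apply: eq_monop => m.
  rewrite -rmorphM -exprD mulSn; congr (_ ^+ (_ + _))%:C.
  apply: eq_bigr => j ij; rewrite !ffunE.
  by case: eqP ij => [->|]; rewrite ?ltnn ?muln0.
by move=> _; apply/ffunP => j; rewrite !ffunE addnA -mulSn.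
Qed.

Lemma prod_Z m (s : seq 'I_n) :
  pairwise (fun i j : 'I_n => (j < i)%N) s ->
  \big[@opmul R n/@opid R n]_(i <- s) iter (m i) (opmul (Z i)) (@opid R n) =
  monop (fun p => (q ^+ (\sum_(i <- s) m i * \sum_(j < n | (i < j)%N) p j)%N)%:C)
        (madd (mrestr s m)).
Proof.
elim: s => [_|i s IH /= /andP[/allP si ps]].
  rewrite big_nil opidE; apply: eq_monop => p; first by rewrite big_nil.
  by move=> _; apply/ffunP => j; rewrite !ffunE.
rewrite big_cons IH// iter_Z opmul_monop; apply: eq_monop => p.
  rewrite -rmorphM -exprD big_cons; congr (_ ^+ (_ * _ + _))%:C.
  apply: eq_bigr => j ij; rewrite !ffunE.
  by case: (boolP (j \in s)) => // /si ji; move: (ltn_trans ij ji); rewrite ltnn.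
move=> _; apply/ffunP => j; rewrite !ffunE inE addnA; congr (_ + _)%N.
case: (eqVneq j i) => [->|ji]; last by rewrite muln0.
by case: (boolP (i \in s)) => [/si|]; rewrite ?ltnn// mul1n muln1 addn0.
Qed.

Lemma zpowE m : zpow q m =
  monop (fun p => (q ^+ (\sum_(i < n) m i * \sum_(j < n | (i < j)%N) p j)%N)%:C)
        (madd m).
Proof.
rewrite /zpow prod_Z; last first.
  rewrite -sorted_pairwise; last by move=> i j l ji li; exact: ltn_trans li ji.
  rewrite rev_sorted; have := iota_ltn_sorted 0 n.
  by rewrite -val_enum_ord sorted_map.
apply: eq_monop => p.
  by rewrite (perm_big (enum 'I_n)) ?perm_rev// big_enum.
move=> _; apply/ffunP => j; rewrite !ffunE.
by rewrite mem_rev mem_enum mul1n.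
Qed.

Lemma zpow_mzero m k : zpow q m k (mzero n) = (k == m)%:R.
Proof.
rewrite zpowE /monop.
have -> : madd m (mzero n) = m by apply/ffunP => j; rewrite !ffunE addn0.
case: eqP => // _; rewrite big1 ?expr0// => i _.
by rewrite big1 ?muln0// => j _; rewrite ffunE.
Qed.

Lemma opmul_zpow k m : exists c, opmul (zpow q k) (zpow q m) = c *: zpow q (madd k m).
Proof.
exists (q ^+ (\sum_(i < n) k i * \sum_(j < n | (i < j)%N) m j)%N)%:C.
rewrite !zpowE opmul_monop scale_monop; apply: eq_monop => p; last first.
  by move=> _; apply/ffunP => j; rewrite !ffunE addnA.
rewrite -!rmorphM -!exprD -!big_split; congr (_ ^+ _)%:C.
apply: eq_bigr => i _; rewrite ffunE.
rewrite (eq_bigr (fun j => m j + p j)%N) => [|j _]; last by rewrite ffunE.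
by rewrite big_split /= mulnDr mulnDl addnA.
Qed.

Lemma zspowE m : exists2 c, (forall p, c p != 0 -> forall j, (m j <= p j)%N) &
  zspow q m = monop c (fun p => msub p m).
Proof.
have itE i a : exists2 c, (forall p, c p != 0 -> (a <= p i)%N) &
    iter a (opmul (Zs i)) (@opid R n) =
    monop c (fun p => msub p [ffun j => (a * (j == i))%N]).
  elim: a => [|a [c ca IH]].
    exists (fun=> 1) => //=; rewrite opidE; apply: eq_monop => // p _.
    by apply/ffunP => j; rewrite !ffunE subn0.
  rewrite /= IH ZsE// opmul_monop; eexists; last first.
    apply: eq_monop => [p|p _]; first exact: erefl.
    by apply/ffunP => j; rewrite !ffunE -subnDA addnC -mulSn.
  move=> p /=; rewrite mulf_eq0 negb_or => /andP[+ /ca ap].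
  rewrite !ffunE eqxx muln1 ltn_neqAle ap andbT; apply: contra_neq => ->.
  by rewrite subnn muln0 expr0 subrr mulr0.
suff [c cm E] : exists2 c, (forall p, c p != 0 ->
    forall j, j \in enum 'I_n -> (m j <= p j)%N) &
    zspow q m = monop c (fun p => msub p (mrestr (enum 'I_n) m)).
  exists c => [p /cm cp j|]; first by apply: cp; rewrite mem_enum.
  rewrite E; apply: eq_monop => // p _; apply/ffunP => j.
  by rewrite !ffunE mem_enum mul1n.
rewrite /zspow; elim: (enum _) (enum_uniq 'I_n) => [_|i s IH /= /andP[si us]].
  exists (fun=> 1) => //; rewrite big_nil opidE; apply: eq_monop => // p _.
  by apply/ffunP => j; rewrite !ffunE subn0.
rewrite big_cons; have [c cs ->] := IH us; have [d dm ->] := itE i (m i).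
rewrite opmul_monop; eexists; last first.
  apply: eq_monop => [p|p _]; first exact: erefl.
  apply/ffunP => j; rewrite !ffunE -subnDA; congr (_ - _)%N.
  rewrite inE; case: (eqVneq j i) => [->|_] /=; last by rewrite muln0 addn0.
  by rewrite (negPf si) muln1 mul1n.
move=> p /=; rewrite mulf_eq0 negb_or => /andP[/dm + /cs cp] j.
rewrite !ffunE (negPf si) subn0 => mi; rewrite inE => /orP[/eqP->//|].
exact: cp.
Qed.

Lemma tailsK : cancel (@tails n) (@gaps n).
Proof.
move=> m; apply/ffunP => j; rewrite /gaps /tails !ffunE.
have [jn|jn] := ltnP j.+1 n; last first.
  rewrite [X in (_ - X)%N]big_pred0 ?subn0; last first.
    by move=> l; apply/negbTE; rewrite neq_ltn (leq_trans (ltn_ord l)).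
  rewrite (bigD1 j)//= big_pred0 ?addn0// => l; apply/negbTE.
  rewrite negb_and negbK -ltnNge; case: ltngtP => //= [jl|/ord_inj->//].
  by move: (leq_trans (leq_ltn_trans jl (ltn_ord l)) jn); rewrite ltnn.
rewrite [X in (_ - X)%N](big_pred1 (Ordinal jn)) ?ffunE//= (bigD1 j)//=.
rewrite (eq_bigl (fun l : 'I_n => (j < l)%N)) ?addnK// => l.
by rewrite ltn_neqAle andbC -val_eqE eq_sym.
Qed.

Lemma tails_Pn m : @Pn n (tails m).
Proof.
move=> i j ij; rewrite !ffunE big_mkcond [leqRHS]big_mkcond.
apply: leq_sum => l _; case: ifP => // jl.
by rewrite (leq_trans ij jl).
Qed.

Lemma gapsK k : @Pn n k -> tails (gaps k) = k.
Proof.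
move=> kP; apply/ffunP => i; rewrite ffunE.
have [d] := ubnP (n - i)%N; elim: d i => // d IH i nid.
rewrite (bigD1 i)//= ffunE.
rewrite (eq_bigl (fun l : 'I_n => (i < l)%N)); last first.
  by move=> l; rewrite ltn_neqAle andbC -val_eqE eq_sym.
have [iN|iN] := ltnP i.+1 n; last first.
  have E1 (l : 'I_n) : (i < l)%N = false.
    by apply/negbTE; rewrite -leqNgt -ltnS (leq_trans (ltn_ord l)).
  have E2 (l : 'I_n) : (l == i.+1 :> nat) = false.
    by apply/negbTE; rewrite neq_ltn (leq_trans (ltn_ord l)).
  by rewrite [X in (_ + X)%N]big_pred0// big_pred0// subn0 addn0.
rewrite (big_pred1 (Ordinal iN))// [X in (_ + X)%N](IH (Ordinal iN)) ?subnK//.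
  by apply: kP => /=.
by rewrite /= -ltnS (leq_trans _ nid)// ltnS subnS prednK ?subn_gt0// ltnW.
Qed.

Lemma tails_bij : set_bij setT (@Pn n) (@tails n).
Proof.
split=> [m _|m m' _ _ /(congr1 (@gaps n))|k kP]; first exact: tails_Pn.
  by rewrite !tailsK.
by exists (gaps k) => //; rewrite gapsK.
Qed.

Lemma normal_order_diag (i j : mindex n) (g : mindex n -> R[i]) k :
  (forall l : 'I_n, (i l * j l)%N = 0%N) -> @Pn n k ->
  f00 (opmul (opmul (zpow q i) (diagop (fun m => g (tails m)))) (zspow q j)) k =
  if (i == mzero n) && (j == mzero n) then g k else 0.
Proof.
move=> ij kP; rewrite /f00; move: (gapsK kP); move: (gaps k) => m <-.
case: ifP => [/andP[/eqP-> /eqP->]|].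
  have id2 : opmul (@opid R n) (@opid R n) = @opid R n.
    by rewrite opidE opmul_monop; apply: eq_monop => // p; rewrite mulr1.
  have -> : zpow q (mzero n) = @opid R n.
    by apply: (big_ind (fun f => f = @opid R n)) => [|_ _ -> ->|l _] //; rewrite ffunE.
  have -> : zspow q (mzero n) = @opid R n.
    by apply: (big_ind (fun f => f = @opid R n)) => [|_ _ -> ->|l _] //; rewrite ffunE.
  by rewrite opidE diagopE !opmul_monop /monop /= eqxx mulr1 mul1r.
have [c cj ->] := zspowE j.
rewrite zpowE diagopE !opmul_monop /monop => ij0; case: eqP => //= E.
have [->|cm] := eqVneq (c m) 0; first by rewrite mulr0.
have lejm := cj _ cm.
suff : (i == mzero n) && (j == mzero n) by rewrite ij0.
have H (l : 'I_n) : (i l = 0 /\ j l = 0)%N.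
  move/ffunP/(_ l) : E; rewrite !ffunE => E; move: (ij l) (lejm l) => /eqP.
  rewrite muln_eq0 => /orP[/eqP i0|/eqP j0] jm; split=> //.
    move: E (subnKC jm); rewrite i0 add0n => <- /eqP.
    by rewrite -[X in _ == X]add0n eqn_add2r => /eqP.
  by apply/esym/(@addIn (m l)); rewrite add0n [LHS]E j0 subn0.
by apply/andP; split; apply/eqP/ffunP => l; rewrite ffunE; case: (H l).
Qed.
End Monomials.

Section HolomorphicPolynomials.
Variables (R : realType) (n : nat) (q : R).
Hypothesis q01 : 0 < q < 1.
Implicit Types (f g h : infmx R n) (m k l p : mindex n).

Let fincol f := forall m, finite_set [set l | f l m != 0].
Let comb (s : seq (R[i] * mindex n)) : infmx R n :=
  \sum_(x <- s) x.1 *: zpow q x.2.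

Let opmulDr f g h : fincol g -> fincol h ->
  opmul f (g + h) = opmul f g + opmul f h.
Proof.
move=> fg fh; apply/funext => k; apply/funext => m; rewrite infmxDE /opmul.
pose A := [set l | g l m != 0] `|` [set l | h l m != 0].
have finA : finite_set A by rewrite finite_setU.
have W (u : infmx R n) : ([set l | u l m != 0] `<=` A) ->
    \sum_(l \in setT) f k l * u l m = \sum_(l \in A) f k l * u l m.
  move=> uA; apply/esym/fsbig_widen => // l [_ Al] /=.
  by have [->|/uA//] := eqVneq (u l m) 0; rewrite mulr0.
rewrite !W.
- by rewrite -fsbig_split//; apply: eq_fsbigr => l _; rewrite infmxDE mulrDr.
- by move=> l hl; right.
- by move=> l gl; left.
- move=> l /=; rewrite infmxDE; have [gl|gl] := eqVneq (g l m) 0; last by left.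
  by rewrite gl add0r; right.
Qed.

Let fincol_scale_zpow (a : R[i]) p : fincol (a *: zpow q p).
Proof.
move=> m; apply: (sub_finite_set _ (finite_set1 (madd p m))) => l.
rewrite /mkset infmxZE zpowE /monop; by case: ifP => [/eqP->//|_]; rewrite mulr0 eqxx.
Qed.

Let fincol_comb s : fincol (comb s).
Proof.
rewrite /comb; elim: s => [|x s IH] m.
  rewrite big_nil (_ : [set _ | _] = set0)//.
  by apply/seteqP; split => // l /=; rewrite eqxx.
rewrite big_cons.
apply: (@sub_finite_set _ _ ([set l | (x.1 *: zpow q x.2) l m != 0] `|`
   [set l | comb s l m != 0])) => [l /=|].
  rewrite infmxDE; have [->|?] := eqVneq ((x.1 *: zpow q x.2) l m) 0; last by left.
  by rewrite add0r; right.
by rewrite finite_setU; split; [exact: fincol_scale_zpow|exact: IH].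
Qed.

Let opmul_scale (a b : R[i]) p m : opmul (a *: zpow q p) (b *: zpow q m) =
  (a * b) *: opmul (zpow q p) (zpow q m).
Proof.
apply/funext => k; apply/funext => l; rewrite infmxZE.
rewrite (zpowE _ m) scale_monop !opmul_monopr infmxZE.
by rewrite mulrACA.
Qed.

Let opmulDl f g (b : R[i]) m : opmul (f + g) (b *: zpow q m) =
  opmul f (b *: zpow q m) + opmul g (b *: zpow q m).
Proof.
apply/funext => k; apply/funext => l; rewrite infmxDE zpowE scale_monop.
by rewrite !opmul_monopr infmxDE mulrDl.
Qed.

Let hol_comb f : hol q f -> exists s, f = comb s.
Proof.
have addc s1 s2 : comb s1 + comb s2 = comb (s1 ++ s2) by rewrite /comb big_cat.
elim=> {f}.
- exists [:: (1, mzero n)]; rewrite /comb big_seq1 scale1r /=.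
  by rewrite zpowE opidE; apply: eq_monop => [m|m _]; [rewrite big1 ?expr0// => i _;
    rewrite ffunE mul0n | apply/ffunP => j; rewrite !ffunE].
- move=> i; exists [:: (1, munit i)]; rewrite /comb big_seq1 scale1r /=.
  rewrite zpowE; apply: eq_monop => // m; congr (_ ^+ _)%:C.
  rewrite [RHS](bigD1 i)//= !ffunE eqxx mul1n [X in (_ + X)%N]big1 ?addn0//.
  by move=> j /negPf ji; rewrite ffunE ji.
- by move=> f g _ [s ->] _ [r ->]; exists (s ++ r).
- move=> c f _ [s ->]; exists [seq (c * x.1, x.2) | x <- s].
  by rewrite /comb big_map scaler_sumr; apply: eq_bigr => x _; rewrite scalerA.
- move=> f g _ [s ->] _ [r ->]; elim: r => [|y r [u Hu]].
    exists [::]; rewrite /comb !big_nil; apply/funext => k; apply/funext => m.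
    by rewrite /opmul fsbig1// => l _; rewrite mulr0.
  suff [v Hv] : exists v, opmul (comb s) (y.1 *: zpow q y.2) = comb v.
    exists (v ++ u); rewrite -addc -Hu -Hv [X in opmul _ X]/comb big_cons.
    by rewrite opmulDr// -/(comb r); exact: fincol_comb.
  elim: s {Hu} => [|x s [v Hv]].
    exists [::]; rewrite /comb !big_nil; apply/funext => k; apply/funext => m.
    by rewrite /opmul fsbig1// => l _; rewrite mul0r.
  have [c Hc] := opmul_zpow q x.2 y.2.
  exists ((x.1 * y.1 * c, madd x.2 y.2) :: v).
  rewrite [X in opmul X _]/comb [RHS]/comb !big_cons opmulDl -/(comb s) -/(comb v).
  by rewrite Hv opmul_scale Hc scalerA.
Qed.

Lemma hol_coord f : hol q f -> exists2 s : seq (mindex n), uniq s &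
  f = \sum_(k <- s) f k (mzero n) *: zpow q k.
Proof.
move=> /hol_comb[s fE]; exists (undup (map snd s)); first exact: undup_uniq.
have fk k : f k (mzero n) = \sum_(x <- s) x.1 * (k == x.2)%:R.
  rewrite fE /comb; elim: s {fE} => [|x s IH]; first by rewrite !big_nil.
  by rewrite !big_cons infmxDE infmxZE zpow_mzero IH.
under eq_bigr do rewrite fk scaler_suml.
rewrite exchange_big {1}fE /comb big_seq [RHS]big_seq; apply: eq_bigr => x xs.
rewrite (bigD1_seq x.2) ?undup_uniq//=; last first.
  by rewrite mem_undup; apply/mapP; exists x.
rewrite eqxx mulr1 big1 ?addr0// => k /negPf ->.
by rewrite mulr0 scale0r.
Qed.

End HolomorphicPolynomials.

Section ScalarProduct.
Variables (R : realType) (n : nat) (q : R).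
Implicit Types (f g : infmx R n).

Lemma rsum_fin (T : choiceType) (A : set T) (F : T -> R) : finite_set A ->
  (forall x, F x != 0 -> A x) -> rsum F = \sum_(x \in A) F x.
Proof.
move=> finA FA.
have H (G : T -> R) : (forall x, 0 <= G x) -> (forall x, G x != 0 -> A x) ->
    fine (\esum_(x in setT) (G x)%:E)%E = \sum_(x \in A) G x.
  move=> G0 GA.
  have -> : (\esum_(x in setT) (G x)%:E = \esum_(x in A) (G x)%:E)%E.
    rewrite [RHS]esum_mkcond; apply: eq_esum => x _; case: ifPn => //.
    by rewrite notin_setE => xA; have [->//|/GA] := eqVneq (G x) 0.
  by rewrite esum_fset// => [|x _]; rewrite ?lee_fin// fsumEFin.
rewrite /rsum !H; last 4 first.
- by move=> x; rewrite le_max lexx orbT.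
- by move=> x; have [->|/FA//] := eqVneq (F x) 0; rewrite oppr0 maxxx eqxx.
- by move=> x; rewrite le_max lexx orbT.
- by move=> x; have [->|/FA//] := eqVneq (F x) 0; rewrite maxxx eqxx.
rewrite !fsbig_finite//= -sumrB; apply: eq_bigr => x _.
have [x0|/ltW x0] := lerP 0 (F x).
  by rewrite max_r ?oppr_le0// subr0.
by rewrite max_l ?oppr_ge0// sub0r opprK.
Qed.

Lemma csum_fin (T : choiceType) (A : set T) (F : T -> R[i]) : finite_set A ->
  (forall x, F x != 0 -> A x) -> csum F = \sum_(x \in A) F x.
Proof.
move=> finA FA; rewrite /csum !(@rsum_fin _ A)//; last 2 first.
- move=> x; have [->|/FA//] := eqVneq (F x) 0; by rewrite eqxx.
- move=> x; have [->|/FA//] := eqVneq (F x) 0; by rewrite eqxx.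
rewrite !fsbig_finite//=; elim/big_rec3: _ => //= x a b c _ <-.
by case: (F x).
Qed.

Lemma scal_finop al f g : finop f -> finop g ->
  scal q al f g = int_m q al (opmul (adj q g) f).
Proof.
move=> finf fing; rewrite /int_m.
pose P := [set p.2 | p in [set km : mindex n * mindex n | f km.1 km.2 != 0]].
pose Q := [set p.1 | p in [set km : mindex n * mindex n | f km.1 km.2 != 0]].
have finP : finite_set P by exact: finite_image.
have finQ : finite_set Q by exact: finite_image.
have f0P l p : ~ P p -> f l p = 0.
  move=> Pp; apply/eqP; apply: contra_notT Pp => fl0; by exists (l, p).
have f0Q l p : ~ Q l -> f l p = 0.
  move=> Pp; apply/eqP; apply: contra_notT Pp => fl0; by exists (l, p).
rewrite (reindex_fsbig (@tails n) setT)//; last exact: tails_bij.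
rewrite /f00 -(fsbig_widen P)//; last first.
  move=> p [_ Pp] /=; rewrite tailsK /opmul fsbig1 ?mul0r// => l _.
  by rewrite f0P// mulr0.
under eq_fsbigr => p _.
  rewrite tailsK /opmul -(fsbig_widen Q)//; last first.
    by move=> l [_ Ql] /=; rewrite f0Q// mulr0.
  rewrite mulr_fsuml//. over.
rewrite exchange_fsbig// pair_fsbig//.
rewrite /scal (@csum_fin _ (Q `*` P)); last 2 first.
- exact: finite_setX.
- move=> [l p] /=; have [->|fl0 _] := eqVneq (f l p) 0; first by rewrite mulr0 mul0r eqxx.
  by split; exists (l, p).
rewrite mulr_fsumr//; apply: eq_fsbigr => -[l p] _ /=.
rewrite /wt2 /= /adj !rmorphM /=.
by ring.
Qed.

End ScalarProduct.

(* Main.v *)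
Require Import Defs.
From mathcomp Require Import all_boot all_order all_algebra.
From mathcomp Require Import finmap boolp classical_sets functions.
From mathcomp Require Import cardinality fsbigop reals ereal normedtype.
From mathcomp Require Import sequences esum exp ring lra.

(** Write Q = q^2 and t = q^(2 alpha). Through the definitions of the Toeplitz
operator and of the covariant symbol, the Berezin transform is a composition
of three explicit operators on infinite matrices:

  B_t = (Q t; Q)_n D_t,   D_t = e(t F) M_t e(t E).

Here e(x) = sum_N x^N / (Q; Q)_N is the q-exponential, E ([lower]) and F
([raise]) move both matrix indices down or up by one unit vector, and M_t
([poch_scale]) multiplies the entry (k, l) by
(Q^(n+1) t; Q)_|k| (Q^(n+1) t; Q)_|l|. The factor e(t E) comes from the Toeplitz
matrix: the scalar products (f z^b, z^a) are sums over all multi-indices r of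
shifted entries of f, and the terms with |r| = N add up to E^N f / (Q; Q)_N
([iter_lowerE]). The factor M_t comes from the norms of the monomials z^a, which
a product of n one-variable q-binomial series evaluates ([esum_zpow_mass]). The
factor e(t F) appears because F is the transpose of E for the invariant
integral ([pairing_raise]). The outcome is [berezinE].

E and F generate a q-oscillator algebra ([lower_raise]):

  E F - Q F E = (1 - Q) (Q^(n+2) - Q^(2n+2) Q^(|k|+|l|)).

Commuting E through e(t F), and using e(Q x) = (1 - x) e(x), gives a
q-difference equation in t ([berezin_core_dilate]):

  (1 - t W + t^2 Q^(n+2)) D_t = (1 - Q^(n+1) t)^2 D_(Q t),
  W = E + F + Q^(n+1) (Q^|k| + Q^|l|).

Each matrix entry of D_t f is a polynomial in t, so the equation is a three-term
recurrence for its coefficients ([bcoef1], [bcoefSS]). The coefficient of t in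
B_t shows that W is an affine function of the Laplace operator ([laplaceE]).
The polynomials p_j are Al-Salam-Chihara polynomials written in the basis
prod_(m < l) (1 - Q^m a) (1 - Q^m b) with a + b = W / Q and a b = Q^n, and with
the weights of the series they satisfy the same recurrence ([series_polySS]).
Hence the coefficient of t^j in D_t f is the j-th weighted p_j evaluated at the
Laplace operator ([bcoefE]). The series converges entry by entry because each
entry is a finite sum. *)

Set Implicit Arguments.
Unset Strict Implicit.
Unset Printing Implicit Defensive.

Import Order.TTheory GRing.Theory Num.Theory numFieldNormedType.Exports.
Local Open Scope classical_set_scope.
Local Open Scope ring_scope.
Local Open Scope complex_scope.

Lemma infmxNE (R : realType) (n : nat) (f : infmx R n) k m : (- f) k m = - f k m.
Proof. by []. Qed.

(** * Linear maps and the q-oscillator relation *)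

Section LinearMaps.
Variables (K : fieldType) (V : lmodType K).
Implicit Types (L : V -> V) (v w : V).

Lemma linD L v w : linear L -> L (v + w) = L v + L w.
Proof. by move=> lL; rewrite -[v in LHS]scale1r lL scale1r. Qed.

Lemma lin0 L : linear L -> L 0 = 0.
Proof. by move=> lL; apply: (addrI (L 0)); rewrite -(linD _ _ lL) !addr0. Qed.

Lemma linZ L a v : linear L -> L (a *: v) = a *: L v.
Proof. by move=> lL; rewrite -[in LHS](addr0 (a *: v)) lL lin0// addr0. Qed.

Lemma linB L v w : linear L -> L (v - w) = L v - L w.
Proof. by move=> lL; rewrite -scaleN1r (linD _ _ lL) (linZ _ _ lL) scaleN1r. Qed.

Lemma lin_sum L (I : Type) (r : seq I) (P : pred I) (F : I -> V) : linear L ->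
  L (\sum_(i <- r | P i) F i) = \sum_(i <- r | P i) L (F i).
Proof.
by move=> lL; elim/big_rec2: _ => [|i x y _ <-]; [exact: lin0|exact: linD].
Qed.

Lemma lin_iter L N : linear L -> linear (iter N L).
Proof. by move=> lL; elim: N => [|N IH] a v w //=; rewrite IH lL. Qed.

Lemma scale_sum4 (c b : K) (x x' y y' z z' w w' : V) :
  (c *: x + x') + (c *: y + y') + b *: ((c *: z + z') + (c *: w + w')) =
  c *: (x + y + b *: (z + w)) + (x' + y' + b *: (z' + w')).
Proof.
rewrite (addrACA (c *: x)) (addrACA (c *: z)) -!(scalerDr c).
rewrite (scalerDr b (c *: (z + w))) addrACA; congr (_ + _).
by rewrite (scalerDr c (x + y)) !scalerA (mulrC c b).
Qed.

Lemma scale_affine2 (c a b : K) (x x' y y' : V) :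
  a *: (c *: x + x' - b *: (c *: y + y')) =
  c *: (a *: (x - b *: y)) + a *: (x' - b *: y').
Proof.
rewrite (scalerDr b (c *: y)) opprD addrACA scalerDr; congr (_ + _).
by rewrite !scalerBr !scalerA; congr (_ *: _ - _ *: _); ring.
Qed.

(** Induction on N, moving E through one factor F at a time; D plays the part of
Q^(|k|+|l|), and the geometric sums of the correction terms produce the factor
1 - Q^(N+1). *)
Lemma q_oscillator_iter (E F D : V -> V) (Q a b : K) :
  linear E -> linear F -> linear D ->
  (forall v, E (F v) = Q *: F (E v) + ((1 - Q) * a) *: v - ((1 - Q) * b) *: D v) ->
  (forall v, D (F v) = (Q * Q) *: F (D v)) ->
  forall N v, E (iter N.+1 F v) = Q ^+ N.+1 *: iter N.+1 F (E v) +
    (1 - Q ^+ N.+1) *: iter N F (a *: v - (b * Q ^+ N) *: D v).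
Proof.
move=> lE lF lD EF DF; elim=> [|N IH] v.
  by rewrite EF expr1 expr0 mulr1 scalerBr !scalerA addrA.
have itB m x y : iter m F (x - y) = iter m F x - iter m F y.
  exact/linB/lin_iter.
have itZ m (c : K) x : iter m F (c *: x) = c *: iter m F x.
  exact/linZ/lin_iter.
have itD m x y : iter m F (x + y) = iter m F x + iter m F y.
  exact/linD/lin_iter.
rewrite [iter N.+2 F v]iterSr IH EF DF !(itB, itD, itZ) -!iterSr.
move: (iter N.+2 F (E v)) (iter N.+1 F v) (iter N.+1 F (D v)) => x y z.
rewrite !scalerBr !scalerDr !scalerA -!scaleNr addrACA.
rewrite -[X in X + _]addrA -!scalerDl -addrA.
by congr (_ *: _ + (_ *: _ + _ *: _)); rewrite !exprS; ring.
Qed.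
End LinearMaps.

(** * Lowering and raising operators on infinite matrices *)

Section Operators.
Variables (R : realType) (n : nat) (q : R[i]).
Local Notation Q := (q ^+ 2).
Implicit Types (f g : infmx R n) (k l m : mindex n) (i j : 'I_n) (t : R[i]).

(** The partial sum m_1 + ... + m_s, with s a natural number and not an index, so
that sums telescope from 0 to n. *)
Definition low (s : nat) m : nat := (\sum_(j < n | (j < s)%N) m j)%N.
Definition deg m : nat := (\sum_(j < n) m j)%N.

Lemma low0 m : low 0 m = 0%N.
Proof. by rewrite /low big_pred0. Qed.

Lemma lown m : low n m = deg m.
Proof. by apply: eq_bigl => j; rewrite ltn_ord. Qed.

Lemma lowS i m : low i.+1 m = (low i m + m i)%N.
Proof.
rewrite /low (bigD1 i)//= addnC; congr (_ + _)%N.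
by apply: eq_bigl => j; rewrite ltnS ltn_neqAle andbC -val_eqE.
Qed.

Lemma low_madd s k m : low s (madd k m) = (low s k + low s m)%N.
Proof. by rewrite /low -big_split; apply: eq_bigr => j _; rewrite ffunE. Qed.

Lemma deg_madd k m : deg (madd k m) = (deg k + deg m)%N.
Proof. by rewrite -!lown low_madd. Qed.

Lemma low_munit s i : low s (munit i) = (i < s)%N.
Proof.
rewrite /low; case: (ltnP i s) => si.
  rewrite (bigD1 i)//= ffunE eqxx big1 ?addn0// => j /andP[_ /negPf ji].
  by rewrite ffunE ji.
rewrite big1// => j js; rewrite ffunE; case: eqP => // ji.
by move: js; rewrite ji ltnNge si.
Qed.

Lemma deg_munit i : deg (munit i) = 1%N.
Proof. by rewrite -lown low_munit ltn_ord. Qed.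

Lemma maddKl k m : msub (madd k m) k = m.
Proof. by apply/ffunP => j; rewrite !ffunE addKn. Qed.

Lemma madd_munitK k i : (0 < k i)%N -> madd (munit i) (msub k (munit i)) = k.
Proof.
move=> ki; apply/ffunP => j; rewrite !ffunE.
by case: eqP => [->|_]; rewrite ?subn0 ?subnKC.
Qed.

Lemma low_msub s k i : (0 < k i)%N ->
  low s k = ((i < s)%N + low s (msub k (munit i)))%N.
Proof. by move=> ki; rewrite -{1}(madd_munitK ki) low_madd low_munit. Qed.

Lemma maddCA k l m : madd k (madd l m) = madd l (madd k m).
Proof. by apply/ffunP => j; rewrite !ffunE addnCA. Qed.

Definition lcoef i k l : R[i] :=
  q ^+ (low i k + low i l) * (1 - Q ^+ (k i).+1) * Q ^+ i.+1.
(** An analogue of the sum over i of the maps f -> z_i^* f z_i, with the powers of q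
that the Toeplitz operator produces at first order in t, up to the factor 1 - Q. *)
Definition lower f : infmx R n :=
  fun k l => \sum_(i < n) lcoef i k l * f (madd (munit i) k) (madd (munit i) l).

Definition rcoef i k l : R[i] :=
  Q ^+ n.+1 * q ^+ (low i k + low i l) * (1 - Q ^+ (l i)).
(** The transpose of [lower] for the invariant integral. The guard makes entries
with a negative index vanish; the factor 1 - Q^(l i) does this only for the
column index. *)
Definition raise f : infmx R n :=
  fun k l => \sum_(i < n)
    if (0 < k i)%N && (0 < l i)%N
    then rcoef i k l * f (msub k (munit i)) (msub l (munit i)) else 0.

Definition deg_scale (a b : R[i]) f : infmx R n :=
  fun k l => a ^+ deg k * b ^+ deg l * f k l.

(** Each term is the difference of consecutive values of
Q^(s+1) q^(2 (low s k + low s l)). *)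
Lemma sum_low k l : \sum_(i < n)
    (Q ^+ i.+1 * q ^+ (2 * (low i k + low i l)) -
     Q ^+ i.+2 * q ^+ (2 * (low i.+1 k + low i.+1 l))) =
  Q - Q ^+ n.+1 * Q ^+ (deg k + deg l).
Proof.
pose G (s : nat) := Q ^+ s.+1 * q ^+ (2 * (low s k + low s l)).
rewrite -(big_mkord xpredT (fun s => G s - G s.+1)) -[LHS]opprK -sumrN.
under eq_bigr do rewrite opprB.
rewrite telescope_sumr// opprB /G !low0 muln0 mulr1 expr1 !lown -exprM.
by rewrite !exprM.
Qed.

(** The terms with i <> j of both double sums agree up to the factor Q. Those with
i = j differ by the increments of [sum_low], whose sum depends on the degrees
alone. *)
Lemma lower_raise f k l : lower (raise f) k l = Q * raise (lower f) k l +
  (1 - Q) * (Q ^+ n.+2 - Q ^+ (2 * n.+1) * Q ^+ (deg k + deg l)) * f k l.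
Proof.
apply/eqP; rewrite addrC -subr_eq; apply/eqP.
pose a i j := lcoef i k l *
  (if (0 < madd (munit i) k j)%N && (0 < madd (munit i) l j)%N
   then rcoef j (madd (munit i) k) (madd (munit i) l) *
     f (msub (madd (munit i) k) (munit j)) (msub (madd (munit i) l) (munit j))
   else 0).
pose b i j := if (0 < k j)%N && (0 < l j)%N
   then rcoef j k l * (lcoef i (msub k (munit j)) (msub l (munit j)) *
     f (madd (munit i) (msub k (munit j))) (madd (munit i) (msub l (munit j))))
   else 0.
have -> : lower (raise f) k l = \sum_(i < n) \sum_(j < n) a i j.
  by apply: eq_bigr => i _; rewrite /raise mulr_sumr.
have -> : raise (lower f) k l = \sum_(i < n) \sum_(j < n) b i j.
  rewrite exchange_big; apply: eq_bigr => j _; rewrite /b.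
  by case: ifP => _; [rewrite mulr_sumr|rewrite big1].
pose g i := (1 - Q) * Q ^+ n.+1 *
    (Q ^+ i.+1 * q ^+ (2 * (low i k + low i l)) -
     Q ^+ i.+2 * q ^+ (2 * (low i.+1 k + low i.+1 l))) * f k l.
have off i j : i != j -> a i j = Q * b i j.
  move=> ij; rewrite /a /b !ffunE eq_sym (negPf ij) !add0n.
  case: ifP => [/andP[kj lj]|_]; last by rewrite !mulr0.
  have E m : (0 < m j)%N ->
      msub (madd (munit i) m) (munit j) = madd (munit i) (msub m (munit j)).
    move=> mj; apply/ffunP => s; rewrite !ffunE.
    have [->|sj] := eqVneq s j; last by rewrite !subn0.
    by rewrite [j == i]eq_sym (negPf ij).
  rewrite !E// /lcoef /rcoef.
  move: (f _ _) => X; rewrite !mulrA; congr (_ * _).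
  rewrite !ffunE (negPf ij) eq_sym (negPf ij) add0n subn0.
  rewrite (low_msub i kj) (low_msub i lj) !low_madd !low_munit.
  have [lij|lji|/ord_inj eij] := ltngtP i j; last by rewrite eij eqxx in ij.
    by rewrite /= !exprD; ring.
  by rewrite /= !exprD; ring.
have dia i : a i i - Q * b i i = g i.
  rewrite /a /b /g !ffunE eqxx !add1n /= !maddKl !lowS /lcoef /rcoef.
  rewrite !low_madd !low_munit ltnn !ffunE eqxx !add0n !add1n.
  case: ifPn => [/andP[ki li]|].
    rewrite !madd_munitK//.
    rewrite (low_msub i ki) (low_msub i li) ltnn !add0n !subn1 !prednK//.
    by rewrite -!exprM !mul2n -!addnn !exprD !exprS; ring.
  rewrite negb_and -!leqNgt !leqn0 mulr0 subr0 -!exprM !mul2n -!addnn !exprD !exprS.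
  by move=> /orP[]/eqP ->; rewrite expr0; ring.
rewrite mulr_sumr -sumrB.
transitivity (\sum_(i < n) g i).
  apply: eq_bigr => i _; rewrite mulr_sumr -sumrB (bigD1 i)//= dia big1 ?addr0//.
  by move=> j ji; rewrite off 1?eq_sym// subrr.
by rewrite -mulr_suml -mulr_sumr sum_low mul2n -addnn (exprD _ n.+1 n.+1) (exprS _ n.+1); ring.
Qed.

Lemma lower_is_linear : linear lower.
Proof.
move=> a f g; apply/funext => k; apply/funext => l.
rewrite infmxDE infmxZE /lower mulr_sumr -big_split; apply: eq_bigr => i _.
by rewrite infmxDE infmxZE mulrDr mulrCA.
Qed.

Lemma raise_is_linear : linear raise.
Proof.
move=> a f g; apply/funext => k; apply/funext => l.
rewrite infmxDE infmxZE /raise mulr_sumr -big_split; apply: eq_bigr => i _ /=.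
by case: ifP => _; rewrite ?mulr0 ?addr0// infmxDE infmxZE mulrDr mulrCA.
Qed.

Lemma deg_scale_is_linear a b : linear (deg_scale a b).
Proof.
move=> c f g; apply/funext => k; apply/funext => l.
by rewrite infmxDE infmxZE /deg_scale infmxDE infmxZE mulrDr mulrCA.
Qed.

Lemma deg_scale_raise a b f : deg_scale a b (raise f) = (a * b) *: raise (deg_scale a b f).
Proof.
apply/funext => k; apply/funext => l; rewrite infmxZE /deg_scale /raise !mulr_sumr.
apply: eq_bigr => i _; case: ifPn => [/andP[ki li]|]; last by rewrite !mulr0.
rewrite -{1}(madd_munitK ki) -{1}(madd_munitK li) !deg_madd !deg_munit.
by rewrite !exprD; ring.
Qed.

Lemma lower_raiseE f : lower (raise f) = Q *: raise (lower f) +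
  ((1 - Q) * Q ^+ n.+2) *: f - ((1 - Q) * Q ^+ (2 * n.+1)) *: deg_scale Q Q f.
Proof.
apply/funext => k; apply/funext => l.
rewrite !(infmxDE, infmxNE, infmxZE) lower_raise /deg_scale exprD; ring.
Qed.

Definition raises N : infmx R n -> infmx R n := iter N raise.

Lemma raisesS N f : raises N.+1 f = raise (raises N f).
Proof. by []. Qed.

Lemma raisesSr N f : raises N.+1 f = raises N (raise f).
Proof. by rewrite /raises iterSr. Qed.

Lemma raises_is_linear N : linear (raises N).
Proof. exact/lin_iter/raise_is_linear. Qed.

Lemma lower_raises N f : lower (raises N.+1 f) =
  Q ^+ N.+1 *: raises N.+1 (lower f) +
  (1 - Q ^+ N.+1) *:
    raises N (Q ^+ n.+2 *: f - (Q ^+ (2 * n.+1) * Q ^+ N) *: deg_scale Q Q f).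
Proof.
exact: (q_oscillator_iter lower_is_linear raise_is_linear (deg_scale_is_linear Q Q)
  lower_raiseE (deg_scale_raise Q Q)).
Qed.

End Operators.

Lemma qpochS (K : fieldType) (a b : K) (m : nat) :
  qpoch a b m.+1 = qpoch a b m * (1 - a * b ^+ m).
Proof. by rewrite /qpoch big_ord_recr. Qed.

Lemma qpochSl (K : fieldType) (a b : K) (m : nat) :
  qpoch a b m.+1 = (1 - a) * qpoch (b * a) b m.
Proof.
rewrite /qpoch big_ord_recl expr0 mulr1; congr (_ * _); apply: eq_bigr => i _.
by rewrite exprS mulrA [a * b]mulrC.
Qed.

(** * q-exponentials and the q-difference equation *)

Section QExponentials.
Variables (R : realType) (n : nat) (q : R[i]).
Hypothesis q_reg : forall N, 1 - (q ^+ 2) ^+ N.+1 != 0.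
Local Notation Q := (q ^+ 2).
Local Notation c := (Q ^+ n.+1).
Local Notation poch := (qpoch Q Q).
Implicit Types (f g u : infmx R n) (k l m : mindex n) (t a b : R[i]).

Lemma poch_neq0 N : poch N != 0.
Proof. by apply/prodf_neq0 => j _; rewrite -exprS q_reg. Qed.

Lemma raises_eq0 N g k l : (deg k < N)%N -> raises q N g k l = 0.
Proof.
elim: N k l => // N IH k l kN; rewrite raisesS /raise big1// => i _.
case: ifP => // /andP[ki _]; rewrite IH ?mulr0//.
move: kN; rewrite -{1}(madd_munitK ki) deg_madd deg_munit.
exact.
Qed.

Definition qexp_raise_trunc B t g : infmx R n :=
  \sum_(N < B) (t ^+ N / poch N) *: raises q N g.
(** The q-exponential e(t F). The series stops at N = |k| because F^N g vanishes
on rows of degree below N. *)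
Definition qexp_raise t g : infmx R n := fun k l => qexp_raise_trunc (deg k).+1 t g k l.

Lemma infmx_sumE (I : Type) (r : seq I) (P : pred I) (F : I -> infmx R n) k l :
  (\sum_(i <- r | P i) F i) k l = \sum_(i <- r | P i) F i k l.
Proof. by elim/big_rec2: _ => [//|i x y _ <-]; rewrite infmxDE. Qed.

(** The number of terms may be chosen larger than |k|. This allows one truncation
for entries in neighbouring rows. *)
Lemma qexp_raiseE B t g k l : (deg k < B)%N ->
  qexp_raise t g k l = qexp_raise_trunc B t g k l.
Proof.
move=> kB; rewrite /qexp_raise /qexp_raise_trunc !infmx_sumE.
rewrite (big_ord_widen B (fun N => ((t ^+ N / poch N) *: raises q N g) k l))// big_mkcond.
apply: eq_bigr => N _; case: ifPn => //; rewrite -leqNgt => kN.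
by rewrite infmxZE raises_eq0 ?mulr0.
Qed.

Lemma qexp_raise_trunc_is_linear B t : linear (qexp_raise_trunc B t).
Proof.
move=> a f g; rewrite /qexp_raise_trunc scaler_sumr -big_split; apply: eq_bigr => N _.
by rewrite (raises_is_linear q N) scalerDr !scalerA mulrC.
Qed.

Lemma qexp_raise_is_linear t : linear (qexp_raise t).
Proof.
move=> a f g; apply/funext => k; apply/funext => l.
by rewrite infmxDE infmxZE /qexp_raise qexp_raise_trunc_is_linear.
Qed.

(** e(Q x) = (1 - x) e(x), at x = t F. *)
Lemma qexp_raise_dilate t g :
  qexp_raise (Q * t) g = qexp_raise t g - t *: qexp_raise t (raise q g).
Proof.
apply/funext => k; apply/funext => l; rewrite !(infmxDE, infmxNE, infmxZE).
rewrite !(@qexp_raiseE (deg k).+2 _ g)//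
  [qexp_raise t _]/qexp_raise /qexp_raise_trunc !infmx_sumE mulr_sumr.
rewrite big_ord_recl [X in _ = X - _]big_ord_recl !expr0 -addrA; congr (_ + _).
rewrite -sumrB; apply: eq_bigr => N _; rewrite !infmxZE -raisesSr.
rewrite lift0 qpochS; have p0 := poch_neq0 N.
have r0 := q_reg N; rewrite -exprS (exprMn _ Q t) [t ^+ N.+1]exprS.
by field; rewrite r0 p0.
Qed.

Lemma raise_qexp_raise t g : raise q (qexp_raise t g) = qexp_raise t (raise q g).
Proof.
apply/funext => k; apply/funext => l.
transitivity (raise q (qexp_raise_trunc (deg k).+1 t g) k l).
  apply: eq_bigr => i _; case: ifP => // /andP[ki _]; congr (_ * _); apply: qexp_raiseE.
  by rewrite -{2}(madd_munitK ki) deg_madd deg_munit add1n ltnS ltnW.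
rewrite /qexp_raise /qexp_raise_trunc (lin_sum _ _ _ (raise_is_linear q)) !infmx_sumE.
apply: eq_bigr => N _; rewrite (linZ _ _ (raise_is_linear q)).
by rewrite !infmxZE -raisesS raisesSr.
Qed.

Lemma deg_scale_raises a b N g :
  deg_scale a b (raises q N g) = (a * b) ^+ N *: raises q N (deg_scale a b g).
Proof.
elim: N g => [|N IH] g; first by rewrite expr0 scale1r.
by rewrite raisesS deg_scale_raise IH (linZ _ _ (raise_is_linear q)) scalerA -exprS raisesS.
Qed.

Lemma deg_scale_qexp_raise a b t g :
  deg_scale a b (qexp_raise t g) = qexp_raise (a * b * t) (deg_scale a b g).
Proof.
apply/funext => k; apply/funext => l.
transitivity (deg_scale a b (qexp_raise_trunc (deg k).+1 t g) k l); first by [].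
rewrite /qexp_raise /qexp_raise_trunc (lin_sum _ _ _ (deg_scale_is_linear a b)) !infmx_sumE.
apply: eq_bigr => N _; rewrite (linZ _ _ (deg_scale_is_linear a b)).
by rewrite deg_scale_raises scalerA; congr (_ *: _); rewrite !exprMn; ring.
Qed.

(** Termwise application of [lower_raises]: the factor Q^(N+1) turns t into Q t,
and the correction term lowers the power of F by one. *)
Lemma lower_qexp_raise t g : lower q (qexp_raise t g) = qexp_raise (Q * t) (lower q g) +
  t *: (Q ^+ n.+2 *: qexp_raise t g - Q ^+ (2 * n.+1) *: qexp_raise (Q * t) (deg_scale Q Q g)).
Proof.
apply/funext => k; apply/funext => l.
transitivity (lower q (qexp_raise_trunc (deg k).+2 t g) k l).
  apply: eq_bigr => i _; congr (_ * _); apply: qexp_raiseE.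
  by rewrite deg_madd deg_munit.
rewrite !(infmxDE, infmxNE, infmxZE) (@qexp_raiseE (deg k).+2)// /qexp_raise /qexp_raise_trunc.
have lL := @lower_is_linear R n q.
rewrite (lin_sum _ _ _ lL) !infmx_sumE big_ord_recl [X in _ = X + _]big_ord_recl !expr0.
rewrite -addrA (linZ _ _ lL); congr (_ + _).
rewrite !mulr_sumr -sumrB mulr_sumr -big_split; apply: eq_bigr => N _.
have lr := @raises_is_linear R n q N.
rewrite (linZ _ _ lL) !infmxZE lift0 lower_raises (linB _ _ lr) !(linZ _ _ lr).
rewrite !(infmxDE, infmxNE, infmxZE) qpochS.
move: (raises _ _ _ _ _) (raises _ _ _ _ _) (raises _ _ _ _ _) => x y z.
have p0 := poch_neq0 N; have r0 := q_reg N; rewrite -exprS !(exprMn _ Q t) [t ^+ N.+1]exprS.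
move: (Q ^+ N.+1) (exprS Q N) r0 => w ->; move: (Q ^+ N) => v r0 /=.
by field; rewrite r0 p0.
Qed.

(** A bound on the row index makes E locally nilpotent, since E increases the degrees
of the indices at which f is read. *)
Definition bounded K f := forall k l, (K <= deg k)%N -> f k l = 0.

(** The q-exponential e(t E), truncated at the power K that annihilates f when f
is bounded by K. *)
Definition qexp_lower K t f : infmx R n := \sum_(N < K) (t ^+ N / poch N) *: iter N (lower q) f.

Lemma iter_lower_eq0 K f N : bounded K f -> (K <= N)%N -> iter N (lower q) f = 0.
Proof.
move=> Kf KN; suff H M k l : (K <= M + deg k)%N -> iter M (lower q) f k l = 0.
  by apply/funext => k; apply/funext => l; apply: H; rewrite (leq_trans KN) ?leq_addr.
elim: M k l => [|M IH] k l; first exact: Kf.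
rewrite iterS /lower => MK; rewrite big1// => i _.
by rewrite IH ?mulr0// deg_madd deg_munit add1n addnS.
Qed.

Lemma qexp_lower_dilate K t f : bounded K f ->
  qexp_lower K (Q * t) f = qexp_lower K t f - t *: lower q (qexp_lower K t f).
Proof.
move=> Kf; have E s : qexp_lower K s f = qexp_lower K.+1 s f.
  by rewrite {2}/qexp_lower big_ord_recr /= (iter_lower_eq0 Kf)// scaler0 addr0.
rewrite [qexp_lower K (Q * t) f]E [X in X - _]E /qexp_lower.
have lL := @lower_is_linear R n q; rewrite (lin_sum _ _ _ lL) scaler_sumr.
rewrite big_ord_recl [X in X - _]big_ord_recl !expr0 -addrA; congr (_ + _).
rewrite -sumrB; apply: eq_bigr => N _.
rewrite (linZ _ _ lL) -iterS lift0 scalerA -scalerBl; congr (_ *: _).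
rewrite qpochS; have p0 := poch_neq0 N; have r0 := q_reg N.
rewrite -exprS (exprMn _ Q t) [t ^+ N.+1]exprS.
by field; rewrite r0 p0.
Qed.

Definition poch_scale t u : infmx R n :=
  fun k l => qpoch (c * t) Q (deg k) * qpoch (c * t) Q (deg l) * u k l.

(** (1 - a) (Q a; Q)_m = (a; Q)_m (1 - a Q^m), for rows and columns. *)
Lemma poch_scale_dilate t u : (1 - c * t) ^+ 2 *: poch_scale (Q * t) u =
  (fun k l => (1 - c * t * Q ^+ deg k) * (1 - c * t * Q ^+ deg l) * poch_scale t u k l).
Proof.
apply/funext => k; apply/funext => l; rewrite infmxZE /poch_scale.
have E (m : nat) : (1 - c * t) * qpoch (c * (Q * t)) Q m =
    qpoch (c * t) Q m * (1 - c * t * Q ^+ m).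
  by rewrite [c * (Q * t)]mulrCA -qpochSl qpochS.
transitivity (((1 - c * t) * qpoch (c * (Q * t)) Q (deg k)) *
              ((1 - c * t) * qpoch (c * (Q * t)) Q (deg l)) * u k l); first by ring.
by rewrite !E; ring.
Qed.

Lemma lower_poch_scale t u : lower q (poch_scale t u) =
  (fun k l => (1 - c * t * Q ^+ deg k) * (1 - c * t * Q ^+ deg l) * poch_scale t (lower q u) k l).
Proof.
apply/funext => k; apply/funext => l; rewrite /poch_scale /lower !mulr_sumr.
apply: eq_bigr => i _; rewrite !deg_madd !deg_munit !add1n !qpochS; ring.
Qed.

(** The operator D_t; multiplied by (Q t; Q)_n it is the Berezin transform. *)
Definition berezin_core K t f : infmx R n := qexp_raise t (poch_scale t (qexp_lower K t f)).

(** The operator W, an affine function of the Laplace operator. *)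
Definition shift_op f : infmx R n :=
  lower q f + raise q f + c *: (deg_scale Q 1 f + deg_scale 1 Q f).

(** Put g = M_t e(t E) f. Moving E, F and the diagonal parts of W through e(t F)
turns the left side into e(Q t F) applied to
g - t E g - Q^(n+1) t (Q^|k| + Q^|l|) g + Q^(2n+2) t^2 Q^(|k|+|l|) g.
The terms without E combine to the product of 1 - Q^(n+1) t Q^|k| and
1 - Q^(n+1) t Q^|l|, and moving E through M_t creates the same product. So this
vector is (1 - Q^(n+1) t)^2 M_(Q t) (1 - t E) e(t E) f, which is
(1 - Q^(n+1) t)^2 M_(Q t) e(Q t E) f. *)
Lemma berezin_core_dilate K t f : bounded K f ->
  (1 + t ^+ 2 * Q ^+ n.+2) *: berezin_core K t f - t *: shift_op (berezin_core K t f) =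
  (1 - c * t) ^+ 2 *: berezin_core K (Q * t) f.
Proof.
move=> Kf; rewrite /berezin_core; set u := qexp_lower K t f; set g := poch_scale t u.
have -> : (1 - c * t) ^+ 2 *: qexp_raise (Q * t) (poch_scale (Q * t) (qexp_lower K (Q * t) f)) =
  qexp_raise (Q * t) (g - t *: lower q g + (t ^+ 2 * Q ^+ (2 * n.+1)) *: deg_scale Q Q g -
    (t * c) *: deg_scale Q 1 g - (t * c) *: deg_scale 1 Q g).
  have lR s := @qexp_raise_is_linear s.
  rewrite -(linZ _ _ (lR _)) poch_scale_dilate qexp_lower_dilate// -/u; congr (qexp_raise _ _).
  apply/funext => k; apply/funext => l; rewrite !(infmxDE, infmxNE, infmxZE).
  rewrite /g lower_poch_scale /deg_scale /poch_scale !(infmxDE, infmxNE, infmxZE) !expr1n.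
  by rewrite mul2n -addnn exprD; ring.
have lR s := @qexp_raise_is_linear s.
rewrite 2!(linB _ _ (lR _)) (linD _ _ (lR _)) (linB _ _ (lR _)) !(linZ _ _ (lR _)).
rewrite /shift_op lower_qexp_raise raise_qexp_raise !deg_scale_qexp_raise !mulr1 !mul1r.
apply/funext => k; apply/funext => l; rewrite !(infmxDE, infmxNE, infmxZE).
rewrite [qexp_raise (Q * t) g]qexp_raise_dilate !(infmxDE, infmxNE, infmxZE).
set x1 := qexp_raise _ _ _ _; set x2 := qexp_raise _ _ _ _; set x3 := qexp_raise _ _ _ _.
set x4 := qexp_raise _ _ _ _; set x5 := qexp_raise _ _ _ _; set x6 := qexp_raise _ _ _ _.
by ring.
Qed.

End QExponentials.

(** * Recurrence for the polynomials of the series *)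

Section AlSalamChihara.
Variables (K : fieldType) (q : K) (n : nat).
Hypothesis n_gt0 : (0 < n)%N.
Hypothesis q_neq0 : q != 0.
Hypothesis q_reg : forall N, 1 - (q ^+ 2) ^+ N.+1 != 0.
Local Notation Q := (q ^+ 2).

Lemma qpochD (a b : K) m k : qpoch a b (m + k) = qpoch a b m * qpoch (a * b ^+ m) b k.
Proof.
elim: k => [|k IH]; first by rewrite addn0 /qpoch big_ord0 mulr1.
by rewrite addnS !qpochS IH exprD !mulrA.
Qed.

Lemma qpoch0 (a b : K) : qpoch a b 0 = 1. Proof. by rewrite /qpoch big_ord0. Qed.

Lemma qpoch_exp_neq0 (s m : nat) : qpoch (Q ^+ s.+1) Q m != 0.
Proof. by apply/prodf_neq0 => j _; rewrite -exprD addSn q_reg. Qed.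

(** The weight of the j-th term of the series, written with (Q^n; Q)_j / (Q; Q)_j
so that consecutive weights have a simple ratio. *)
Definition series_coef j : K := Q ^+ j * (qpoch (Q ^+ n) Q j / qpoch Q Q j).

(** Both quotients equal (Q; Q)_(n+j-1) / ((Q; Q)_(n-1) (Q; Q)_j). *)
Lemma series_coefE j :
  series_coef j = q ^+ (2 * j) * (qpoch (q ^+ (2 * j + 2)) Q n.-1 / qpoch Q Q n.-1).
Proof.
rewrite /series_coef exprM; congr (_ * _); apply/eqP.
have nz m : qpoch Q Q m != 0 by have := qpoch_exp_neq0 0 m; rewrite expr1.
have -> : Q ^+ n = Q * Q ^+ n.-1 by rewrite -exprS prednK.
have -> : q ^+ (2 * j + 2) = Q * Q ^+ j by rewrite exprD exprM mulrC.
by rewrite eqr_div// [X in X == _]mulrC [X in _ == X]mulrC -!qpochD addnC.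
Qed.

(** This is (1 - Q^m a) (1 - Q^m b), where a b = Q^n and Q (a + b) is the
polynomial [shift_poly]. *)
Definition chihara_factor (m : nat) : {poly K} :=
  ((1 - q ^+ (2 * m)) * (1 - q ^+ (2 * m + 2 * n)))%:P
       - (q ^+ (2 * m + 2 * n - 2) * (1 - Q) ^+ 2) *: 'X.
Definition chihara_prod l : {poly K} := \prod_(m < l) chihara_factor m.
Definition chihara_coef j l : K :=
  qpoch (Q ^- j) Q l * Q ^+ l / (qpoch (Q ^+ n) Q l * qpoch Q Q l).

(** The expression of W in terms of the Laplace operator. *)
Definition shift_poly : {poly K} :=
  (Q + Q ^+ n.+1)%:P + (Q ^+ n * (1 - Q) ^+ 2) *: 'X.

Definition series_poly j : {poly K} := series_coef j *: berezin_pj q n j.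

(** The factor of index j of (Q^-j; Q)_l vanishes. *)
Lemma chihara_coef_eq0 j l : (j < l)%N -> chihara_coef j l = 0.
Proof.
move=> jl; rewrite /chihara_coef /qpoch (bigD1 (Ordinal jl))//= mulVf ?subrr ?mul0r//.
by rewrite !expf_neq0.
Qed.

Lemma series_polyE B j : (j < B)%N ->
  series_poly j = \sum_(l < B) (series_coef j * chihara_coef j l) *: chihara_prod l.
Proof.
move=> jB; rewrite /series_poly /berezin_pj.
have -> : \sum_(l < B) (series_coef j * chihara_coef j l) *: chihara_prod l =
    series_coef j *: \sum_(l < B) chihara_coef j l *: chihara_prod l.
  by rewrite scaler_sumr; apply: eq_bigr => l _; rewrite scalerA.
congr (_ *: _).
rewrite [RHS](bigID (fun l : 'I_B => (l < j.+1)%N))/= [X in _ = _ + X]big1 ?addr0; last first.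
  by move=> l; rewrite -leqNgt => jl; rewrite chihara_coef_eq0 ?scale0r.
rewrite -(big_ord_widen B (fun l => chihara_coef j l *: chihara_prod l))//.
by apply: eq_bigr => l _; rewrite /chihara_coef !exprM.
Qed.

(** The factor of index l is 1 - Q^l (a + b) + Q^(n+2l), so it expresses
multiplication by a + b through two neighbouring products. *)
Lemma shift_poly_chihara_prod l : shift_poly * chihara_prod l =
  (Q * Q ^- l * (1 + Q ^+ n * Q ^+ l ^+ 2)) *: chihara_prod l - (Q * Q ^- l) *: chihara_prod l.+1.
Proof.
have E : Q ^+ l *: shift_poly = (Q * (1 + Q ^+ n * Q ^+ l ^+ 2))%:P - Q *: chihara_factor l.
  rewrite /shift_poly /chihara_factor; apply/polyP => i; rewrite !coefE.
  have -> : q ^+ (2 * l + 2 * n) = Q ^+ l * Q ^+ n by rewrite exprD !exprM.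
  have -> : q ^+ (2 * l + 2 * n - 2) = Q ^+ l * Q ^+ n.-1.
    by rewrite -[in LHS](prednK n_gt0) mulnS addnCA addKn exprD !exprM.
  rewrite exprM [Q ^+ n.+1]exprS -(prednK n_gt0) [Q ^+ n.-1.+1]exprS /=.
  by case: (i == 0%N); case: (i == 1%N); ring.
rewrite /chihara_prod big_ord_recr /= -/(chihara_prod l).
have Ql : Q ^+ l != 0 by rewrite !expf_neq0.
apply: (scalerI Ql).

rewrite scalerBr !scalerA scalerAl E.
rewrite mulrBl mul_polyC -scalerAl [chihara_factor l * _]mulrC; congr (_ *: _ - _ *: _).
  by field; rewrite Ql.
by field; rewrite Ql.
Qed.

Lemma series_poly0 : series_poly 0 = 1.
Proof.
rewrite (@series_polyE 1)// big_ord1 /series_coef /chihara_coef /chihara_prod big_ord0 !qpoch0 !expr0.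
by rewrite !(mulr1, invr1) scale1r.
Qed.

Lemma series_poly1 : (1 - Q) *: series_poly 1 = shift_poly - (2 * Q ^+ n.+1)%:P.
Proof.
rewrite (@series_polyE 2)// big_ord_recl big_ord1 /series_coef /chihara_coef.
rewrite !lift0 !qpochS !qpoch0 !expr1 !expr0 !mul1r !mulr1.
have -> : chihara_prod (lift ord0 (ord0 : 'I_1)) = chihara_factor 0 by rewrite /chihara_prod big_ord1.
rewrite /chihara_prod big_ord0 /shift_poly /chihara_factor.
have r1 := q_reg 0; rewrite expr1 in r1.
have rn := q_reg n.-1; rewrite prednK// in rn.
apply/polyP => i; rewrite !coefE muln0 add0n expr0.
have -> : q ^+ (2 * n - 2) = Q ^+ n.-1.
  by rewrite -[in LHS](prednK n_gt0) mulnS addKn exprM.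
have Qn : Q ^+ n = Q * Q ^+ n.-1 by rewrite -exprS prednK.
rewrite [Q ^+ n.+1]exprS; move: rn; rewrite Qn => rn.
have [->|->] : (i == 0%N) = false \/ i = 0%N by case: i; [right|left].
  by case: (i == 1%N) => /=; field; rewrite q_neq0 r1 rn oner_neq0.
have -> : (0 == 1 :> nat) = false by [].
by rewrite eqxx /=; field; rewrite q_neq0 r1 rn oner_neq0.
Qed.

(** Both sides are expanded in the products [chihara_prod] and compared
coefficientwise. All coefficients of a given product are rational multiples of
a single one, of index (j + 1, l), which leaves an identity of rational functions
in Q, Q^j, Q^l and Q^n. *)
Lemma series_polySS j : (1 - Q ^+ j.+2) *: series_poly j.+2 =
  (shift_poly - (2 * Q ^+ n.+1 * Q ^+ j.+1)%:P) * series_poly j.+1 -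
  (Q ^+ n.+2 * (1 - Q ^+ (n + j))) *: series_poly j.
Proof.
pose B := j.+3.
rewrite !(@series_polyE B) /B//; last by rewrite ltnS ltnW.
have -> : (shift_poly - (2 * Q ^+ n.+1 * Q ^+ j.+1)%:P) *
      (\sum_(l < j.+3) (series_coef j.+1 * chihara_coef j.+1 l) *: chihara_prod l) =
    \sum_(l < j.+3) (series_coef j.+1 * chihara_coef j.+1 l *
      (Q * Q ^- l * (1 + Q ^+ n * Q ^+ l ^+ 2) - 2 * Q ^+ n.+1 * Q ^+ j.+1)) *: chihara_prod l
    - \sum_(l < j.+2) (series_coef j.+1 * chihara_coef j.+1 l * (Q * Q ^- l)) *: chihara_prod l.+1.
  rewrite mulr_sumr.
  under eq_bigr => l _.
    rewrite -scalerAr mulrBl shift_poly_chihara_prod mul_polyC addrAC -scalerBl scalerBr !scalerA.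
    over.
  rewrite sumrB; congr (_ - _).
  by rewrite big_ord_recr /= chihara_coef_eq0// mulr0 mul0r scale0r addr0.
rewrite !scaler_sumr addrAC -sumrB.
rewrite big_ord_recl [X in _ = X - _]big_ord_recl -addrA -sumrB.
have rj1 := q_reg j; have rj2 := q_reg j.+1.
have bS i : series_coef i.+1 = series_coef i * (Q * (1 - Q ^+ n * Q ^+ i) / (1 - Q ^+ i.+1)).
  rewrite /series_coef !qpochS -exprS; have ri := q_reg i.
  have nz := qpoch_exp_neq0 0 i; rewrite expr1 in nz.
  by rewrite (exprS Q i); rewrite (exprS Q i) in ri; field; rewrite nz ri.
have a0 i : chihara_coef i 0 = 1 by rewrite /chihara_coef !qpoch0 expr0 !(mulr1, invr1).
congr (_ + _).
  rewrite !scalerA -scalerBl; congr (_ *: _); rewrite !a0 !bS exprD.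
  rewrite expr0 invr1 expr1n.
  rewrite (exprS Q n.+1) (exprS Q n) (exprS Q j.+1) (exprS Q j) in rj1 rj2 *.
  by field; rewrite rj1 rj2.
apply: eq_bigr => l _; rewrite !lift0 !scalerA -!scalerBl; congr (_ *: _).
have q2 : Q != 0 by rewrite expf_neq0.
have qn i : Q ^+ i != 0 by rewrite expf_neq0.
have dS i : chihara_coef i l.+1 = chihara_coef i l * ((1 - Q ^- i * Q ^+ l) * Q /
    ((1 - Q ^+ n * Q ^+ l) * (1 - Q * Q ^+ l))).
  rewrite /chihara_coef !qpochS (exprS Q l); have := qpoch_exp_neq0 n.-1 l; rewrite prednK// => n1.
  have := qpoch_exp_neq0 0 l; rewrite expr1 => n2.
  have r1 := q_reg l; rewrite (exprS Q l) in r1.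
  have := q_reg (n.-1 + l); rewrite -addSn prednK// exprD => r2.
  by field; rewrite n1 n2 r1 r2 qn.
have aS i : chihara_coef i.+1 l * (1 - Q ^- i.+1 * Q ^+ l) = chihara_coef i l * (1 - Q ^- i.+1).
  rewrite /chihara_coef; set D := qpoch (Q ^+ n) Q l * qpoch Q Q l.
  transitivity ((qpoch (Q ^- i.+1) Q l.+1) * Q ^+ l / D); first by rewrite qpochS; ring.
  rewrite qpochSl (exprS Q i) invfM mulrA divff// mul1r; ring.
have nj i : 1 - Q ^- i.+1 != 0.
  have := q_reg i; apply: contra_neq => /(congr1 (fun x => x * Q ^+ i.+1)).
  by rewrite mulrBl mul1r mulVf// mul0r => /eqP; rewrite subr_eq0 => /eqP ->; rewrite subrr.
(* Dividing by 1 - Q^-(i+1) turns all coefficients into multiples of one. *)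
have aP i : chihara_coef i l = chihara_coef i.+1 l * (1 - Q ^- i.+1 * Q ^+ l) / (1 - Q ^- i.+1).
  by rewrite aS mulfK.
rewrite !dS.
have e2 : chihara_coef j.+2 l * (1 - Q ^- j.+2 * Q ^+ l) = chihara_coef j.+1 l * (1 - Q ^- j.+2).
  exact: aS.
rewrite (aP j).
transitivity ((1 - Q ^+ j.+2) * (series_coef j.+2 *
   (chihara_coef j.+2 l * (1 - Q ^- j.+2 * Q ^+ l)) * (Q /
    ((1 - Q ^+ n * Q ^+ l) * (1 - Q * Q ^+ l))))); first by ring.
rewrite e2 !bS exprD; move: (chihara_coef _ _) (series_coef _) => s b.
have r1 := q_reg l; rewrite (exprS Q l) in r1.
have := q_reg (n.-1 + l); rewrite -addSn prednK// exprD => r2.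
have nj1 := nj j.
rewrite (exprS Q n.+1) (exprS Q n) (exprS Q j.+1) (exprS Q j) (exprS Q l) in rj1 rj2 nj1 *.
move: (qn j) (qn l) (qn n) r1 r2 rj1 rj2 nj1.
move: (Q ^+ j) (Q ^+ l) (Q ^+ n) => x y z x0 y0 z0 r1 r2 rj1 rj2 nj1.
have xQ : x * Q - 1 != 0.
  by rewrite -opprB oppr_eq0 mulrC.
have xQ' : Q * x - 1 != 0 by rewrite mulrC.
move: q2 r1 r2 rj1 rj2 nj1 xQ xQ'; move: Q => p q2 r1 r2 rj1 rj2 nj1 xQ xQ'.
by field; rewrite ?x0 ?y0 ?z0 ?q2 ?r1 ?r2 ?rj1 ?rj2 ?xQ ?xQ'.
Qed.

End AlSalamChihara.

(** * Polynomial functions and polynomials in an operator *)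

Section PolynomialFunctions.
Variable K : fieldType.
Implicit Types (phi psi : K -> K).

Definition polyfun phi := exists p : {poly K}, forall t, phi t = p.[t].

Lemma polyfunC (a : K) : polyfun (fun=> a).
Proof. by exists a%:P => t; rewrite hornerC. Qed.

Lemma polyfunX N : polyfun (fun t => t ^+ N).
Proof. by exists 'X^N => t; rewrite hornerXn. Qed.

Lemma polyfunM phi psi : polyfun phi -> polyfun psi -> polyfun (fun t => phi t * psi t).
Proof. by move=> [p pE] [r rE]; exists (p * r) => t; rewrite hornerM pE rE. Qed.

Lemma polyfun_sum (I : Type) (s : seq I) (F : I -> K -> K) :
  (forall i, polyfun (F i)) -> polyfun (fun t => \sum_(i <- s) F i t).
Proof.
move=> FP; elim: s => [|i s [p pE]].
  by exists 0 => t; rewrite big_nil horner0.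
by have [r rE] := FP i; exists (r + p) => t; rewrite big_cons hornerD rE pE.
Qed.

Lemma polyfun_prod (I : Type) (s : seq I) (F : I -> K -> K) :
  (forall i, polyfun (F i)) -> polyfun (fun t => \prod_(i <- s) F i t).
Proof.
move=> FP; elim: s => [|i s [p pE]].
  by exists 1 => t; rewrite big_nil hornerC.
by have [r rE] := FP i; exists (r * p) => t; rewrite big_cons hornerM rE pE.
Qed.

Lemma polyfun_qpoch (a b : K) m : polyfun (fun t => qpoch (a * t) b m).
Proof.
apply: polyfun_prod => i; exists (1 - (a * b ^+ i) *: 'X) => t.
by rewrite !hornerE mulrAC.
Qed.

(** A polynomial with infinitely many roots vanishes. *)
Lemma eq_poly_seq (u : nat -> K) (p r : {poly K}) : injective u ->
  (forall i, p.[u i] = r.[u i]) -> p = r.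
Proof.
move=> uI pr; apply/eqP; rewrite -subr_eq0; apply/eqP.
apply: (@roots_geq_poly_eq0 _ _ (map u (iota 0 (size (p - r))))).
- by apply/allP => _ /mapP[i _ ->]; rewrite /root hornerD hornerN pr subrr.
- by rewrite map_inj_uniq ?iota_uniq.
- by rewrite size_map size_iota.
Qed.

End PolynomialFunctions.

Section PolyOperators.
Variables (R : realType) (n : nat) (D : infmx R n -> infmx R n).
Hypothesis lD : linear D.
Implicit Types (p r : {poly R[i]}) (f : infmx R n).

Lemma polyopE B p f : (size p <= B)%N ->
  polyop D p f = \sum_(i < B) p`_i *: iter i D f.
Proof.
move=> pB; rewrite /polyop (big_ord_widen B (fun i => p`_i *: iter i D f))//.
rewrite big_mkcond; apply: eq_bigr => i _; case: ifPn => //.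
by rewrite -leqNgt => pi; rewrite nth_default// scale0r.
Qed.

Lemma polyopD p r f : polyop D (p + r) f = polyop D p f + polyop D r f.
Proof.
pose B := maxn (size p) (size r).
rewrite !(@polyopE B) ?leq_maxl ?leq_maxr ?size_polyD//.
by rewrite -big_split; apply: eq_bigr => i _; rewrite coefD scalerDl.
Qed.

Lemma polyopZ a p f : polyop D (a *: p) f = a *: polyop D p f.
Proof.
rewrite !(@polyopE (size p)) ?size_scale_leq// scaler_sumr.
by apply: eq_bigr => i _; rewrite coefZ scalerA.
Qed.

Lemma polyopB p r f : polyop D (p - r) f = polyop D p f - polyop D r f.
Proof. by rewrite -[- r]scaleN1r polyopD polyopZ scaleN1r. Qed.

Lemma polyopXM p f : polyop D ('X * p) f = D (polyop D p f).
Proof.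
rewrite [polyop D p f](@polyopE (size p))// (lin_sum _ _ _ lD).
rewrite (@polyopE (size p).+1); last first.
  by rewrite (leq_trans (size_polyMleq _ _))// size_polyX addSn.
rewrite big_ord_recl coefXM scale0r add0r; apply: eq_bigr => i _.
by rewrite coefXM lift0 /= (linZ _ _ lD).
Qed.

Lemma polyopC a f : polyop D a%:P f = a *: f.
Proof. by rewrite (@polyopE 1) ?size_polyC_leq1// big_ord1 coefC eqxx. Qed.

End PolyOperators.

(** * Coefficients in t of the Berezin transform *)

Section BerezinSeries.
Variables (R : realType) (n : nat) (q : R[i]).
Hypothesis n_gt0 : (0 < n)%N.
Hypothesis q_neq0 : q != 0.
Hypothesis q_reg : forall N, 1 - (q ^+ 2) ^+ N.+1 != 0.
Local Notation Q := (q ^+ 2).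
Local Notation c := (Q ^+ n.+1).
Implicit Types (f g : infmx R n) (k l : mindex n) (t : R[i]).

Lemma Qpow_inj : injective (fun i => Q ^+ i.+1).
Proof.
have H i d : Q ^+ i.+1 != Q ^+ (i + d.+1).+1.
  rewrite -subr_eq0 -addSn exprD -[X in X - _]mulr1 -mulrBr.
  by rewrite mulf_neq0 ?q_reg// !expf_neq0.
move=> i j /eqP /= E; have [ij|ji|//] := ltngtP i j.
  by move: E; rewrite -(subnKC ij) addSnnS (negPf (H _ _)).
by move: E; rewrite -(subnKC ji) addSnnS eq_sym (negPf (H _ _)).
Qed.

(** Each entry uses finitely many entries of M_t e(t E) f, which are polynomial in t. *)
Lemma berezin_core_polyfun K f : exists P : mindex n -> mindex n -> {poly R[i]},
  forall k l t, (P k l).[t] = berezin_core q K t f k l.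
Proof.
suff H k l : exists p : {poly R[i]}, forall t, p.[t] = berezin_core q K t f k l.
  exists (fun k l => sval (cid (H k l))) => k l t.
  by case: cid.
suff [p pE] : polyfun (fun t => berezin_core q K t f k l) by exists p => t; rewrite pE.
pose g t := poch_scale q t (qexp_lower q K t f).
have gP k' l' : polyfun (fun t => g t k' l').
  apply: polyfunM; first by apply: polyfunM; exact: polyfun_qpoch.
  have [p pE] : polyfun (fun t => \sum_(N < K) t ^+ N *
      (iter N (lower q) f k' l' / qpoch Q Q N)).
    by apply: polyfun_sum => N; apply: polyfunM; [exact: polyfunX|exact: polyfunC].
  exists p => t; rewrite -pE /qexp_lower infmx_sumE; apply: eq_bigr => N _.
  by rewrite infmxZE mulrAC mulrA.
have rP N k' l' : polyfun (fun t => raises q N (g t) k' l').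
  elim: N k' l' => [|N IH] k' l'; first exact: gP.
  change (polyfun (fun t => raise q (raises q N (g t)) k' l')); rewrite /raise.
  apply: polyfun_sum => i.
  case: ((0 < k' i)%N && (0 < l' i)%N); last exact: polyfunC.
  by apply: polyfunM; [exact: polyfunC|exact: IH].
have [p pE] : polyfun (fun t => \sum_(N < (deg k).+1)
    t ^+ N * ((qpoch Q Q N)^-1 * raises q N (g t) k l)).
  apply: polyfun_sum => N; apply: polyfunM; first exact: polyfunX.
  by apply: polyfunM; [exact: polyfunC|exact: rP].
exists p => t; rewrite -pE /berezin_core /qexp_raise /qexp_raise_trunc infmx_sumE.
by apply: eq_bigr => N _; rewrite infmxZE mulrA.
Qed.

(** W reads finitely many entries with constant coefficients, so it commutes both
with evaluation and with taking coefficients. *)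
Lemma shift_op_polyfun (P : mindex n -> mindex n -> {poly R[i]}) k l : exists p : {poly R[i]},
  (forall t, p.[t] = shift_op q (fun k l => (P k l).[t]) k l) /\
  (forall j, p`_j = shift_op q (fun k l => (P k l)`_j) k l).
Proof.
exists (\sum_(i < n) lcoef q i k l *: P (madd (munit i) k) (madd (munit i) l) +
  \sum_(i < n) (if (0 < k i)%N && (0 < l i)%N
    then rcoef q i k l *: P (msub k (munit i)) (msub l (munit i)) else 0) +
  c *: ((Q ^+ deg k * 1 ^+ deg l) *: P k l + (1 ^+ deg k * Q ^+ deg l) *: P k l)).
split=> [t|j]; rewrite /shift_op !(infmxDE, infmxZE) /deg_scale.
  rewrite !hornerE !horner_sum; congr (_ + _ + _ * (_ + _)).
    by apply: eq_bigr => i _; rewrite hornerZ.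
  by apply: eq_bigr => i _; case: ifP => _; rewrite ?hornerZ ?horner0.
rewrite !coefE; congr (_ + _ + _ * (_ + _)).
  by apply: eq_bigr => i _; rewrite coefZ.
by apply: eq_bigr => i _; case: ifP => _; rewrite ?coefZ ?coef0.
Qed.

Section Recurrence.
Variables (K : nat) (f : infmx R n) (P : mindex n -> mindex n -> {poly R[i]}).
Hypothesis Kf : bounded K f.
Hypothesis PE : forall k l t, (P k l).[t] = berezin_core q K t f k l.
Let Pc j : infmx R n := fun k l => (P k l)`_j.

(** At t = 0 all three factors of D_t are the identity. *)
Lemma bcoef0 : Pc 0 = f.
Proof.
apply/funext => k; apply/funext => l; rewrite /Pc -horner_coef0 PE.
rewrite /berezin_core /qexp_raise /qexp_raise_trunc infmx_sumE big_ord_recl big1 ?addr0; last first.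
  by move=> i _; rewrite lift0 expr0n mul0r infmxZE mul0r.
have q0 m : qpoch 0 Q m = 1.
  by rewrite /qpoch big1// => i _; rewrite mul0r subr0.
rewrite infmxZE qpoch0 expr0 divr1 mul1r /raises /= /poch_scale mulr0 !q0.
rewrite !mul1r /qexp_lower infmx_sumE.
case: K Kf => [K0|K' _]; first by rewrite big_ord0 K0.
rewrite big_ord_recl big1 ?addr0; last first.
  by move=> i _; rewrite lift0 expr0n mul0r infmxZE mul0r.
by rewrite infmxZE qpoch0 expr0 divr1 mul1r.
Qed.

Let key k l : exists2 p : {poly R[i]}, (forall j, p`_j = shift_op q (Pc j) k l) &
  P k l + Q ^+ n.+2 *: ('X^2 * P k l) - 'X * p =
  (1 - (2 * c) *: 'X + (c ^+ 2) *: 'X^2) * \poly_(j < size (P k l)) (Q ^+ j * (P k l)`_j).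
Proof.
have [p [pt pj]] := shift_op_polyfun P k l; exists p => //.
apply: (eq_poly_seq Qpow_inj) => i; move: (Q ^+ i.+1) => t.
have PQ : (\poly_(j < size (P k l)) (Q ^+ j * (P k l)`_j)).[t] = (P k l).[Q * t].
  rewrite horner_poly horner_coef; apply: eq_bigr => j _.
  by rewrite (exprMn _ Q t) mulrCA mulrA.
rewrite !(hornerD, hornerN, hornerM, hornerZ, hornerX, hornerXn, hornerC) PQ pt.
have -> : (fun k l => (P k l).[t]) = berezin_core q K t f.
  by apply/funext => k'; apply/funext => l'; rewrite PE.
have := berezin_core_dilate q_reg t Kf => /(congr1 (fun g : infmx R n => g k l)).
rewrite !(infmxDE, infmxNE, infmxZE) -!PE => E.
rewrite (_ : 1 - 2 * c * t + c ^+ 2 * t ^+ 2 = (1 - c * t) ^+ 2); last by ring.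
by rewrite -E; ring.
Qed.

Let eq_diff (a b x y : R[i]) : a = b -> x - y = a - b -> x = y.
Proof. by move=> -> /eqP; rewrite subrr subr_eq0 => /eqP. Qed.

Let coef_dilate (p : {poly R[i]}) j :
  (\poly_(j < size p) (Q ^+ j * p`_j))`_j = Q ^+ j * p`_j.
Proof. by rewrite coef_poly; case: ltnP => // pj; rewrite nth_default// mulr0. Qed.

Lemma bcoef1 : (1 - Q) *: Pc 1 = shift_op q (Pc 0) - (2 * c) *: Pc 0.
Proof.
apply/funext => k; apply/funext => l; rewrite !(infmxDE, infmxNE, infmxZE).
have [p pE /(congr1 (fun p : {poly _} => p`_1))] := key k l.
rewrite [(_ - _ + _) * _]mulrDl mulrBl [1 * _]mul1r => E.
rewrite -!scalerAl !(coefD, coefN, coefZ, coefXM, coefXnM) /= in E.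
rewrite !coef_dilate pE expr1 expr0 !mulr0 !addr0 mul1r in E.
by apply: (eq_diff E); rewrite /Pc; ring.
Qed.

Lemma bcoefSS j : (1 - Q ^+ j.+2) *: Pc j.+2 =
  shift_op q (Pc j.+1) - (2 * c * Q ^+ j.+1) *: Pc j.+1 -
  (Q ^+ n.+2 * (1 - Q ^+ (n + j))) *: Pc j.
Proof.
apply/funext => k; apply/funext => l; rewrite !(infmxDE, infmxNE, infmxZE).
have [p pE /(congr1 (fun p : {poly _} => p`_j.+2))] := key k l.
rewrite [(_ - _ + _) * _]mulrDl mulrBl [1 * _]mul1r => E.
rewrite -!scalerAl !(coefD, coefN, coefZ, coefXM, coefXnM) /= in E.
rewrite !coef_dilate pE !subSS subn0 in E.
apply: (eq_diff E); rewrite /Pc exprD (exprS Q n.+1) (exprS Q n).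
rewrite (exprS Q j.+1) (exprS Q j); ring.
Qed.

Variable D : infmx R n -> infmx R n.
Hypothesis lD : linear D.
Hypothesis DE : forall g,
  shift_op q g = (Q + Q ^+ n.+1) *: g + (Q ^+ n * (1 - Q) ^+ 2) *: D g.

(** Both sides satisfy the same three-term recurrence with the same first two
terms. The operator D stands for the Laplace operator. *)
Lemma bcoefE j : Pc j = polyop D (series_poly q n j) f.
Proof.
have wE p : polyop D (shift_poly q n * p) f = shift_op q (polyop D p f).
  rewrite DE /shift_poly mulrDl polyopD -scalerAl polyopZ polyopXM//.
  by rewrite mul_polyC polyopZ.
suff: Pc j = polyop D (series_poly q n j) f /\ Pc j.+1 = polyop D (series_poly q n j.+1) f by case.
elim: j => [|j [IH0 IH1]]; split=> //.
- by rewrite series_poly0// bcoef0 -polyC1 polyopC scale1r.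
- have r1 := q_reg 0; rewrite expr1 in r1; apply: (scalerI r1).
  rewrite bcoef1 -polyopZ series_poly1// -polyCN polyopD polyopC scaleNr.
  by rewrite -[shift_poly q n]mulr1 wE -polyC1 polyopC scale1r bcoef0.
apply: (scalerI (q_reg j.+1)).
rewrite bcoefSS -polyopZ series_polySS// mulrBl mul_polyC !polyopB wE.
by rewrite (polyopZ D _ (series_poly q n j.+1)) (polyopZ D _ (series_poly q n j)) -IH0 -IH1.
Qed.

End Recurrence.
End BerezinSeries.

(** * Sums over multi-indices of given degree *)

Section FiniteSets.
Variable n : nat.
Implicit Types (r m : mindex n) (i : 'I_n).

Lemma finite_degree_lt K : finite_set [set r : mindex n | (deg r < K)%N].
Proof.
pose emb (h : {ffun 'I_n -> 'I_K.+1}) : mindex n := [ffun i => val (h i)].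
apply: (@sub_finite_set _ _ (emb @` setT)); last exact/finite_image/finite_finset.
move=> r /= rK; exists [ffun i => inord (r i)] => //.
apply/ffunP => i; rewrite !ffunE /= inordK//.
rewrite ltnS (leq_trans _ (ltnW rK))// /deg (bigD1 i)//=; exact: leq_addr.
Qed.

Lemma finite_degree K : finite_set [set r : mindex n | deg r = K].
Proof. by apply: sub_finite_set (finite_degree_lt K.+1) => r /= ->. Qed.

Lemma sum_degreeE (V : nmodType) K (G : mindex n -> V) :
  \sum_(r \in [set r | deg r = K]) G r =
  \sum_(r <- fset_set [set r : mindex n | deg r = K]) G r.
Proof. exact/fsbig_finite/finite_degree. Qed.

(** Reindexing by the addition of the i-th unit vector, whose image consists of the
multi-indices with positive i-th entry. *)
Lemma sum_degreeS (V : nmodType) K i (G : mindex n -> V) :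
  (forall r, r i = 0%N -> G r = 0) ->
  \sum_(r \in [set r | deg r = K]) G (madd (munit i) r) =
  \sum_(r \in [set r | deg r = K.+1]) G r.
Proof.
move=> G0.
rewrite -[RHS](@fsbig_widen _ _ _ _ [set r | deg r = K.+1 /\ (0 < r i)%N])//=; last 2 first.
- by move=> r [].
- move=> r [/= rK] /not_andP[//|/negP]; rewrite -leqNgt leqn0 => /eqP; exact: G0.
rewrite [RHS](reindex_fsbig (madd (munit i)) [set r | deg r = K])//.
split=> [r /= rK|r r' _ _ /(congr1 (fun m => msub m (munit i)))|r /= [rK ri]].
- by rewrite deg_madd deg_munit add1n rK !ffunE eqxx.
- by rewrite !maddKl.
exists (msub r (munit i)); last exact: madd_munitK.
by apply: succn_inj; rewrite -rK -{2}(madd_munitK ri) deg_madd deg_munit.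
Qed.

End FiniteSets.

(** * Explicit form of the powers of the lowering operator *)

Section LoweringExpansion.
Variables (R : realType) (n : nat) (q : R).
Hypothesis q01 : 0 < q < 1.
Local Notation Q := (q ^+ 2).
Local Notation qc := (q%:C).
Implicit Types (f : infmx R n) (k l m r a b : mindex n) (i : 'I_n).

Lemma Q_reg N : 1 - Q ^+ N.+1 != 0.
Proof. by rewrite subr_eq0 eq_sym exprS exprq2_neq1. Qed.

Lemma Qc_reg N : 1 - (qc ^+ 2) ^+ N.+1 != 0.
Proof. by rewrite -!rmorphXn /= -(rmorph1 (real_complex R)) -rmorphB /= fmorph_eq0 Q_reg. Qed.

Lemma qc_neq0 : qc != 0. Proof. by rewrite fmorph_eq0 q_neq0. Qed.

(** The exponent of q in z^a z^r e_0: moving the factors of z^a to their places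
past z^r contributes a_i r_j for every i < j. *)
Definition cross a r : nat := (\sum_(j < n) r j * low j a)%N.
(** The exponent of q^2 in the weight q^(2 k_2) ... q^(2 k_n) at k = tails r. *)
Definition height r : nat := (\sum_(j < n) j * r j)%N.

Lemma crossE a r : cross a r = (\sum_(i < n) a i * \sum_(j < n | (i < j)%N) r j)%N.
Proof.
rewrite /cross /low; under eq_bigr do rewrite big_distrr /=.
rewrite (exchange_big_dep xpredT)//=; apply: eq_bigr => i _.
by rewrite big_distrr; apply: eq_bigr => j _; rewrite mulnC.
Qed.

Lemma cross_madd a r r' : cross a (madd r r') = (cross a r + cross a r')%N.
Proof. by rewrite -big_split; apply: eq_bigr => j _; rewrite ffunE mulnDl. Qed.

Lemma cross_munit a i : cross a (munit i) = low i a.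
Proof.
rewrite /cross (bigD1 i)//= ffunE eqxx mul1n big1 ?addn0// => j /negPf ji.
by rewrite ffunE ji.
Qed.

Lemma height_madd r r' : height (madd r r') = (height r + height r')%N.
Proof. by rewrite -big_split; apply: eq_bigr => j _; rewrite ffunE mulnDr. Qed.

Lemma height_munit i : height (munit i) = i.
Proof.
rewrite /height (bigD1 i)//= ffunE eqxx muln1 big1 ?addn0// => j /negPf ji.
by rewrite ffunE ji muln0.
Qed.

(** The coefficient of f (a + r) (b + r) in (f z^b, z^a), without the powers of t
and divided by the common factor of all r. *)
Definition kappa a b r : R :=
  q ^+ (cross a r + cross b r) * Q ^+ (deg r + height r) *
  (hnorm q (madd a r) / (hnorm q a * hnorm q r)).

(** One more application of E multiplies kappa by an increment of the function
s -> - Q^(low s r), and these increments telescope to 1 - Q^|r|. *)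
Lemma kappa_munit i a b r :
  (kappa a b r)%:C * lcoef qc i (madd a r) (madd b r) =
  (kappa a b (madd (munit i) r) *
    (Q ^+ low i (madd (munit i) r) - Q ^+ low i.+1 (madd (munit i) r)))%:C.
Proof.
have -> : lcoef qc i (madd a r) (madd b r) = (q ^+ (low i (madd a r) +
    low i (madd b r)) * (1 - Q ^+ (madd a r i).+1) * Q ^+ i.+1)%:C.
  by rewrite /lcoef !(rmorphM, rmorphB, rmorphXn, rmorph1).
rewrite -rmorphM /=; congr (_%:C).
rewrite lowS !low_madd low_munit ltnn add0n !ffunE eqxx add1n /kappa.
rewrite !cross_madd !cross_munit height_madd height_munit deg_madd deg_munit.
have -> : madd a (madd (munit i) r) = madd (munit i) (madd a r).
  exact: maddCA.
rewrite !hnormS// !ffunE.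
have h1 := hnorm_neq0 q01 a; have h2 := hnorm_neq0 q01 r.
have r1 := Q_reg (r i); rewrite -exprM in r1.
rewrite -!exprM !mul2n -!addnn in r1 *; rewrite !exprD !exprS expr0 in r1 *.
by field; rewrite r1 h1 h2.
Qed.

Lemma sum_low_telescope r : \sum_(i < n) (Q ^+ low i r - Q ^+ low i.+1 r) = 1 - Q ^+ deg r.
Proof.
rewrite -(big_mkord xpredT (fun s => Q ^+ low s r - Q ^+ low s.+1 r)) -[LHS]opprK -sumrN.
under eq_bigr do rewrite opprB.
by rewrite telescope_sumr// opprB low0 lown expr0.
Qed.

Lemma hnorm_mzero : hnorm q (mzero n) = 1.
Proof. by rewrite /hnorm big1// => i _; rewrite ffunE qpoch0. Qed.

Lemma kappa0 a b : kappa a b (mzero n) = 1.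
Proof.
have m0 : madd a (mzero n) = a by apply/ffunP => j; rewrite !ffunE addn0.
rewrite /kappa m0 hnorm_mzero mulr1 divff ?hnorm_neq0// mulr1.
rewrite /cross /deg /height !big1 ?expr0 ?mulr1// => i _; by rewrite ffunE ?muln0.
Qed.

(** Induction on N. By [kappa_munit] and a telescoping sum, the ways to
write a multi-index of degree N + 1 as a unit vector plus a rest contribute a
total factor 1 - Q^(N+1), which (Q; Q)_(N+1) cancels. *)
Lemma iter_lowerE N f a b : iter N (lower qc) f a b / qpoch (qc ^+ 2) (qc ^+ 2) N =
  \sum_(r \in [set r | deg r = N]) (kappa a b r)%:C * f (madd a r) (madd b r).
Proof.
elim: N f => [|N IH] f.
  rewrite qpoch0 divr1 /= (_ : [set r | deg r = 0%N] = [set mzero n]).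
    rewrite fsbig_set1 kappa0 mul1r.
    by congr f; apply/ffunP => j; rewrite !ffunE addn0.
  apply/seteqP; split=> r /= => [r0|->]; last by rewrite /deg big1// => i _; rewrite ffunE.
  apply/ffunP => i; rewrite ffunE; move: r0; rewrite /deg (bigD1 i)//=.
  by case: (r i).
rewrite iterSr qpochS invfM mulrA IH -exprS.
apply: (canLR (mulfK _)); first exact: Qc_reg.
pose G i r := (kappa a b r * (Q ^+ low i r - Q ^+ low i.+1 r))%:C * f (madd a r) (madd b r).
transitivity (\sum_(i < n) \sum_(r \in [set r | deg r = N]) G i (madd (munit i) r)).
  rewrite sum_degreeE; under [RHS]eq_bigr do rewrite sum_degreeE.
  rewrite exchange_big; apply: eq_bigr => r _; rewrite /lower mulr_sumr.
  apply: eq_bigr => i _; rewrite mulrA kappa_munit /G.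
  by rewrite (maddCA a) (maddCA b).
under eq_bigr => i _.
  rewrite sum_degreeS; last first.
    by move=> r ri; rewrite /G lowS ri addn0 subrr mulr0 mul0r.
  over.
under eq_bigr do rewrite sum_degreeE.
rewrite exchange_big sum_degreeE mulr_suml.
apply: eq_big_seq => r; rewrite in_fset_set; last exact: finite_degree.
move=> /set_mem /= rN.
rewrite -mulr_suml -rmorph_sum /= -mulr_sumr sum_low_telescope rN.
by rewrite rmorphM rmorphB rmorph1 !rmorphXn /= mulrAC.
Qed.

Lemma qexp_lowerE K t f a b : qexp_lower qc K t f a b =
  \sum_(r \in [set r | (deg r < K)%N])
     t ^+ deg r * ((kappa a b r)%:C * f (madd a r) (madd b r)).
Proof.
rewrite /qexp_lower infmx_sumE; elim: K => [|K IH].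
  by rewrite big_ord0 (_ : [set _ | _] = set0) ?fsbig_set0//; apply/seteqP; split.
rewrite big_ord_recr IH (_ : [set r | (deg r < K.+1)%N] =
  [set r | (deg r < K)%N] `|` [set r | deg r = K]); last first.
  apply/seteqP; split=> r /=.
    by rewrite ltnS leq_eqVlt => /orP[/eqP ?|?]; [right|left].
  by move=> [/ltnW|->].
rewrite fsbigU0; last 3 first.
- exact: finite_degree_lt.
- exact: finite_degree.
- by move=> r /= [+ rK]; rewrite rK ltnn.
congr (_ + _); rewrite infmxZE mulrAC -mulrA iter_lowerE mulr_fsumr.
by apply: eq_fsbigr => r; rewrite inE /= => ->.
Qed.

End LoweringExpansion.

(** * The q-binomial series *)

Section QBinomial.
Variables (R : realType) (q : R).
Hypothesis q01 : 0 < q < 1.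
Local Notation Q := (q ^+ 2).
Local Notation hq := (qpoch Q Q).

Lemma Q_ge0 : 0 <= Q. Proof. exact: sqr_ge0. Qed.

Lemma Q_lt1 N : Q ^+ N.+1 < 1.
Proof. by case/andP: q01 => q0 q1; rewrite -exprM exprn_ilt1// ltW. Qed.

Lemma qpoch_gt0 (y : R) m : 0 <= y < 1 -> 0 < qpoch y Q m.
Proof.
move=> /andP[y0 y1]; apply: prodr_gt0 => i _; rewrite subr_gt0.
rewrite (le_lt_trans _ y1)// ler_piMr// -exprM exprn_ile1//; case/andP: q01 => *; exact: ltW.
Qed.

Lemma hq_gt0 m : 0 < hq m.
Proof. by apply: qpoch_gt0; rewrite Q_ge0 -[Q]expr1 Q_lt1. Qed.

(** The q-binomial coefficient of a + p over a. *)
Definition gauss a p : R := hq (a + p) / (hq a * hq p).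

Lemma gauss_ge0 a p : 0 <= gauss a p.
Proof. by rewrite divr_ge0 ?mulr_ge0// ltW// hq_gt0. Qed.

Lemma gauss_a0 a : gauss a 0 = 1.
Proof. by rewrite /gauss addn0 qpoch0 mulr1 divff ?gt_eqF// hq_gt0. Qed.

Lemma gauss_0p p : gauss 0 p = 1.
Proof. by rewrite /gauss add0n qpoch0 mul1r divff ?gt_eqF// hq_gt0. Qed.

Lemma gauss_pascal a p :
  gauss a.+1 p.+1 = gauss a p.+1 + Q ^+ a.+1 * gauss a.+1 p.
Proof.
rewrite /gauss addSnnS !addnS !qpochS -!exprS.
have h1 : hq a != 0 by rewrite gt_eqF ?hq_gt0.
have h2 : hq p != 0 by rewrite gt_eqF ?hq_gt0.
have h3 := Q_reg q01 a; have h4 := Q_reg q01 p.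
have -> : Q ^+ (a + p).+2 = Q ^+ a.+1 * Q ^+ p.+1 by rewrite -exprD addSn addnS.
by field; rewrite h1 h2 h3 h4.
Qed.

(** Monotonicity and the recurrence bound u by V / (1 - rho); the limit exists and
is the fixed point of x -> V + rho x. *)
Lemma cvg_affine_rec (u v : nat -> R) (V rho : R) :
  0 <= rho < 1 -> nondecreasing_seq u -> v @ \oo --> V -> (forall N, v N <= V) ->
  (forall N, u N.+1 = v N.+1 + rho * u N) -> u @ \oo --> V / (1 - rho).
Proof.
move=> /andP[r0 r1] undec vV vle uS.
have r1' : 0 < 1 - rho by rewrite subr_gt0.
have uM N : u N <= V / (1 - rho).
  rewrite ler_pdivlMr// mulrBr mulr1 lerBlDr [u N * _]mulrC.
  by rewrite (le_trans (undec _ _ (leqnSn N)))// uS lerD2r.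
have uc : cvgn u.
  by apply: nondecreasing_is_cvgn => //; exists (V / (1 - rho)) => _ [N _ <-].
have E : limn u = V + rho * limn u.
  have c1 : (fun N => u N.+1) @ \oo --> limn u by rewrite (cvg_shiftS u).
  have c2 : (fun N => v N.+1 + rho * u N) @ \oo --> V + rho * limn u.
    by apply: cvgD; [rewrite (cvg_shiftS v)|exact: cvgMl_tmp].
  rewrite -[LHS](cvg_lim (@Rhausdorff R) c1) -[RHS](cvg_lim (@Rhausdorff R) c2).
  by congr (lim (_ @ \oo)); apply/funext => N; rewrite uS.
suff -> : V / (1 - rho) = limn u by [].
apply: (canLR (mulfK _)); first by rewrite gt_eqF.
by rewrite mulrBr mulr1 {1}E [rho * _]mulrC addrK.
Qed.

Lemma gauss_series_nondecreasing a (y : R) : 0 <= y ->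
  nondecreasing_seq (fun N => \sum_(p < N) y ^+ p * gauss a p).
Proof.
move=> y0; apply/nondecreasing_seqP => N.
by rewrite big_ord_recr /= lerDl mulr_ge0 ?gauss_ge0 ?exprn_ge0.
Qed.

(** Induction on a: the q-Pascal rule says that the partial sums for a + 1 satisfy
an affine recurrence with ratio y Q^(a+1), driven by the partial sums for a. So
each step divides the limit by 1 - y Q^(a+1). *)
Lemma q_binomial_cvg a (y : R) : 0 <= y < 1 ->
  (fun N => \sum_(p < N) y ^+ p * gauss a p) @ \oo --> (qpoch y Q a.+1)^-1.
Proof.
move=> y01; have /andP[y0 y1] := y01; elim: a => [|a IH].
  have y1' : `|y| < 1 by rewrite ger0_norm.
  have := cvg_geometric_series (a := 1) y1'.
  rewrite qpochS qpoch0 expr0 mulr1 !mul1r; apply: cvg_trans.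
  rewrite (_ : series _ = fun N => \sum_(p < N) y ^+ p * gauss 0 p)//.
  apply/funext => N; rewrite /series /= big_mkord; apply: eq_bigr => p _.
  by rewrite gauss_0p mulr1 /geometric mul1r.
rewrite qpochS invfM.
have r01 : 0 <= y * Q ^+ a.+1 < 1.
  apply/andP; split; first exact: mulr_ge0 y0 (exprn_ge0 _ Q_ge0).
  by apply: le_lt_trans y1; rewrite ler_piMr// ltW ?Q_lt1.
apply: (cvg_affine_rec r01 _ IH).
- exact: gauss_series_nondecreasing.
- move=> N; rewrite -(cvg_lim (@Rhausdorff R) IH).
  apply: nondecreasing_cvgn_le; first exact: gauss_series_nondecreasing.
  by apply: cvgP IH.
- move=> N; rewrite big_ord_recl [in RHS]big_ord_recl !gauss_a0 -addrA; congr (_ + _).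
  rewrite mulr_sumr -big_split; apply: eq_bigr => p _.
  by rewrite lift0 gauss_pascal (exprS y) /=; ring.
Qed.

End QBinomial.

(** * Sums over multi-indices of products *)

Section ProductSums.
Variables (R : realType) (n : nat).
Implicit Types p : mindex n.

Lemma cvg_prod_seq (I : Type) (s : seq I) (u : I -> nat -> R) (S : I -> R) :
  (forall i, u i @ \oo --> S i) ->
  (fun N => \prod_(i <- s) u i N) @ \oo --> \prod_(i <- s) S i.
Proof.
move=> uS; elim: s => [|i s IH].
  rewrite big_nil; under [fun N => _]funext do rewrite big_nil; exact: cvg_cst.
rewrite big_cons; under [fun N => _]funext do rewrite big_cons.
exact: cvgM.
Qed.

(** Every finite set of multi-indices lies in a box, and on a box the sum of the
products is the product of the partial sums. *)
Lemma esum_mindex_prod (c : R) (G : 'I_n -> nat -> R) (S : 'I_n -> R) :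
  0 <= c -> (forall i (p : nat), 0 <= G i p) ->
  (forall i, (fun N => \sum_(p < N) G i p) @ \oo --> S i) ->
  (\esum_(p in [set: mindex n]) (c * \prod_i G i (p i))%:E = (c * \prod_i S i)%:E)%E.
Proof.
move=> c0 G0 GS.
have P0 p : 0 <= c * \prod_i G i (p i) by rewrite mulr_ge0 ?prodr_ge0.
pose emb N (h : {ffun 'I_n -> 'I_N}) : mindex n := [ffun i => val (h i)].
have embI N : injective (@emb N).
  move=> h h' /ffunP hh; apply/ffunP => i; apply: val_inj.
  by have := hh i; rewrite !ffunE.
pose box N := [seq emb N h | h <- enum {ffun 'I_n -> 'I_N}].
have boxU N : uniq (box N) by rewrite (map_inj_uniq (@embI N)) enum_uniq.
have boxE N : \sum_(p <- box N) (c * \prod_i G i (p i)) =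
    c * \prod_i \sum_(p < N) G i p.
  rewrite -mulr_sumr; congr (_ * _).
  rewrite big_map big_enum bigA_distr_bigA /=; apply: eq_bigr => h _.
  by apply: eq_bigr => i _; rewrite ffunE.
have cvgbox : (fun N => c * \prod_i \sum_(p < N) G i p) @ \oo --> c * \prod_i S i.
  apply: cvgMl_tmp; exact: (@cvg_prod_seq _ _ (fun i N => \sum_(p < N) G i p)) GS.
have undec i : nondecreasing_seq (fun N => \sum_(p < N) G i p).
  by apply/nondecreasing_seqP => N; rewrite big_ord_recr lerDl G0.
have uS i N : \sum_(p < N) G i p <= S i.
  rewrite -(cvg_lim (@Rhausdorff R) (GS i)).
  apply: (nondecreasing_cvgn_le (undec i)); exact: cvgP (GS i).
have fsE (s : seq (mindex n)) : uniq s ->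
    (\sum_(p \in [set` s]) (c * \prod_i G i (p i))%:E)%E =
    (\sum_(p <- s) (c * \prod_i G i (p i)))%:E.
  by move=> us; rewrite -fsbig_seq// sumEFin.
apply/eqP; rewrite eq_le; apply/andP; split.
  apply: ub_ereal_sup => _ [A [finA _] <-].
  have [s [us As]] : exists s : seq (mindex n), uniq s /\ A = [set` s].
    exists (fset_set A); split; first exact: fset_uniq.
    by apply/seteqP; split=> p; rewrite /= in_fset_set// ?inE.
  rewrite As fsE// lee_fin.
  pose N := (\sum_(p <- s) deg p).+1.
  apply: (@le_trans _ _ (\sum_(p <- box N) (c * \prod_i G i (p i)))).
    have sb : {subset s <= box N}.
      move=> p ps; apply/mapP; exists [ffun i => inord (p i)]; rewrite ?mem_enum//.
      apply/ffunP => i; rewrite !ffunE /= inordK// /N ltnS.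
      apply: leq_trans (_ : deg p <= _)%N; first by rewrite /deg (bigD1 i)//= leq_addr.
      by rewrite (bigD1_seq p)//= leq_addr.
    have sE : perm_eq [seq p <- box N | p \in s] s.
      apply: uniq_perm => //; first exact: filter_uniq.
      by move=> p; rewrite mem_filter; case: (boolP (p \in s)) => //= /sb ->.
    rewrite -(perm_big _ sE) big_filter big_mkcond; apply: ler_sum => p _.
    by case: ifP.
  by rewrite boxE ler_wpM2l//; apply: ler_prod => i _; rewrite uS andbT sumr_ge0.
have E N : ((c * \prod_i \sum_(p < N) G i p)%:E <=
    \esum_(p in [set: mindex n]) (c * \prod_i G i (p i))%:E)%E.
  rewrite -boxE -fsE//; apply: ereal_sup_ubound; exists [set` box N] => //.
  by split => //; exact: finite_seq.
case: (\esum_(p in _) _)%E E => [r E| |E]; rewrite ?leey//; last first.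
  by have := E 0%N; rewrite leNgt ltNyr.
rewrite lee_fin -(cvg_lim (@Rhausdorff R) cvgbox); apply: limr_le.
  exact: cvgP cvgbox.
by apply: nearW => N; rewrite -lee_fin.
Qed.

End ProductSums.

(** * Norms of the monomials *)

Section Weights.
Variables (R : realType) (n : nat) (q : R).
Hypothesis q01 : 0 < q < 1.
Local Notation Q := (q ^+ 2).
Implicit Types (a m p : mindex n).

Lemma weight_tails (x : R) m :
  weight q x (tails m) = \prod_(l < n) (x * Q ^+ l) ^+ m l.
Proof.
rewrite /weight; pose b (j : nat) := if j == 0%N then x else Q.
under eq_bigr do rewrite -/(b _) ffunE -prodrXr.
rewrite (exchange_big_dep xpredT)//=; apply: eq_bigr => l _.
rewrite prodrXl; congr (_ ^+ _).
rewrite (eq_bigl (fun j : 'I_n => (j < l.+1)%N))//.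
rewrite -(big_ord_widen n (fun j => b j))// big_ord_recl; congr (_ * _).
by rewrite -[in RHS](card_ord l) -prodr_const; apply: eq_bigr.
Qed.

Lemma weightE (x : R) m : weight q x (tails m) = x ^+ deg m * Q ^+ height m.
Proof.
rewrite weight_tails; under eq_bigr do rewrite exprMn -(exprM Q).
by rewrite big_split /= !prodrXr.
Qed.

Lemma wt2E al l p : wt2 q al (l, p) = qpoch (q `^ (2 * al + 2)) Q n *
  (hnorm q l / hnorm q p * (q `^ (2 * al + 2) ^+ deg p * Q ^+ height p)).
Proof. by rewrite /wt2 /= weightE. Qed.

Variable al : R.
Hypothesis al_gt0 : 0 < al.
Local Notation x := (q `^ (2 * al + 2)).

Lemma x_ge0 : 0 <= x < 1.
Proof.
case/andP: q01 => q0 q1; rewrite powR_ge0 /=.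
have r0 : 0 < 2 * al + 2 by rewrite addr_gt0// mulr_gt0.
have : q `^ (2 * al + 2) < 1 `^ (2 * al + 2).
  by apply: gt0_ltr_powR => //; rewrite nnegrE ltW.
by rewrite powR1.
Qed.

Lemma hnorm_gt0 m : 0 < hnorm q m.
Proof. by apply: prodr_gt0 => i _; exact: hq_gt0. Qed.

(** Positivity of the weight makes each matrix entry continuous for the norm. *)
Lemma wt2_gt0 l p : 0 < wt2 q al (l, p).
Proof.
case/andP: q01 => q0 q1.
rewrite wt2E mulr_gt0 ?qpoch_gt0 ?x_ge0// mulr_gt0 ?divr_gt0 ?hnorm_gt0//.
by rewrite mulr_gt0 ?exprn_gt0 ?powR_gt0.
Qed.

(** The contribution of the column p to the squared norm of z^a. *)
Definition zpow_mass a p : R := (q ^+ cross a p) ^+ 2 * wt2 q al (madd a p, p).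
(** The squared norm of z^a in L^2(dm). *)
Definition zpow_norm2 a : R := hnorm q a / qpoch (x * Q ^+ n) Q (deg a).

Lemma zpow_mass_ge0 a p : 0 <= zpow_mass a p.
Proof. by rewrite mulr_ge0 ?sqr_ge0// ltW ?wt2_gt0. Qed.

Lemma zpow_norm2_gt0 a : 0 < zpow_norm2 a.
Proof.
have /andP[x0 x1] := x_ge0; have Qn0 : 0 <= Q ^+ n by rewrite exprn_ge0 ?Q_ge0.
have Qn1 : Q ^+ n <= 1.
  by case: n => [|m]; rewrite ?expr0// ltW ?Q_lt1.
rewrite divr_gt0 ?hnorm_gt0// qpoch_gt0// mulr_ge0//=.
by apply: le_lt_trans x1; rewrite ler_piMr.
Qed.

(** The progressions of exponents starting at i + low i a with a_i + 1 terms are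
consecutive, and together they run through 0, ..., s + low s a - 1. *)
Lemma qpoch_low (y : R) a s : (s <= n)%N ->
  \prod_(i < n | (i < s)%N) qpoch (y * Q ^+ (i + low i a)) Q (a i).+1 =
  qpoch y Q (s + low s a).
Proof.
elim: s => [_|s IH sn]; first by rewrite big_pred0// low0 qpoch0.
rewrite (bigD1 (Ordinal sn))//= (eq_bigl (fun i : 'I_n => (i < s)%N)); last first.
  by move=> i; rewrite ltnS ltn_neqAle andbC -val_eqE.
rewrite IH; last exact: ltnW.
have := lowS (Ordinal sn) a; rewrite /= => ->.
by rewrite mulrC -qpochD addSn -!addnS addnA.
Qed.

(** The mass factorises over the coordinates into q-binomial series at the points
x Q^(i + low i a). The product of their sums is 1 / (x; Q)_(n + |a|) by
[qpoch_low], and (x; Q)_n is the normalisation of the measure. *)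
Lemma esum_zpow_mass a : (\esum_(p in [set: mindex n]) (zpow_mass a p)%:E = (zpow_norm2 a)%:E)%E.
Proof.
have /andP[x0 x1] := x_ge0.
pose y (i : 'I_n) := x * Q ^+ (i + low i a).
have y01 i : 0 <= y i < 1.
  apply/andP; split; first exact: mulr_ge0 x0 (exprn_ge0 _ (Q_ge0 q)).
  apply: le_lt_trans x1; rewrite ler_piMr//.
  by case: (_ + _)%N => [|m]; rewrite ?expr0// ltW ?Q_lt1.
pose G (i : 'I_n) (m : nat) := y i ^+ m * gauss q (a i) m.
have xp : 0 < qpoch x Q n by rewrite qpoch_gt0 ?x_ge0.
rewrite (_ : zpow_norm2 a = qpoch x Q n * hnorm q a * \prod_i (qpoch (y i) Q (a i).+1)^-1).
  rewrite -(@esum_mindex_prod _ _ _ G).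
  - apply: eq_esum => p _; congr (_%:E); rewrite /zpow_mass wt2E.
    have -> : \prod_i G i (p i) = \prod_i y i ^+ p i * \prod_i gauss q (a i) (p i).
      by rewrite -big_split.
    have -> : \prod_i gauss q (a i) (p i) = hnorm q (madd a p) / (hnorm q a * hnorm q p).
      rewrite /gauss prodf_div big_split /=; congr (_ / _).
      by apply: eq_bigr => i _; rewrite ffunE.
    have -> : \prod_i y i ^+ p i = x ^+ deg p * Q ^+ height p * (q ^+ cross a p) ^+ 2.
      rewrite (exprAC _ (cross a p) 2) /deg /height /cross -!prodrXr -!big_split.
      apply: eq_bigr => i _ /=; rewrite /y exprMn exprD exprMn mulrA.
      by rewrite -!(exprM Q) [(p i * low _ _)%N]mulnC.
    have h1 := hnorm_neq0 q01 a; have h2 := hnorm_neq0 q01 p.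
    by field; rewrite h1 h2.
  - by rewrite mulr_ge0 ?ltW// hnorm_gt0.
  - move=> i m; rewrite mulr_ge0 ?gauss_ge0// exprn_ge0//.
    by case/andP: (y01 i).
  - by move=> i; apply: q_binomial_cvg.
have E : \prod_i qpoch (y i) Q (a i).+1 = qpoch x Q (n + deg a).
  rewrite -lown -(qpoch_low x a (leqnn n)); apply: eq_bigl => i.
  by rewrite ltn_ord.
rewrite /zpow_norm2 prodfV E qpochD.
have h2 : qpoch (x * Q ^+ n) Q (deg a) != 0.
  have := zpow_norm2_gt0 a; rewrite /zpow_norm2 => /lt0r_neq0.
  by rewrite mulf_eq0 invr_eq0 negb_or => /andP[].
by field; rewrite h2 gt_eqF.
Qed.

End Weights.

(** * Linearity of absolutely convergent sums *)

Section AbsoluteSums.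
Variables (R : realType) (T : choiceType).
Implicit Types (f g u v : T -> R) (F G : T -> R[i]).

Definition real_esum u : \bar R := (\esum_(x in [set: T]) (u x)%:E)%E.
Definition rsummable f := (real_esum (fun x => `|f x|%R) < +oo)%E.
Definition csummable F :=
  rsummable (fun x => complex.Re (F x)) /\ rsummable (fun x => complex.Im (F x)).

Lemma real_esum_ge0 u : (forall x, 0 <= u x) -> (0 <= real_esum u)%E.
Proof. by move=> u0; apply: esum_ge0 => x _; rewrite lee_fin. Qed.

Lemma le_real_esum u v : (forall x, 0 <= u x <= v x) -> (real_esum u <= real_esum v)%E.
Proof. by move=> uv; apply: le_esum => x _; rewrite lee_fin; case/andP: (uv x). Qed.

Lemma real_esumD u v : (forall x, 0 <= u x) -> (forall x, 0 <= v x) ->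
  real_esum (fun x => u x + v x) = (real_esum u + real_esum v)%E.
Proof.
by move=> u0 v0; rewrite /real_esum -esumD// => x _; rewrite lee_fin.
Qed.

(** One inequality holds for every positive factor; applied to the inverse factor
it gives the other one. *)
Lemma real_esumZ (c : R) u : 0 <= c -> (forall x, 0 <= u x) ->
  real_esum (fun x => c * u x) = (c%:E * real_esum u)%E.
Proof.
have le (d : R) (w : T -> R) : 0 < d -> (forall x, 0 <= w x) ->
    (real_esum (fun x => d * w x)%R <= d%:E * real_esum w)%E.
  move=> d0 w0; apply: ub_ereal_sup => _ [A [finA _] <-].
  have -> : (\sum_(x \in A) (d * w x)%R%:E = d%:E * \sum_(x \in A) (w x)%:E)%E.
    rewrite !fsbig_finite//= !sumEFin -EFinM mulr_sumr//.
  rewrite lee_pmul2l//; apply: ereal_sup_ubound; exists A => //.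
move=> c0 u0; move: c0; rewrite le_eqVlt => /predU1P[<-|c0].
  rewrite mul0e /real_esum esum1// => x _; by rewrite mul0r.
apply/eqP; rewrite eq_le le//=.
have := le c^-1 (fun x => c * u x); rewrite invr_gt0 => /(_ c0).
have -> : (fun x => c^-1 * (c * u x)) = u.
  by apply/funext => x; rewrite mulKf ?gt_eqF.
move=> H; rewrite -lee_pdivlMl//; apply: H => x.
by rewrite mulr_ge0// ltW.
Qed.

Lemma rsummable_fin (A : set T) f : finite_set A ->
  (forall x, f x != 0 -> A x) -> rsummable f.
Proof.
move=> finA fA; rewrite /rsummable /real_esum.
have -> : (\esum_(x in [set: T]) (`|f x|%R)%:E = \esum_(x in A) (`|f x|%R)%:E)%E.
  rewrite [RHS]esum_mkcond; apply: eq_esum => x _; case: ifPn => //.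
  by rewrite notin_setE => xA; have [->|/fA//] := eqVneq (f x) 0; rewrite normr0.
by rewrite esum_fset// fsumEFin// ltry.
Qed.

Let pos f x : R := Num.max (f x) 0.
Let neg f x : R := Num.max (- f x) 0.

Let pos_ge0 f x : 0 <= pos f x. Proof. by rewrite /pos le_max lexx orbT. Qed.
Let neg_ge0 f x : 0 <= neg f x. Proof. by rewrite /neg le_max lexx orbT. Qed.

Let pos_fin f : rsummable f -> real_esum (pos f) \is a fin_num.
Proof.
move=> fs; rewrite ge0_fin_numE; last exact: real_esum_ge0.
apply: le_lt_trans fs; apply: le_real_esum => x; rewrite pos_ge0/= /pos.
by rewrite ge_max ler_norm normr_ge0.
Qed.

Let neg_fin f : rsummable f -> real_esum (neg f) \is a fin_num.
Proof.
move=> fs; rewrite ge0_fin_numE; last exact: real_esum_ge0.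
apply: le_lt_trans fs; apply: le_real_esum => x; rewrite neg_ge0/= /neg.
by rewrite ge_max -normrN ler_norm normr_ge0.
Qed.

Lemma rsummableD f g : rsummable f -> rsummable g -> rsummable (fun x => f x + g x).
Proof.
move=> fs gs; apply: le_lt_trans (_ : (_ <= real_esum (fun x => (`|f x| + `|g x|)%R))%E) _.
  by apply: le_real_esum => x; rewrite normr_ge0 ler_normD.
by rewrite real_esumD// lte_add_pinfty.
Qed.

Let maxE (a : R) : Num.max a 0 = a + Num.max (- a) 0.
Proof.
have [a0|a0] := leP 0 a; first by rewrite max_r ?oppr_le0// addr0.
by rewrite max_l ?oppr_ge0 ?ltW// subrr.
Qed.

(** The positive part of f + g plus the negative parts of f and g equals the
negative part of f + g plus the positive parts of f and g; all these sums are
finite. *)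
Lemma rsumD f g : rsummable f -> rsummable g ->
  rsum (fun x => f x + g x) = rsum f + rsum g.
Proof.
move=> fs gs; have fgs := rsummableD fs gs.
pose h x := f x + g x.
have E : (real_esum (pos h) + real_esum (neg f) + real_esum (neg g) =
    real_esum (neg h) + real_esum (pos f) + real_esum (pos g))%E.
  rewrite -!real_esumD//; try by move=> x; rewrite addr_ge0.
  apply: eq_esum => x _; congr (_%:E); rewrite /pos /neg /h.
  rewrite (maxE (f x + g x)) (maxE (f x)) (maxE (g x)); ring.
rewrite /rsum -!/(real_esum _).
have p1 := pos_fin fs; have p2 := pos_fin gs; have p3 := pos_fin fgs.
have n1 := neg_fin fs; have n2 := neg_fin gs; have n3 := neg_fin fgs.
have := congr1 fine E.
rewrite !fineD ?fin_numD ?p1 ?p2 ?p3 ?n1 ?n2 ?n3//.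
rewrite /pos /neg /h; lra.
Qed.

Lemma rsum_scale (r : R) u (S : R) : (forall x, 0 <= u x) -> real_esum u = S%:E ->
  rsummable (fun x => r * u x) /\ rsum (fun x => r * u x) = r * S.
Proof.
move=> u0 uS; split.
  rewrite /rsummable (_ : (fun x => `|r * u x|) = fun x => `|r| * u x).
    by rewrite real_esumZ// uS -EFinM ltry.
  by apply/funext => x; rewrite normrM (ger0_norm (u0 x)).
rewrite /rsum -!/(real_esum _).
have [r0|r0] := leP 0 r.
  have -> : (fun x => Num.max (r * u x) 0) = fun x => r * u x.
    by apply/funext => x; rewrite max_l// mulr_ge0.
  have -> : (fun x => Num.max (- (r * u x)) 0) = fun x => 0 * u x.
    by apply/funext => x; rewrite mul0r max_r// oppr_le0 mulr_ge0.
  by rewrite !real_esumZ// uS mul0e /= subr0.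
have -> : (fun x => Num.max (r * u x) 0) = fun x => 0 * u x.
  by apply/funext => x; rewrite mul0r max_r// nmulr_rle0.
have -> : (fun x => Num.max (- (r * u x)) 0) = fun x => - r * u x.
  by apply/funext => x; rewrite mulNr max_l// oppr_ge0 nmulr_rle0.
rewrite !real_esumZ// ?oppr_ge0 1?ltW// uS mul0e /=; lra.
Qed.

Lemma csummableD F G : csummable F -> csummable G -> csummable (fun x => F x + G x).
Proof.
move=> [F1 F2] [G1 G2]; split; rewrite /rsummable.
  rewrite (_ : (fun x => `|complex.Re (F x + G x)|) =
    fun x => `|complex.Re (F x) + complex.Re (G x)|); first exact: rsummableD.
  by apply/funext => x; rewrite raddfD.
rewrite (_ : (fun x => `|complex.Im (F x + G x)|) =
  fun x => `|complex.Im (F x) + complex.Im (G x)|); first exact: rsummableD.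
by apply/funext => x; rewrite raddfD.
Qed.

Lemma csumD F G : csummable F -> csummable G ->
  csum (fun x => F x + G x) = csum F + csum G.
Proof.
move=> [F1 F2] [G1 G2]; rewrite /csum.
have -> : (fun x => complex.Re (F x + G x)) = fun x => complex.Re (F x) + complex.Re (G x).
  by apply/funext => x; rewrite raddfD.
have -> : (fun x => complex.Im (F x + G x)) = fun x => complex.Im (F x) + complex.Im (G x).
  by apply/funext => x; rewrite raddfD.
by rewrite !rsumD.
Qed.

Lemma csum_scale (a : R[i]) u (S : R) : (forall x, 0 <= u x) -> real_esum u = S%:E ->
  csummable (fun x => a * (u x)%:C) /\ csum (fun x => a * (u x)%:C) = a * S%:C.
Proof.
move=> u0 uS; case: a => a b.
have e1 : (fun x => complex.Re ((a +i* b) * (u x)%:C)) = fun x => a * u x.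
  by apply/funext => x /=; rewrite mulr0 subr0.
have e2 : (fun x => complex.Im ((a +i* b) * (u x)%:C)) = fun x => b * u x.
  by apply/funext => x /=; rewrite mulr0 add0r.
have [s1 r1] := rsum_scale a u0 uS; have [s2 r2] := rsum_scale b u0 uS.
split; first by rewrite /csummable e1 e2.
rewrite /csum e1 e2 r1 r2; apply/eqP; rewrite eq_complex /=; apply/andP; split; apply/eqP; ring.
Qed.

Lemma csummable_fin (A : set T) F : finite_set A -> (forall x, F x != 0 -> A x) -> csummable F.
Proof.
move=> finA FA; split; apply: (rsummable_fin finA) => x xF; apply: FA.
  by apply: contra_neq xF => ->.
by apply: contra_neq xF => ->.
Qed.

(** The families that occur in scalar products of holomorphic elements are finite
combinations of nonnegative families with known sums. *)
Lemma csum_sum (I : Type) (s : seq I) (a : I -> R[i]) (u : I -> T -> R) (S : I -> R) :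
  (forall i x, 0 <= u i x) -> (forall i, real_esum (u i) = (S i)%:E) ->
  csummable (fun x => \sum_(i <- s) a i * (u i x)%:C) /\
  csum (fun x => \sum_(i <- s) a i * (u i x)%:C) = \sum_(i <- s) a i * (S i)%:C.
Proof.
move=> u0 uS; elim: s => [|i s [IH1 IH2]].
  under [fun x => _]funext do rewrite big_nil.
  split; first by apply: (@csummable_fin set0) => // x; rewrite eqxx.
  by rewrite (@csum_fin _ _ set0) ?fsbig_set0 ?big_nil// => x; rewrite eqxx.
under [fun x => _]funext do rewrite big_cons.
have [s1 c1] := csum_scale (a i) (u0 i) (uS i).
by split; [exact: csummableD|rewrite csumD// c1 IH2 big_cons].
Qed.

End AbsoluteSums.

(** * The closure of the holomorphic polynomials *)

Section HolomorphicShape.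
Variables (R : realType) (n : nat) (q : R).
Hypothesis q01 : 0 < q < 1.
Local Notation Q := (q ^+ 2).
Implicit Types (f g h u : infmx R n) (k l m p a b : mindex n).

Definition below p l := [forall i : 'I_n, (p i <= l i)%N].

Lemma madd_msub p l : below p l -> madd (msub l p) p = l.
Proof. by move=> /forallP pl; apply/ffunP => i; rewrite !ffunE subnK. Qed.

Lemma below_madd k p : below p (madd k p).
Proof. by apply/forallP => i; rewrite ffunE leq_addl. Qed.

Lemma msub_madd k p : msub (madd k p) p = k.
Proof. by apply/ffunP => i; rewrite !ffunE addnK. Qed.

Lemma eq_madd k l p : (l == madd k p) = below p l && (k == msub l p).
Proof.
apply/eqP/andP => [->|[pl /eqP ->]]; last by rewrite madd_msub.
by rewrite below_madd msub_madd.
Qed.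

Lemma zpow_entry k l p : zpow q k l p = if l == madd k p then (q ^+ cross k p)%:C else 0.
Proof. by rewrite zpowE /monop crossE. Qed.

(** The matrices whose first column determines the others as for an infinite
combination of monomials z^k. *)
Definition hol_shape h := forall l p,
  h l p = if below p l then h (msub l p) (mzero n) * (q ^+ cross (msub l p) p)%:C else 0.

Lemma hol_shapeP h : hol q h -> hol_shape h.
Proof.
move=> /hol_coord[s _ ->].
elim/big_ind: _ => [l p|f g fs gs l p|k _ l p].
- by case: ifP => //; rewrite mul0r.
- by rewrite !infmxDE fs gs; case: ifP => _; rewrite ?mulrDl ?addr0.
rewrite !infmxZE zpow_mzero zpow_entry eq_madd eq_sym.
case: (below p l) => /=; last by rewrite mulr0.
case: eqP => [->|_]; first by rewrite mulr1.
by rewrite !mulr0 mul0r.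
Qed.

Definition nsq (z : R[i]) : R := complex.Re z ^+ 2 + complex.Im z ^+ 2.

Lemma nsq_ge0 z : 0 <= nsq z. Proof. by rewrite addr_ge0 ?sqr_ge0. Qed.

Lemma nsq_eq0 z : nsq z = 0 -> z = 0.
Proof.
case: z => a b /eqP; rewrite /nsq /= paddr_eq0 ?sqr_ge0// !sqrf_eq0.
by move=> /andP[/eqP -> /eqP ->].
Qed.

Lemma nsq_lin (z w : R[i]) (c : R) :
  nsq (z - w * c%:C) <= 2 * nsq z + 2 * c ^+ 2 * nsq w.
Proof.
case: z w => [a b] [d e]; rewrite /nsq /= !mulr0 !(addr0, subr0).
have := sqr_ge0 (a + d * c); have := sqr_ge0 (b + e * c); nra.
Qed.

Variable al : R.
Hypothesis al_gt0 : 0 < al.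

Lemma nsq_lt f (e : R) l p : (sqnorm q al f < e%:E)%E -> nsq (f l p) < e / wt2 q al (l, p).
Proof.
move=> fe; rewrite ltr_pdivlMr ?wt2_gt0// -lte_fin; apply: le_lt_trans fe.
apply: esum_ge; exists [set (l, p)]; first by split.
by rewrite fsbig_set1.
Qed.

(** The shape is given by linear relations between two entries. Each entry is
bounded by the norm, so the relations survive the closure. *)
Lemma hol_closure_shape h : hol_closure q al h -> hol_shape h.
Proof.
move=> [_ happ] l p.
(* With c = 0 this also covers the entries that must vanish. *)
have key (c : R) k m : (forall g, hol q g -> g l p = g k m * c%:C) -> h l p = h k m * c%:C.
  move=> gE; apply/eqP; rewrite -subr_eq0; apply/eqP/nsq_eq0/eqP; apply: contraT => d0.
  set d := nsq _ in d0; have {}d0 : 0 < d by rewrite lt_def d0 nsq_ge0.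
  (* Approximation of h within d / M makes the defect smaller than d itself. *)
  pose M := 2 / wt2 q al (l, p) + 2 * c ^+ 2 / wt2 q al (k, m).
  have w1 := wt2_gt0 q01 al_gt0 l p; have w2 := wt2_gt0 q01 al_gt0 k m.
  have M0 : 0 < M.
    apply: ltr_wpDr; last exact: divr_gt0.
    exact: divr_ge0 (mulr_ge0 (ler0n _ 2) (sqr_ge0 c)) (ltW w2).
  have [|g gh] := happ (d / M); first exact: divr_gt0.
  move=> gd; have := nsq_lt l p gd; have := nsq_lt k m gd.
  rewrite !(infmxDE, infmxNE) => h2 h1.
  have : d <= 2 * nsq (h l p - g l p) + 2 * c ^+ 2 * nsq (h k m - g k m).
    apply: le_trans (nsq_lin _ _ _); rewrite /d (gE _ gh).
    by rewrite le_eqVlt; apply/orP; left; apply/eqP; congr nsq; ring.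
  rewrite leNgt => /negP[].
  have -> : d = 2 * (d / M / wt2 q al (l, p)) + 2 * c ^+ 2 * (d / M / wt2 q al (k, m)).
    rewrite -[LHS](divfK (lt0r_neq0 M0)) {2}/M; ring.
  apply: ltr_leD; first by rewrite ltr_pM2l.
  exact: ler_wpM2l (mulr_ge0 (ler0n _ 2) (sqr_ge0 c)) _ _ (ltW h2).
case: ifP => pl.
  by apply: key => g /hol_shapeP ->; rewrite pl.
have := key 0 l p; rewrite mulr0; apply => g /hol_shapeP ->.
by rewrite pl mulr0.
Qed.

End HolomorphicShape.

(** * Matrix entries of the orthogonal projection *)

Section ToeplitzProjection.
Variables (R : realType) (n : nat) (q al : R).
Hypothesis q01 : 0 < q < 1.
Hypothesis al_gt0 : 0 < al.
Local Notation Q := (q ^+ 2).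
Local Notation zpow_norm2 := (@zpow_norm2 R n q al).
Implicit Types (f g h u : infmx R n) (k l m p a b : mindex n) (lp : mindex n * mindex n).

(** The integrand of the squared norm of z^k, as a family over all pairs of
indices. *)
Definition zpow_density k lp : R := if lp.1 == madd k lp.2 then zpow_mass q al k lp.2 else 0.

Lemma zpow_density_ge0 k lp : 0 <= zpow_density k lp.
Proof. by rewrite /zpow_density; case: ifP => // _; exact: zpow_mass_ge0. Qed.

Lemma esum_zpow_density k : real_esum (zpow_density k) = (zpow_norm2 k)%:E.
Proof.
rewrite -esum_zpow_mass// /real_esum.
have bij : set_bij [set: mindex n] [set lp | lp.1 = madd k lp.2] (fun p => (madd k p, p)).
  split=> [p _ //|p p' _ _ []//|[l p] /= ->]; by exists p.
have := @reindex_esum R _ _ _ _ _ (fun lp => (zpow_mass q al k lp.2)%:E) bij => /= <-.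
rewrite [RHS]esum_mkcond; apply: eq_esum => lp _; rewrite /zpow_density.
by case: eqP => E; [rewrite mem_set|rewrite memNset].
Qed.

Lemma conjcM_real (z : R[i]) (r : R) : conjc (z * r%:C) = conjc z * r%:C.
Proof.
case: z => x y; apply/eqP; rewrite eq_complex /=.
by apply/andP; split; apply/eqP; ring.
Qed.

(** The scalar product of u with z^k, for finite u. *)
Definition zpow_scal u k : R[i] :=
  \sum_(lp \in setT) conjc (zpow q k lp.1 lp.2) * u lp.1 lp.2 * (wt2 q al lp)%:C.

(** At (l, p) both g and h are determined by their coefficients at z^(l-p). So
the summand is a finitely supported family minus a combination of the densities of
the monomials, and these have known sums. *)
Lemma scal_shape u g h (s : seq (mindex n)) : finop u -> hol_shape q g ->
  hol_shape q h -> uniq s ->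
  (forall k, k \notin s -> g k (mzero n) * conjc (h k (mzero n)) = 0) ->
  scal q al (u - g) h =
  \sum_(lp \in setT) conjc (h lp.1 lp.2) * u lp.1 lp.2 * (wt2 q al lp)%:C -
  \sum_(k <- s) g k (mzero n) * conjc (h k (mzero n)) * (zpow_norm2 k)%:C.
Proof.
move=> finu gS hS us out; rewrite /scal.
pose a k := - (g k (mzero n) * conjc (h k (mzero n))).
pose Fu lp := conjc (h lp.1 lp.2) * u lp.1 lp.2 * (wt2 q al lp)%:C.
have suppF lp : Fu lp != 0 -> [set km | u km.1 km.2 != 0] lp.
  by rewrite /Fu /=; apply: contra_neq => ->; rewrite mulr0 mul0r.
have E lp : conjc (h lp.1 lp.2) * (u - g) lp.1 lp.2 * (wt2 q al lp)%:C =
    Fu lp + \sum_(k <- s) a k * (zpow_density k lp)%:C.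
  case: lp => l p; rewrite infmxDE infmxNE mulrBr mulrBl; congr (_ + _).
  rewrite /zpow_density /=; under eq_bigr do rewrite eq_madd.
  rewrite hS gS; case: (below p l) (@madd_msub _ p l) => [/(_ isT) pl|_] /=; last first.
    by rewrite mulr0 mul0r oppr0 big1// => k _; rewrite mulr0.
  set k0 := msub l p in pl *.
  have -> : - (conjc (h k0 (mzero n) * (q ^+ cross k0 p)%:C) *
      (g k0 (mzero n) * (q ^+ cross k0 p)%:C) * (wt2 q al (l, p))%:C) =
      a k0 * (zpow_mass q al k0 p)%:C.
    rewrite /zpow_mass pl /a conjcM_real; move: (wt2 _ _ _) => w.
    by rewrite rmorphM !rmorphXn /=; ring.
  have [ks|ks] := boolP (k0 \in s).
    rewrite (bigD1_seq k0)//= eqxx big1 ?addr0// => k /negPf ->.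
    by rewrite mulr0.
  rewrite /a out// oppr0 mul0r big_seq big1// => k kin.
  case: eqP => [kk0|_]; last by rewrite mulr0.
  by rewrite kk0 (negPf ks) in kin.
rewrite (_ : (fun lp => _) =
  fun lp => Fu lp + \sum_(k <- s) a k * (zpow_density k lp)%:C); last first.
  by apply/funext => lp; rewrite E.
have [cs cE] := csum_sum s a zpow_density_ge0 esum_zpow_density.
rewrite csumD//; last exact: csummable_fin finu suppF.
rewrite cE (csum_fin finu suppF); congr (_ + _).
  apply: fsbig_widen => // lp [_ /= /negP].
  by rewrite negbK => /eqP E0; rewrite /Fu E0 mulr0 mul0r.
by rewrite -sumrN; apply: eq_bigr => k _; rewrite /a mulNr.
Qed.

Lemma zpow_shape k : hol_shape q (zpow q k).
Proof.
move=> l p; rewrite zpow_entry zpow_mzero eq_madd; case: (below p l) => //=.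
rewrite eq_sym; case: eqP => [->|_]; first by rewrite mul1r.
by rewrite mul0r.
Qed.

Lemma hol_zpow k : hol q (zpow q k).
Proof.
rewrite /zpow; elim/big_ind: _ => [|f g fs gs|i _]; [exact: hol_id|exact: hol_mul|].
elim: (k i) => [|m IH] /=; first exact: hol_id.
by apply: hol_mul => //; exact: hol_Z.
Qed.

Lemma hol0 : hol q (0 : infmx R n).
Proof. by rewrite -(scale0r (@opid R n)); apply/hol_scale/hol_id. Qed.

Definition hcomb (s : seq (mindex n)) (c : mindex n -> R[i]) : infmx R n :=
  \sum_(k <- s) c k *: zpow q k.

Lemma hol_hcomb s c : hol q (hcomb s c).
Proof.
rewrite /hcomb; elim/big_ind: _ => [|f g|k _]; [exact: hol0|exact: hol_add|].
exact/hol_scale/hol_zpow.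
Qed.

Lemma hcomb_coef s c k : uniq s ->
  hcomb s c k (mzero n) = if k \in s then c k else 0.
Proof.
move=> us; rewrite /hcomb infmx_sumE.
under eq_bigr do rewrite infmxZE zpow_mzero.
case: (boolP (k \in s)) => ks.
  rewrite (bigD1_seq k)//= eqxx mulr1 big1 ?addr0// => j /negPf jk.
  by rewrite eq_sym jk mulr0.
rewrite big_seq big1// => j js; case: eqP => [kj|_]; last by rewrite mulr0.
by rewrite kj js in ks.
Qed.

Lemma nsq0 : nsq (0 : R[i]) = 0.
Proof. by rewrite /nsq /= !expr0n /= addr0. Qed.

Lemma sqnorm0 : sqnorm q al (0 : infmx R n) = 0%E.
Proof. by rewrite /sqnorm esum1// => lp _; rewrite -/(nsq _) nsq0 mul0r. Qed.

(** The squares of the entries are a finite combination of the densities of the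
monomials. *)
Lemma hcomb_closure s c : uniq s -> hol_closure q al (hcomb s c).
Proof.
move=> us; split; last first.
  move=> e e0; exists (hcomb s c); first exact: hol_hcomb.
  by rewrite subrr sqnorm0 lte_fin.
rewrite /L2 /= /sqnorm.
rewrite (_ : (\esum_(lp in setT) _)%E =
  real_esum (fun lp => \sum_(k <- s) nsq (c k) * zpow_density k lp)).
  elim: s {us} => [|k s IH].
    by rewrite /real_esum esum1 ?ltry// => lp _; rewrite big_nil.
  rewrite (_ : (fun lp => _) = fun lp => nsq (c k) * zpow_density k lp +
      \sum_(k <- s) nsq (c k) * zpow_density k lp); last first.
    by apply/funext => lp; rewrite big_cons.
  rewrite real_esumD ?real_esumZ ?esum_zpow_density ?nsq_ge0//; last 3 first.
  - exact: zpow_density_ge0.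
  - by move=> lp; rewrite mulr_ge0 ?nsq_ge0 ?zpow_density_ge0.
  - by move=> lp; apply: sumr_ge0 => j _; rewrite mulr_ge0 ?nsq_ge0 ?zpow_density_ge0.
  by rewrite lte_add_pinfty// -EFinM ltry.
apply: eq_esum => -[l p] _; congr (_%:E); rewrite -/(nsq _).
rewrite (hol_shapeP (hol_hcomb s c)) /zpow_density /=.
under eq_bigr do rewrite eq_madd.
case: (below p l) (@madd_msub _ p l) => [/(_ isT) pl|_] /=; last first.
  by rewrite nsq0 mul0r big1// => k _; rewrite mulr0.
set k0 := msub l p in pl *; rewrite hcomb_coef//.
have nsqM (z : R[i]) (r : R) : nsq (z * r%:C) = nsq z * r ^+ 2.
  by case: z => x y; rewrite /nsq /=; ring.
have [ks|ks] := boolP (k0 \in s).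
  rewrite (bigD1_seq k0)//= eqxx big1 ?addr0; last by move=> k /negPf ->; rewrite mulr0.
  by rewrite nsqM /zpow_mass pl mulrA.
rewrite mul0r nsq0 mul0r big_seq big1// => k kin.
case: eqP => [kk0|_]; last by rewrite mulr0.
by rewrite kk0 (negPf ks) in kin.
Qed.

Lemma zpow_closure k : hol_closure q al (zpow q k).
Proof.
have := @hcomb_closure [:: k] (fun=> 1) isT.
by rewrite /hcomb big_seq1 scale1r.
Qed.

(** On the finite support of u, the matrix h agrees with the combination of
the monomials z^k with k in s. *)
Lemma sum_shape_zpow_scal u h (s : seq (mindex n)) : finop u -> hol_shape q h -> uniq s ->
  (forall l p, u l p != 0 -> msub l p \in s) ->
  \sum_(lp \in setT) conjc (h lp.1 lp.2) * u lp.1 lp.2 * (wt2 q al lp)%:C =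
  \sum_(k <- s) conjc (h k (mzero n)) * zpow_scal u k.
Proof.
move=> finu hS us su.
pose A := [set km : mindex n * mindex n | u km.1 km.2 != 0].
have W (F : mindex n * mindex n -> R[i]) :
    \sum_(lp \in setT) F lp * u lp.1 lp.2 * (wt2 q al lp)%:C =
    \sum_(lp <- fset_set A) F lp * u lp.1 lp.2 * (wt2 q al lp)%:C.
  rewrite -(@fsbig_widen _ _ _ _ A)//=; last first.
    by move=> lp [_ /= /negP]; rewrite negbK => /eqP ->; rewrite mulr0 mul0r.
  by rewrite fsbig_finite.
rewrite (W (fun lp => conjc (h lp.1 lp.2))).
under [RHS]eq_bigr => k _ do
  rewrite /zpow_scal (W (fun lp => conjc (zpow q k lp.1 lp.2))) mulr_sumr.
rewrite exchange_big; apply: eq_big_seq => -[l p] /=.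
rewrite in_fset_set// => /set_mem /= ulp.
under eq_bigr do rewrite !mulrA.
rewrite -!mulr_suml; congr (_ * _ * _).
rewrite hS; under eq_bigr do rewrite zpow_shape -rmorphM /=.
case: (below p l); last by rewrite conjc0 big1// => k _; rewrite mulr0 conjc0.
rewrite (bigD1_seq (msub l p))/= ?su// zpow_mzero eqxx mul1r big1 ?addr0// => k kl.
by rewrite zpow_mzero eq_sym (negPf kl) mul0r mulr0 conjc0.
Qed.

(** A projection of u is orthogonally tested against z^k, which gives its k-th
coefficient since all elements of the closure have the holomorphic shape. The
finite combination with these coefficients is a projection, so the choice operator
of the definition does not fall back to its default. *)
Lemma proj_coef u k : finop u ->
  Defs.proj q al u k (mzero n) = zpow_scal u k / (zpow_norm2 k)%:C.
Proof.
move=> finu; have zn j : (zpow_norm2 j)%:C != 0.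
  by rewrite fmorph_eq0 gt_eqF// zpow_norm2_gt0.
rewrite /Defs.proj; case: xgetP => [g _ [gc gperp]|none].
  have := gperp _ (zpow_closure k).
  rewrite (@scal_shape u g _ [:: k])//; last 3 first.
  - exact: hol_closure_shape gc.
  - exact: zpow_shape.
  - by move=> j; rewrite inE zpow_mzero => /negPf ->; rewrite conjc0 mulr0.
  rewrite big_seq1 zpow_mzero eqxx conjc1 mulr1 -/(zpow_scal u k) => /eqP.
  by rewrite subr_eq0 => /eqP ->; rewrite mulfK.
pose s := undup [seq msub lp.1 lp.2 | lp <- fset_set [set km | u km.1 km.2 != 0]].
pose c k := zpow_scal u k / (zpow_norm2 k)%:C.
exfalso; apply: (none (hcomb s c)); split; first exact/hcomb_closure/undup_uniq.
have us : uniq s by exact: undup_uniq.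
have gS : hol_shape q (hcomb s c) by exact/hol_shapeP/hol_hcomb.
have su l p : u l p != 0 -> msub l p \in s.
  move=> ulp; rewrite mem_undup; apply/mapP; exists (l, p) => //.
  by rewrite in_fset_set// mem_set.
move=> h /(hol_closure_shape q01 al_gt0) hS.
rewrite (@scal_shape _ _ _ s)//; last first.
  by move=> j js; rewrite hcomb_coef// (negPf js) mul0r.
rewrite (sum_shape_zpow_scal finu hS us su); apply/eqP; rewrite subr_eq0; apply/eqP.
apply: eq_big_seq => j js; rewrite hcomb_coef// js /c.
by rewrite [_ * conjc _]mulrC -mulrA divfK.
Qed.

End ToeplitzProjection.

(** * Finite matrices *)

Section FiniteMatrices.
Variables (R : realType) (n : nat).
Implicit Types (f g : infmx R n) (k l m p a b : mindex n).

(** Finite support means a common bound on the degrees of rows and columns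
([finopP]). In this form it is easy to follow through the operators. *)
Definition fbounded K f := forall k l, (K <= deg k)%N || (K <= deg l)%N -> f k l = 0.

Lemma finopP f : finop f <-> exists K, fbounded K f.
Proof.
split=> [finf|[K Kf]]; last first.
  pose A := [set k : mindex n | (deg k < K)%N].
  apply: (@sub_finite_set _ _ (A `*` A)); last first.
    by apply: finite_setX; exact: finite_degree_lt.
  move=> [k l] /= /eqP fkl; split; rewrite /A /= ltnNge; apply/negP => Kk.
    by apply: fkl; rewrite Kf ?Kk.
  by apply: fkl; rewrite Kf ?Kk ?orbT.
pose S := fset_set [set km : mindex n * mindex n | f km.1 km.2 != 0].
exists (\sum_(kl <- S) (deg kl.1 + deg kl.2)).+1 => k l; apply: contraTeq => fkl.
have klS : (k, l) \in S by rewrite in_fset_set// mem_set.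
rewrite negb_or -!ltnNge !ltnS (bigD1_seq (k, l))//= ?fset_uniq//.
rewrite -addnA leq_addr andTb (leq_trans _ (leq_addl _ _))//; exact: leq_addr.
Qed.

Lemma fbounded_leq K K' f : (K <= K')%N -> fbounded K f -> fbounded K' f.
Proof.
move=> KK Kf k l /orP[] H; apply: Kf; first by rewrite (leq_trans KK).
by rewrite (leq_trans KK H) orbT.
Qed.

Lemma fboundedD K f g : fbounded K f -> fbounded K g -> fbounded K (f + g).
Proof. by move=> Kf Kg k l kl; rewrite infmxDE Kf ?Kg ?addr0. Qed.

Lemma fboundedZ K (c : R[i]) f : fbounded K f -> fbounded K (c *: f).
Proof. by move=> Kf k l kl; rewrite infmxZE Kf ?mulr0. Qed.

Lemma fbounded_lower (q : R[i]) K f : fbounded K f -> fbounded K (lower q f).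
Proof.
move=> Kf k l kl; rewrite /lower big1// => i _; rewrite Kf ?mulr0//.
by rewrite !deg_madd; case/orP: kl => H; rewrite (leq_trans H (leq_addl _ _)) ?orbT.
Qed.

Lemma fbounded_raise (q : R[i]) K f : fbounded K f -> fbounded K.+1 (raise q f).
Proof.
move=> Kf k l kl; rewrite /raise big1// => i _; case: ifPn => // /andP[ki li].
rewrite Kf ?mulr0//; move: kl; rewrite -{1}(madd_munitK ki) -{1}(madd_munitK li).
by rewrite !deg_madd !deg_munit.
Qed.

Lemma fbounded_deg_scale (a b : R[i]) K f : fbounded K f -> fbounded K (deg_scale a b f).
Proof. by move=> Kf k l kl; rewrite /deg_scale Kf ?mulr0. Qed.

Lemma fbounded_bounded K f : fbounded K f -> bounded K f.
Proof. by move=> Kf k l Kk; rewrite Kf// Kk. Qed.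

Lemma fbounded_iter_lower (q : R[i]) K f N : fbounded K f -> fbounded K (iter N (lower q) f).
Proof. by move=> Kf; elim: N => //= N; exact: fbounded_lower. Qed.

Lemma fbounded_qexp_lower (q : R[i]) K M t f : fbounded K f -> fbounded K (qexp_lower q M t f).
Proof.
move=> Kf k l kl; rewrite /qexp_lower infmx_sumE big1// => N _.
by rewrite infmxZE (fbounded_iter_lower _ _ Kf)// mulr0.
Qed.

Lemma finop_shift_op (q : R[i]) f : finop f -> finop (shift_op q f).
Proof.
move=> /finopP[K Kf]; apply/finopP; exists K.+1.
have Kf' := fbounded_leq (leqnSn K) Kf.
rewrite /shift_op; apply: fboundedD; last first.
  exact/fboundedZ/fboundedD/fbounded_deg_scale/Kf'/fbounded_deg_scale.
by apply: fboundedD; [exact: fbounded_lower|exact: fbounded_raise].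
Qed.

Lemma finopD f g : finop f -> finop g -> finop (f + g).
Proof.
move=> /finopP[K Kf] /finopP[L Lg]; apply/finopP; exists (maxn K L); apply: fboundedD.
  exact: fbounded_leq (leq_maxl _ _) Kf.
exact: fbounded_leq (leq_maxr _ _) Lg.
Qed.

Lemma finopZ (c : R[i]) f : finop f -> finop (c *: f).
Proof. by move=> /finopP[K Kf]; apply/finopP; exists K; exact: fboundedZ. Qed.

Lemma fsum_exchange (T : choiceType) (I : Type) (s : seq I) (A : set T) (F : I -> T -> R[i]) :
  finite_set A -> (forall i x, F i x != 0 -> A x) ->
  \sum_(x \in setT) \sum_(i <- s) F i x = \sum_(i <- s) \sum_(x \in setT) F i x.
Proof.
move=> finA FA.
have W (G : T -> R[i]) : (forall x, G x != 0 -> A x) ->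
    \sum_(x \in setT) G x = \sum_(x <- fset_set A) G x.
  move=> GA; rewrite -(@fsbig_widen _ _ _ _ A) ?fsbig_finite//= => x [_ xA].
  by apply/eqP; apply: contra_notT xA; exact: GA.
rewrite W => [|x]; last first.
  move=> Fx; apply: contrapT => xA; move/eqP: Fx; apply; rewrite big1// => i _.
  by apply/eqP; apply: contra_notT xA; exact: FA.
by rewrite exchange_big; apply: eq_bigr => i _; rewrite W//; exact: FA.
Qed.

End FiniteMatrices.

(** * The pairing given by the invariant integral *)

Section Pairing.
Variables (R : realType) (n : nat) (q : R).
Hypothesis q01 : 0 < q < 1.
Local Notation Q := (q ^+ 2).
Local Notation qc := (q%:C).
Implicit Types (f g h s : infmx R n) (k l m p a b : mindex n) (i : 'I_n).

Definition nu_weight k : R[i] := (weight q (q ^- (2 * n)) (tails k))%:C.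

(** The invariant integral of h g, up to the constant (Q; Q)_n ([int_nuE]). *)
Definition pairing h g : R[i] :=
  \sum_(kl \in [set: mindex n * mindex n]) h kl.1 kl.2 * g kl.2 kl.1 * nu_weight kl.1.

Definition square K : set (mindex n * mindex n) :=
  [set k : mindex n | (deg k < K)%N] `*` [set k : mindex n | (deg k < K)%N].

Lemma finite_square K : finite_set (square K).
Proof. by apply: finite_setX; exact: finite_degree_lt. Qed.

Lemma squareP K g (kl : mindex n * mindex n) (x y : R[i]) : fbounded K g ->
  x * g kl.2 kl.1 * y != 0 -> square K kl.
Proof.
case: kl => k l Kg /= H; split=> /=; rewrite ltnNge; apply: contraNN H => Kk.
  by rewrite Kg ?Kk ?orbT// mulr0 mul0r.
by rewrite Kg ?Kk// mulr0 mul0r.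
Qed.

Lemma sum_opmul_diag s g : finop g ->
  \sum_(m \in setT) opmul s g m m * nu_weight m = pairing s g.
Proof.
move=> /finopP[K Kg]; pose A := [set k : mindex n | (deg k < K)%N].
have finA : finite_set A by exact: finite_degree_lt.
rewrite /pairing -(@fsbig_widen _ _ _ _ (A `*` A))//=; last first.
  move=> kl [_ nkl]; apply/eqP; apply: contra_notT nkl; exact: squareP.
rewrite -(@fsbig_widen _ _ _ _ A)//=; last first.
  move=> m [_ /negP]; rewrite -leqNgt => Km; rewrite /= /opmul fsbig1 ?mul0r// => l _.
  by rewrite Kg ?mulr0// Km orbT.
transitivity (\sum_(m \in A) \sum_(l \in A) s m l * g l m * nu_weight m).
  apply: eq_fsbigr => m _; rewrite /opmul -(@fsbig_widen _ _ _ _ A)//=; last first.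
    by move=> l [_ /negP]; rewrite -leqNgt => Kl; rewrite /= Kg ?mulr0// Kl.
  by rewrite mulr_fsuml.
by rewrite pair_fsbig//.
Qed.

Lemma int_nuE s g : finop g ->
  int_nu q (opmul s g) = (qpoch Q Q n)%:C * pairing s g.
Proof.
move=> fing; rewrite /int_nu; congr (_ * _); rewrite -sum_opmul_diag//.
rewrite (reindex_fsbig (@tails n) setT)//; last exact: tails_bij.
by apply: eq_fsbigr => m _; rewrite /f00 tailsK.
Qed.

Lemma nu_weight_munit i k :
  nu_weight (madd (munit i) k) = (qc ^+ 2) ^- n * (qc ^+ 2) ^+ i * nu_weight k.
Proof.
rewrite /nu_weight !weightE deg_madd deg_munit height_madd height_munit.
have E : (qc ^+ 2) ^- n = (q ^- (2 * n))%:C by rewrite fmorphV rmorphXn /= exprM.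
rewrite E; move: (q ^- (2 * n)) => X.
rewrite (exprD X 1) (exprD Q i) expr1 !(rmorphM, rmorphXn) /=; ring.
Qed.

(** Reindexing (k, l) by (k + e_i, l + e_i) exchanges the two shifts, and the ratio
of the weights at k + e_i and k turns the coefficient of F into that of E. *)
Lemma pairing_raise h g : finop g -> pairing (raise qc h) g = pairing h (lower qc g).
Proof.
move=> /finopP[K Kg].
pose G i (kl : mindex n * mindex n) :=
  (if (0 < kl.1 i)%N && (0 < kl.2 i)%N
   then rcoef qc i kl.1 kl.2 * h (msub kl.1 (munit i)) (msub kl.2 (munit i))
   else 0) * g kl.2 kl.1 * nu_weight kl.1.
pose H i (kl : mindex n * mindex n) :=
  h kl.1 kl.2 * lcoef qc i kl.2 kl.1 *
    g (madd (munit i) kl.2) (madd (munit i) kl.1) * nu_weight kl.1.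
transitivity (\sum_i \sum_(kl \in [set: mindex n * mindex n]) G i kl).
  rewrite -(@fsum_exchange _ _ _ _ _ _ (finite_square K)); last first.
    by move=> i kl; exact: squareP.
  by apply: eq_fsbigr => kl _; rewrite -mulr_suml -mulr_suml.
transitivity (\sum_i \sum_(kl \in [set: mindex n * mindex n]) H i kl); last first.
  rewrite -(@fsum_exchange _ _ _ _ _ _ (finite_square K)); last first.
    move=> i [k l] /=; rewrite /H /= => nz.
    have : square K (madd (munit i) k, madd (munit i) l).
      exact: (@squareP K g (_, _) _ _ Kg nz).
    rewrite /square /= !deg_madd !deg_munit => -[/ltnW /= H1 /ltnW /= H2].
    by split.
  apply: eq_fsbigr => -[k l] _ /=; rewrite /H /= /lower mulr_sumr mulr_suml.
  by apply: eq_bigr => i _; rewrite !mulrA.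
apply: eq_bigr => i _.
rewrite -(@fsbig_widen _ _ _ _ [set kl : mindex n * mindex n |
  (0 < kl.1 i)%N /\ (0 < kl.2 i)%N])//=; last first.
  move=> kl [_ /= /not_andP no]; rewrite /G; case: ifP => [/andP[]|_].
    by case: no.
  by rewrite !mul0r.
rewrite (reindex_fsbig (fun kl => (madd (munit i) kl.1, madd (munit i) kl.2)) setT); last first.
  split=> [[k l] _ /=|[k l] [k' l'] _ _ /= [E1 E2]|[k l] /= [ki li]].
  - by rewrite !ffunE eqxx.
  - by rewrite -(maddKl (munit i) k) -(maddKl (munit i) l) E1 E2 !maddKl.
  - by exists (msub k (munit i), msub l (munit i)) => //=; rewrite !madd_munitK.
apply: eq_fsbigr => -[k l] _; rewrite /G /H /= !ffunE eqxx /= !maddKl nu_weight_munit.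
rewrite /rcoef /lcoef !low_madd !low_munit ltnn !ffunE eqxx !add0n add1n.
have q0 : (qc ^+ 2) ^+ n != 0 by rewrite !expf_neq0// qc_neq0.
rewrite !(exprD qc) !(exprS (qc ^+ 2) n) !(exprS (qc ^+ 2) i).
by field; rewrite q0.
Qed.

End Pairing.

(** * Toeplitz matrices and the Berezin transform in closed form *)

Section BerezinFormula.
Variables (R : realType) (n : nat) (q : R).
Hypothesis q01 : 0 < q < 1.
Local Notation Q := (q ^+ 2).
Local Notation qc := (q%:C).
Local Notation Qc := (q%:C ^+ 2).
Implicit Types (f g h s : infmx R n) (k l p a b : mindex n).

Lemma pairing_raises N h g : finop g ->
  pairing q (raises qc N h) g = pairing q h (iter N (lower qc) g).
Proof.
elim: N g => [|N IH] g fing //; rewrite raisesS pairing_raise// IH ?iterSr//.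
by move/finopP: fing => [K Kg]; apply/finopP; exists K; exact: fbounded_lower.
Qed.

Lemma pairing_suml (I : Type) (r : seq I) (F : I -> infmx R n) (c : I -> R[i]) g : finop g ->
  pairing q (\sum_(i <- r) c i *: F i) g = \sum_(i <- r) c i * pairing q (F i) g.
Proof.
move=> /finopP[K Kg]; rewrite /pairing.
under [RHS]eq_bigr do rewrite mulr_fsumr.
rewrite -(@fsum_exchange _ _ _ _ _ _ (finite_square n K)).
  apply: eq_fsbigr => -[k l] _ /=; rewrite infmx_sumE !mulr_suml.
  by apply: eq_bigr => i _; rewrite infmxZE !mulrA.
move=> i [k l] /= nz; split=> /=; rewrite ltnNge; apply: contraNN nz => H.
  by rewrite Kg ?H ?orbT// mulr0 mul0r mulr0.
by rewrite Kg ?H// mulr0 mul0r mulr0.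
Qed.

Lemma pairing_sumr K (I : Type) (r : seq I) (F : I -> infmx R n) (c : I -> R[i]) h :
  (forall i, fbounded K (F i)) ->
  pairing q h (\sum_(i <- r) c i *: F i) = \sum_(i <- r) c i * pairing q h (F i).
Proof.
move=> FK; rewrite /pairing.
under [RHS]eq_bigr do rewrite mulr_fsumr.
rewrite -(@fsum_exchange _ _ _ _ _ _ (finite_square n K)).
  apply: eq_fsbigr => -[k l] _ /=; rewrite infmx_sumE mulr_sumr mulr_suml.
  by apply: eq_bigr => i _; rewrite infmxZE; ring.
move=> i [k l] /= nz; split=> /=; rewrite ltnNge; apply: contraNN nz => H.
  by rewrite FK ?H ?orbT// mulr0 mul0r mulr0.
by rewrite FK ?H// mulr0 mul0r mulr0.
Qed.

(** Termwise from [pairing_raises]; only rows of degree below K meet the support of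
g. *)
Lemma pairing_qexp_raise K t h g : fbounded K g ->
  pairing q (qexp_raise qc t h) g = pairing q h (qexp_lower qc K t g).
Proof.
move=> Kg; have fing : finop g by apply/finopP; exists K.
transitivity (pairing q (qexp_raise_trunc qc K t h) g).
  apply: eq_fsbigr => -[k l] _ /=; have [Kk|kK] := leqP K (deg k).
    by rewrite Kg ?Kk ?orbT// !mulr0 !mul0r.
  by rewrite (qexp_raiseE _ _ _ _ kK).
rewrite /qexp_raise_trunc pairing_suml// /qexp_lower (@pairing_sumr K).
  by apply: eq_bigr => N _; rewrite pairing_raises.
by move=> N; exact: fbounded_iter_lower.
Qed.

Lemma pairingZl c h g : finop g -> pairing q (c *: h) g = c * pairing q h g.
Proof.
by move=> fing; have := @pairing_suml _ [:: tt] (fun=> h) (fun=> c) g fing; rewrite !big_seq1.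
Qed.

Definition eunit a b : infmx R n := fun k l => ((k == a) && (l == b))%:R.

Lemma finop_eunit a b : finop (eunit a b).
Proof.
apply: (sub_finite_set _ (finite_set1 (a, b))) => -[k l] /=.
rewrite /eunit; case: (eqVneq k a) => [->|_]; case: (eqVneq l b) => [->|_] //=;
  by rewrite eqxx.
Qed.

Lemma nu_weight_neq0 k : nu_weight q k != 0.
Proof.
rewrite fmorph_eq0 weightE mulf_neq0// !expf_neq0 ?invr_eq0 ?expf_neq0 ?q_neq0//.
Qed.

Lemma pairing_eunit h a b : pairing q h (eunit b a) = h a b * nu_weight q a.
Proof.
rewrite /pairing (fsum_only (x := (a, b))) /eunit /= ?eqxx ?mulr1// => -[k l] /=.
by rewrite xpair_eqE => /negPf E; rewrite andbC E mulr0 mul0r.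
Qed.

(** Matrix units separate infinite matrices. *)
Lemma pairing_inj s s' : (forall g, finop g -> pairing q s g = pairing q s' g) -> s = s'.
Proof.
move=> E; apply/funext => a; apply/funext => b.
have := E _ (finop_eunit b a); rewrite !pairing_eunit => /mulIf; apply.
exact: nu_weight_neq0.
Qed.

Lemma int_nu_inj s s' : (forall g, finop g ->
  int_nu q (opmul s g) = int_nu q (opmul s' g)) -> s = s'.
Proof.
move=> E; apply: pairing_inj => g fing.
have nz : (qpoch Q Q n)%:C != 0 by rewrite fmorph_eq0 gt_eqF// hq_gt0.
by apply: (mulfI nz); rewrite -!int_nuE// E.
Qed.

Variable al : R.
Hypothesis al_gt0 : 0 < al.
Local Notation x := (q `^ (2 * al + 2)).
Local Notation t := ((q `^ (2 * al))%:C).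
Local Notation C := (qpoch x Q n).

Lemma powR_shiftE : x = q `^ (2 * al) * Q.
Proof.
case/andP: q01 => q0 q1; rewrite powRD.
  by rewrite powR_mulrn ?ltW.
by apply/implyP => _; rewrite gt_eqF.
Qed.

Lemma powR_shiftCE : x%:C = t * Qc.
Proof. by rewrite powR_shiftE rmorphM rmorphXn. Qed.

Lemma qpoch_rmorph (y z : R) m : (qpoch y z m)%:C = qpoch y%:C z%:C m.
Proof.
rewrite /qpoch rmorph_prod; apply: eq_bigr => j _.
by rewrite rmorphB rmorph1 rmorphM rmorphXn.
Qed.

Lemma C_neq0 : C%:C != 0.
Proof. by rewrite fmorph_eq0 gt_eqF// qpoch_gt0// x_ge0. Qed.

(** x = t Q splits x^|p| into t^|p| and the factor Q^|p| of kappa. *)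
Lemma wt2_kappa a b p :
  q ^+ (cross a p + cross b p) * wt2 q al (madd a p, p) =
  C * hnorm q a * ((q `^ (2 * al)) ^+ deg p * kappa q a b p).
Proof.
rewrite wt2E /kappa powR_shiftE exprMn exprD.
have h1 := hnorm_neq0 q01 a; have h2 := hnorm_neq0 q01 p.
by rewrite (exprD Q); field; rewrite h1 h2.
Qed.

Lemma zpow_scal_opmul K f a b : fbounded K f -> zpow_scal q al (opmul f (zpow q b)) a =
  (C * hnorm q a)%:C * qexp_lower qc K t f a b.
Proof.
move=> Kf; rewrite /zpow_scal.
rewrite -(@fsbig_widen _ _ _ _ [set lp : mindex n * mindex n | lp.1 = madd a lp.2])//=; last first.
  move=> [l p] [_ /= /eqP lp]; rewrite zpow_entry (negPf lp).
  by rewrite conjc0 !mul0r.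
rewrite (reindex_fsbig (fun p => (madd a p, p)) setT); last first.
  by split=> [p _ //|p p' _ _ []//|[l p] /= ->]; exists p.
rewrite qexp_lowerE// mulr_fsumr -[LHS](@fsbig_widen _ _ _ _ [set r | (deg r < K)%N])//=; last first.
  move=> p [_ /negP]; rewrite -leqNgt => Kp /=; rewrite (zpowE _ b) opmul_monopr.
  rewrite Kf ?mul0r ?mulr0 ?mul0r// deg_madd.
  by rewrite (leq_trans Kp (leq_addl _ _)).
apply: eq_fsbigr => p _; rewrite zpow_entry eqxx conjc_real (zpowE _ b) opmul_monopr -crossE.
transitivity ((q ^+ (cross a p + cross b p) * wt2 q al (madd a p, p))%:C *
  f (madd a p) (madd b p)).
  by move: (wt2 _ _ _) => w; rewrite exprD !rmorphM /=; ring.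
by rewrite wt2_kappa !rmorphM !rmorphXn /=; ring.
Qed.

(** The norm of z^a in the denominator cancels hnorm a and leaves the Pochhammer
symbol (Q^(n+1) t; Q)_|a|. *)
Lemma toeplitz_mxE K f a b : fbounded K f ->
  toeplitz_mx q al f a b =
  C%:C * (qpoch (Qc ^+ n.+1 * t) Qc (deg a) * qexp_lower qc K t f a b).
Proof.
move=> Kf; rewrite /toeplitz_mx /toeplitz proj_coef//; last first.
  apply/finopP; exists (K + deg b)%N => k p kp; rewrite zpowE opmul_monopr.
  rewrite Kf ?mul0r// deg_madd; case/orP: kp => H.
    by rewrite (leq_trans (leq_addr _ _) H).
  by rewrite (leq_trans (leq_trans (leq_addr _ _) H) (leq_addl _ _)) orbT.
rewrite (zpow_scal_opmul _ _ Kf) /zpow_norm2 fmorph_div /= qpoch_rmorph.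
have -> : (x * Q ^+ n)%:C = Qc ^+ n.+1 * t.
  by rewrite rmorphM /= powR_shiftCE !rmorphXn /= (exprS Qc n); ring.
rewrite rmorphXn; have h1 : (hnorm q a)%:C != 0 by rewrite fmorph_eq0 hnorm_neq0.
have h2 : qpoch (Qc ^+ n.+1 * t) Qc (deg a) != 0.
  have := zpow_norm2_gt0 q01 al_gt0 a; rewrite /zpow_norm2 => /lt0r_neq0.
  rewrite mulf_eq0 invr_eq0 negb_or => /andP[_].
  rewrite -(fmorph_eq0 (real_complex R)) /= qpoch_rmorph.
  have -> : (x * Q ^+ n)%:C = Qc ^+ n.+1 * t.
    by rewrite rmorphM /= powR_shiftCE !rmorphXn /= (exprS Qc n); ring.
  by rewrite rmorphXn.
by rewrite rmorphM; field; rewrite h1 h2.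
Qed.

(** The defining property determines the symbol, because the pairing with finite
functions is nondegenerate. *)
Lemma symbolE T s : (forall g, finop g ->
    int_nu q (opmul s g) = qtrace q al (opmul T (toeplitz_mx q al g))) ->
  symbol q al T = s.
Proof.
move=> sE; rewrite /symbol; case: xgetP => [s' _ s'E|/(_ s)//].
by apply: int_nu_inj => g fing; rewrite s'E// sE.
Qed.

(** The Toeplitz matrices of f and g carry the factors (Q^(n+1) t; Q)_|a| of M_t
for rows and columns, and transposing e(t E) from g to the other side gives
e(t F). *)
Lemma berezinE K f : fbounded K f ->
  berezin q al f = C%:C *: berezin_core qc K t f.
Proof.
move=> Kf; apply: symbolE => g fing.
have [L Lg] : exists L, fbounded L g by apply/finopP.
rewrite int_nuE// pairingZl// /berezin_core (pairing_qexp_raise _ _ Lg) /qtrace.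
have finT : finop (toeplitz_mx q al g).
  apply/finopP; exists L => k l kl; rewrite (toeplitz_mxE _ _ Lg).
  by rewrite (fbounded_qexp_lower _ _ _ Lg)// !mulr0.
rewrite sum_opmul_diag// fmorph_div /= -!mulrA; congr (_ * _).
have -> : pairing q (toeplitz_mx q al f) (toeplitz_mx q al g) =
    pairing q ((C%:C * C%:C) *: poch_scale qc t (qexp_lower qc K t f)) (qexp_lower qc L t g).
  apply: eq_fsbigr => -[k l] _ /=.
  rewrite (toeplitz_mxE _ _ Kf) (toeplitz_mxE _ _ Lg) infmxZE /poch_scale; ring.
rewrite pairingZl; last by apply/finopP; exists L; exact: fbounded_qexp_lower.
by rewrite !mulrA mulVf ?C_neq0// mul1r.
Qed.

End BerezinFormula.

(** * The Laplace operator in closed form *)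

Section BerezinPolynomial.
Variables (R : realType) (n : nat) (q : R).
Hypothesis n_gt0 : (0 < n)%N.
Hypothesis q01 : 0 < q < 1.
Local Notation Q := (q ^+ 2).
Local Notation qc := (q%:C).
Local Notation Qc := (q%:C ^+ 2).
Implicit Types (f g h s : infmx R n) (k l p a b : mindex n).

Let qc0 : qc != 0 := qc_neq0 q01.
Let qcr : forall N, 1 - Qc ^+ N.+1 != 0 := Qc_reg q01.

Definition cpoly (m : nat) : {poly R[i]} := \prod_(j < m) (1 - (Qc ^+ j.+1) *: 'X).

Lemma cpolyE (t : R[i]) : (cpoly n).[t] = qpoch (Qc * t) Qc n.
Proof.
rewrite /cpoly horner_prod; apply: eq_bigr => j _.
by rewrite !hornerE exprS mulrAC.
Qed.

Lemma cpoly_coef m : (cpoly m)`_0 = 1 /\ (cpoly m)`_1 = - \sum_(j < m) Qc ^+ j.+1.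
Proof.
elim: m => [|m [IH0 IH1]]; first by rewrite /cpoly big_ord0 big_ord0 oppr0 !coef1.
rewrite /cpoly big_ord_recr /= -/(cpoly m) mulrBr mulr1 -scalerAr.
rewrite !(coefB, coefZ, coefMX) /= IH0 IH1 mulr0 subr0 mulr1 big_ord_recr /=.
by rewrite opprD.
Qed.

(** The geometric sum of Q, ..., Q^n. *)
Lemma cpoly_coef1 : (1 - Qc) * (cpoly n)`_1 = Qc ^+ n.+1 - Qc.
Proof.
rewrite (cpoly_coef n).2 mulrN; elim: n => [|m IH].
  by rewrite big_ord0 mulr0 oppr0 expr1 subrr.
rewrite big_ord_recr /= mulrDr opprD IH (exprS Qc m.+1); ring.
Qed.

Lemma pairing_finite g : finop g -> exists r : seq (mindex n * mindex n),
  forall h, pairing q h g = \sum_(kl <- r) h kl.1 kl.2 * g kl.2 kl.1 * nu_weight q kl.1.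
Proof.
move=> /finopP[K Kg].
exists (fset_set (@square n K)) => h.
rewrite /pairing -(@fsbig_widen _ _ _ _ (@square n K))//=; last first.
  by move=> kl [_ nA]; apply/eqP; apply: contra_notT nA; exact: squareP.
by rewrite fsbig_finite//; exact: (finite_square n K).
Qed.

Section FixedFunction.
Variables (K : nat) (f : infmx R n) (P : mindex n -> mindex n -> {poly R[i]}).
Hypothesis Kf : fbounded K f.
Hypothesis PE : forall k l t, (P k l).[t] = berezin_core qc K t f k l.

Lemma berezin_horner al : 0 < al ->
  berezin q al f = fun k l => (cpoly n * P k l).[(q `^ (2 * al))%:C].
Proof.
move=> al0; rewrite (berezinE q01 al0 Kf).
apply/funext => k; apply/funext => l; rewrite infmxZE hornerM PE cpolyE.
congr (_ * _); rewrite (qpoch_rmorph (q `^ (2 * al + 2)) Q n) (powR_shiftCE q01 al).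
by congr (qpoch _ _ _); [exact: mulrC|exact: rmorphXn].
Qed.

(** The pairing with g is a finite sum, so the polynomials of the entries combine
to one polynomial; its values at t = Q^(i+1), that is alpha = i + 1, determine
it. *)
Lemma berezin_polyP g : finop g -> exists2 p : {poly R[i]}, berezin_poly q f g = p &
  p`_1 = int_nu q (opmul (fun k l => (cpoly n * P k l)`_1) g).
Proof.
move=> fing; have [r rE] := pairing_finite fing.
pose p0 : {poly R[i]} := (qpoch Q Q n)%:C *:
  \sum_(kl <- r) (g kl.2 kl.1 * nu_weight q kl.1) *: (cpoly n * P kl.1 kl.2).
exists p0; last first.
  rewrite int_nuE// rE coefZ coef_sum; congr (_ * _); apply: eq_bigr => kl _.
  by rewrite coefZ; ring.
have p0E al : 0 < al -> p0.[(q `^ (2 * al))%:C] = int_nu q (opmul (berezin q al f) g).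
  move=> al0; rewrite int_nuE// rE hornerZ horner_sum berezin_horner//.
  by congr (_ * _); apply: eq_bigr => kl _; rewrite hornerZ; ring.
rewrite /berezin_poly; case: xgetP => [p _ pE|/(_ p0)//].
apply: (eq_poly_seq (Qpow_inj qc0 qcr)) => i /=.
have -> : Qc ^+ i.+1 = (q `^ (2 * i.+1%:R))%:C.
  rewrite -natrM powR_mulrn; last by case/andP: q01 => /ltW.
  by rewrite rmorphXn exprM.
by rewrite pE ?p0E// ltr0n.
Qed.

Lemma dberezin0E : dberezin0 q f = fun k l => (cpoly n * P k l)`_1.
Proof.
set s0 := (RHS).
have s0E g : finop g -> int_nu q (opmul s0 g) = (berezin_poly q f g)^`().[0].
  move=> fing; have [p -> pE] := berezin_polyP fing.
  by rewrite horner_coef0 coef_deriv mulr1n pE.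
rewrite /dberezin0; case: xgetP => [s _ sE|/(_ s0)//].
by apply: (int_nu_inj q01) => g fing; rewrite sE// s0E.
Qed.

End FixedFunction.

(** The Laplace operator solved for from the expression of W, defined by explicit
formulas on all infinite matrices. It agrees with [laplace] on finite functions
([laplaceE]). *)
Definition lap_formula f : infmx R n :=
  (Qc ^+ n * (1 - Qc) ^+ 2)^-1 *: (shift_op qc f - (Qc + Qc ^+ n.+1) *: f).

(** The derivative at 0 of the entry (Q t; Q)_n D_t f is the first coefficient of
D_t f minus (Q + ... + Q^n) f, and [bcoef1] gives the first coefficient. *)
Lemma laplaceE f : finop f -> laplace q f = lap_formula f.
Proof.
move=> /finopP[K Kf]; have [P PE] := berezin_core_polyfun qc K f.
rewrite /laplace (dberezin0E Kf PE); apply/funext => k; apply/funext => l.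
rewrite /lap_formula !(infmxZE, infmxDE, infmxNE).
have Kb := fbounded_bounded Kf.
have := bcoef1 qc0 qcr Kb PE => /(congr1 (fun h : infmx R n => h k l)).
have := bcoef0 Kb PE => E0.
have E0kl : (P k l)`_0 = f k l by rewrite -[in RHS]E0.
rewrite E0 !(infmxZE, infmxDE, infmxNE) => E1.
rewrite coefM big_ord_recl big_ord1 lift0 /= subnn E0kl (cpoly_coef n).1 mul1r.
have r1 := qcr 0; rewrite expr1 in r1.
have nz : Qc ^+ n != 0 by rewrite !expf_neq0.
have c1 := cpoly_coef1.
have -> : (q ^- (2 * n) / (1 - Q))%:C = (Qc ^+ n * (1 - Qc))^-1.
  rewrite fmorph_div fmorphV rmorphB rmorph1 !rmorphXn /= exprM invfM//.
rewrite -[LHS]mulr1 -(divff r1) expr2.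
transitivity ((Qc ^+ n * (1 - Qc) * (1 - Qc))^-1 *
  ((1 - Qc) * (P k l)`_1 + (1 - Qc) * (cpoly n)`_1 * f k l)).
  by field; rewrite r1 nz.
by rewrite E1 c1; field; rewrite r1 nz.
Qed.

Lemma finop_lap_formula f : finop f -> finop (lap_formula f).
Proof.
move=> ff; apply/finopZ/finopD; first exact: finop_shift_op.
by rewrite -scaleNr; exact: finopZ.
Qed.

Lemma shift_op_linear : linear (shift_op qc : infmx R n -> infmx R n).
Proof.
move=> c g h; rewrite /shift_op (lower_is_linear qc) (raise_is_linear qc).
rewrite (deg_scale_is_linear _ 1 c) (deg_scale_is_linear _ Qc c); exact: scale_sum4.
Qed.

Lemma lap_formula_linear : linear lap_formula.
Proof. by move=> c g h; rewrite /lap_formula shift_op_linear; exact: scale_affine2. Qed.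

Lemma shift_op_lap_formula g :
  shift_op qc g = (Qc + Qc ^+ n.+1) *: g + (Qc ^+ n * (1 - Qc) ^+ 2) *: lap_formula g.
Proof.
rewrite /lap_formula scalerA divff; first by rewrite scale1r addrC subrK.
by have := qcr 0; rewrite expr1 => r1; rewrite mulf_neq0 ?expf_neq0.
Qed.

Lemma polyop_laplace f (p : {poly R[i]}) : finop f ->
  polyop (laplace q) p f = polyop lap_formula p f.
Proof.
move=> ff; apply: eq_bigr => i _; congr (_ *: _).
suff [-> //] : iter i (laplace q) f = iter i lap_formula f /\ finop (iter i lap_formula f).
elim: (i : nat) => [|m [IH1 IH2]] //=.
by rewrite IH1 laplaceE//; split=> //; exact: finop_lap_formula.
Qed.

End BerezinPolynomial.

Theorem proposition5p5 (R : realType) (n : nat) (n_ge1 : (1 <= n)%N)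
    (q : R) (q01 : 0 < q < 1) (alpha : R) (alpha_gt0 : 0 < alpha)
    (f : infmx R n) (f_fin : finop f) :
  let t := q `^ (2 * alpha) in
  exists2 S : infmx R n,
    infmx_cvg
      (fun N => \sum_(j < N)
         (t ^+ j * q ^+ (2 * j) *
          (qpoch (q ^+ (2 * j + 2)) (q ^+ 2) n.-1 /
           qpoch (q ^+ 2) (q ^+ 2) n.-1))%:C
         *: polyop (@laplace R n q) (berezin_pj q%:C n j) f) S
    & berezin q alpha f = (qpoch (q ^+ 2 * t) (q ^+ 2) n)%:C *: S.
Proof.
move=> t; have [K Kf] : exists K, fbounded K f by apply/finopP.
have [P PE] := berezin_core_polyfun q%:C K f.
exists (berezin_core q%:C K t%:C f); last first.
  by rewrite (berezinE q01 alpha_gt0 Kf) powR_shiftE// [q ^+ 2 * t]mulrC.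
move=> k l; rewrite -PE.
have termE j : (t ^+ j * q ^+ (2 * j) *
          (qpoch (q ^+ (2 * j + 2)) (q ^+ 2) n.-1 /
           qpoch (q ^+ 2) (q ^+ 2) n.-1))%:C
         *: polyop (@laplace R n q) (berezin_pj q%:C n j) f =
    t%:C ^+ j *: (fun k l => (P k l)`_j).
  rewrite polyop_laplace//.
  have -> := bcoefE n_ge1 (qc_neq0 q01) (Qc_reg q01) (fbounded_bounded Kf) PE
    (lap_formula_linear q) (shift_op_lap_formula q01) j.
  rewrite /series_poly polyopZ scalerA; congr (_ *: _).
  rewrite (series_coefE n_ge1 (Qc_reg q01)) -mulrA rmorphM rmorphXn; congr (_ * _).
  by rewrite rmorphM /= fmorph_div /= !qpoch_rmorph !rmorphXn.
apply: cvg_near_cst; exists (size (P k l)) => // N /= PN.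
rewrite infmx_sumE (@horner_coef_wide _ N)//; apply: eq_bigr => j _.
by rewrite termE infmxZE mulrC.
Qed.
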